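(* Let $X$ be a closed connected surface, and for a weighted (generalized) triangulation $(T,\Phi)$ of $X$ with vertex set $V$ consider the condition $$(\ast)\qquad \frac{2\pi|I|\,\chi(X)}{|V|}>-\sum_{(e,v)\in Lk(I)}(\pi-\Phi(e))+2\pi\chi(F_I)\quad\text{for every nonempty proper subset } I\subset V.$$ (a) If $\chi(X)>0$, then $(\ast)$ holds for every weighted generalized triangulation $(T,\Phi)$ of $X$ for which there is no null homotopic loop consisting of 3 edges $e_1,e_2,e_3$ with $\sum_{i=1}^3\Phi(e_i)\ge\pi$. (b) If $\chi(X)=0$, then $(\ast)$ holds for every weighted triangulation $(T,\Phi)$ of $X$ satisfying the following two conditions: (i) for any three edges $e_1,e_2,e_3$ forming a null homotopic loop in $X$, if $\sum_{i=1}^3\Phi(e_i)\ge\pi$, then these three edges form the boundary of a triangle of $T$; (ii) for any four edges $e_1,\dots,e_4$ forming a null homotopic loop in $X$, if $\sum_{i=1}^4\Phi(e_i)\ge2\pi$, then these edges form the boundary of the union of two adjacent triangles of $T$.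
   Context: A generalized triangulation $T$ of a surface $X$ is a cell-division of $X$ into vertices, edges and triangles (sets $V,E,F$) whose lift to the universal cover is a triangulation. In particular each triangle lifts to an embedding in the universal cover, there are no vertices of degree 1 or 2, there are no null homotopic loops formed by at most 2 edges, and (in the universal cover) there is at most one triangle with three given vertices. A weight is a function $\Phi:E\to[0,\pi/2]$; a (generalized) triangulation with a weight is called weighted. ''Edges forming a null homotopic loop'' means that they are the successive edges of a closed edge path which is null homotopic in $X$ and has no backtracking (it lifts to a simple closed edge cycle in the universal cover). For $I\subset V$, $F_I$ is the subcomplex of $T$ consisting of all cells whose vertices are all in $I$, $\chi$ denotes Euler characteristic, and $Lk(I)$ is the set of pairs $(e,v)$ of an edge $e$ and a vertex $v$ such that the end points of $e$ are not in $I$, $v\in I$, and $e$ and $v$ form a triangle of $T$. If, in a generalized triangulation, $e$ and $v$ form more than one triangle, the pair $(e,v)$ is counted once for each such triangle. *)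

(* Defs.v *)
From HB Require Import structures.
From mathcomp Require Import all_boot all_order all_algebra.
From mathcomp Require Import all_classical all_reals all_analysis.

Set Implicit Arguments.
Unset Strict Implicit.
Unset Printing Implicit Defensive.

Import Order.TTheory GRing.Theory Num.Theory.
Import numFieldNormedType.Exports.

Local Open Scope classical_set_scope.
Local Open Scope ring_scope.

Definition homeo_on (A B : topologicalType) (U : set A) (W : set B)
    (f : A -> B) : Prop :=
  exists g : B -> A,
    [/\ {within U, continuous f}, {within W, continuous g},
        set_fun U W f & set_fun W U g] /\
    {in U, cancel f g} /\ {in W, cancel g f}.

Definition closed_surface (R : realType) (X : topologicalType) : Prop :=
  [/\ hausdorff_space X, compact [set: X] &
      forall x : X, exists (U : set X) (W : set (R * R)%type) (f : X -> R * R),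
        [/\ open U, U x, open W & homeo_on U W f]].

(* Paths and loops are functions on R of which only the restriction to [0, 1]
   matters. *)
Definition null_homotopic (R : realType) (X : topologicalType)
    (c : R -> X) : Prop :=
  exists H : R * R -> X,
    [/\ {within `[0, 1] `*` `[0, 1], continuous H},
        forall s : R, s \in `[0, 1] -> H (s, 0) = c s,
        forall t : R, t \in `[0, 1] -> H (0, t) = c 0,
        forall t : R, t \in `[0, 1] -> H (1, t) = c 0 &
        forall s : R, s \in `[0, 1] -> H (s, 1) = c 0].

Definition simply_connected (R : realType) (Y : topologicalType) : Prop :=
  [/\ [set: Y] !=set0,
      forall x y : Y, exists c : R -> Y,
        [/\ {within `[0, 1], continuous c}, c 0 = x & c 1 = y] &
      forall c : R -> Y,
        {within `[0, 1], continuous c} -> c 0 = c 1 -> null_homotopic c].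

Definition covering_map (Y X : topologicalType) (p : Y -> X) : Prop :=
  [/\ continuous p, set_surj [set: Y] [set: X] p &
      forall x : X, exists (U : set X) (I : Type) (S : I -> set Y),
        [/\ open U, U x, p @^-1` U = \bigcup_i S i, trivIset [set: I] S &
            forall i, open (S i) /\ homeo_on (S i) U p]].

Definition universal_covering (R : realType) (Y X : topologicalType)
    (p : Y -> X) : Prop :=
  covering_map p /\ simply_connected R Y.

Definition simplex (R : realType) : set (R * R) :=
  [set u | [/\ 0 <= u.1, 0 <= u.2 & u.1 + u.2 <= 1]].

Definition open_simplex (R : realType) : set (R * R) :=
  [set u | [/\ 0 < u.1, 0 < u.2 & u.1 + u.2 < 1]].

Definition corner (R : realType) (i : 'I_3) : R * R :=
  ((i == 1%N :> nat)%:R, (i == 2%N :> nat)%:R).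

(* Side i of the standard triangle runs from corner i to corner i + 1 (mod 3);
   it is opposite to corner i + 2. *)
Definition side_point (R : realType) (i : 'I_3) (s : R) : R * R :=
  ((1 - s) * (corner R i).1 + s * (corner R (ordS i)).1,
   (1 - s) * (corner R i).2 + s * (corner R (ordS i)).2).

Definition simplex_side (R : realType) (i : 'I_3) : set (R * R) :=
  @side_point R i @` `[0, 1].

(* A family of singular triangles is simplicial if each of them is embedded and
   any two of them with different images meet in the empty set, in a common
   vertex or in a common side.  (In particular two edges with the same end
   points coincide, and so do two triangles with the same vertices.) *)
Definition simplicial (R : realType) (Y : topologicalType)
    (F : set (R * R -> Y)) : Prop :=
  (forall a, F a -> set_inj (@simplex R) a) /\
  (forall a b, F a -> F b ->
    let meet := (a @` @simplex R) `&` (b @` @simplex R) in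
    [\/ a @` @simplex R = b @` @simplex R,
        meet = set0,
        exists i j, meet = [set a (corner R i)] /\ meet = [set b (corner R j)] |
        exists i j, meet = a @` @simplex_side R i /\
                    meet = b @` @simplex_side R j]).

(* Incidence data.  A dart (e, b) is the edge e with an orientation: its own
   parametrization for b = false, the reverse one for b = true.  [org] gives the
   initial vertex of a dart, and [side f i] the dart along which the i-th side
   of the triangle f is glued. *)
Record incidence := Incidence {
  vert : finType;
  edge : finType;
  face : finType;
  org : edge * bool -> vert;
  side : face -> 'I_3 -> edge * bool
}.

Definition dart (K : incidence) : finType := (edge K * bool)%type.

Definition rev_dart (K : incidence) (d : dart K) : dart K := (d.1, ~~ d.2).

(* (f, i) stands both for the i-th side and for the i-th corner of f. *)
Definition tri_corner (K : incidence) : finType := (face K * 'I_3)%type.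

Definition side_edge (K : incidence) (c : tri_corner K) : edge K :=
  (side c.1 c.2).1.

Definition corner_vert (K : incidence) (c : tri_corner K) : vert K :=
  org (side c.1 c.2).

(* Two darts with the same origin v are consecutive in the link of v when they
   span a corner of a triangle. *)
Definition link_adj (K : incidence) : rel (dart K) :=
  fun d d' => [exists c : tri_corner K,
    [set d; d']%SET ==
    [set side c.1 c.2; rev_dart (side c.1 (ord_pred c.2))]%SET].

(* The incidences of a surface without boundary: the triangles are glued along
   their sides in pairs and the link of each vertex is a single circle.  For a
   cell division of a closed connected surface these conditions are automatic
   (invariance of domain); they are part of the notion of cell division here. *)
Definition surface_incidence (K : incidence) : Prop :=
  [/\ forall e : edge K, #|[set c : tri_corner K | side_edge c == e]%SET| = 2%N,
      forall v : vert K, exists d : dart K, org d = v &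
      forall d d' : dart K, org d = org d' -> connect (@link_adj K) d d'].

Definition open_cell_points (R : realType) (K : incidence) :
    set (vert K + (edge K * R + face K * (R * R))) :=
  [set z | match z with
           | inl _ => True
           | inr (inl es) => es.2 \in `]0, 1[
           | inr (inr fu) => open_simplex fu.2
           end].

(* A cell division of X: characteristic maps of the vertices, edges (on [0, 1])
   and triangles (on the standard simplex), the triangles being attached side by
   side to edges, such that X is the disjoint union of the open cells. *)
Record cell_division (R : realType) (X : topologicalType) := CellDivision {
  cells :> incidence;
  vmap : vert cells -> X;
  emap : edge cells -> R -> X;
  fmap : face cells -> R * R -> X;
  emap_continuous : forall e, {within `[0, 1], continuous (emap e)};
  fmap_continuous : forall f, {within @simplex R, continuous (fmap f)};
  emap_org : forall e,
    emap e 0 = vmap (org (e, false)) /\ emap e 1 = vmap (org (e, true));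
  fmap_side : forall f i (s : R), s \in `[0, 1] ->
    fmap f (side_point i s) =
    emap (side f i).1 (if (side f i).2 then 1 - s else s);
  open_cells : set_bij (@open_cell_points R cells) [set: X]
    (fun z => match z with
              | inl v => vmap v
              | inr (inl es) => emap es.1 es.2
              | inr (inr fu) => fmap fu.1 fu.2
              end);
  cells_surface : surface_incidence cells
}.

Definition is_triangulation (R : realType) (X : topologicalType)
    (T : cell_division R X) : Prop :=
  simplicial (range (@fmap R X T)).

Definition lifted_triangles (R : realType) (Y X : topologicalType)
    (p : Y -> X) (T : cell_division R X) : set (R * R -> Y) :=
  [set a | {within @simplex R, continuous a} /\
           exists f, forall u, simplex u -> p (a u) = fmap (c := T) f u].

Definition is_generalized_triangulation (R : realType) (X : topologicalType)
    (T : cell_division R X) : Prop :=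
  exists (Y : topologicalType) (p : Y -> X),
    universal_covering R p /\ simplicial (lifted_triangles p T).

Definition is_weight (R : realType) (K : incidence) (Phi : edge K -> R) : Prop :=
  forall e, 0 <= Phi e <= pi / 2.

Definition dart_map (R : realType) (X : topologicalType)
    (T : cell_division R X) (d : dart T) (s : R) : X :=
  emap d.1 (if d.2 then 1 - s else s).

(* The darts d, p_0, p_1, ... run through successively, each in unit time. *)
Fixpoint walk (R : realType) (X : topologicalType) (T : cell_division R X)
    (d : dart T) (p : seq (dart T)) (s : R) : X :=
  if p is d' :: p' then
    if s <= 1 then dart_map d s else walk d' p' (s - 1)
  else dart_map d s.

(* p is a closed edge path without backtracking (also at its base point) which
   is null homotopic in X. *)
Definition null_homotopic_edge_loop (R : realType) (X : topologicalType)
    (T : cell_division R X) (p : seq (dart T)) : Prop :=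
  if p is d :: p' then
    [/\ cycle (fun d d' => org (rev_dart d) == org d') p,
        cycle (fun d d' => d' != rev_dart d) p &
        null_homotopic (fun s => walk d p' (s * (size p)%:R))]
  else False.

Definition edges_of (K : incidence) (p : seq (dart K)) : seq (edge K) :=
  [seq d.1 | d <- p].

Definition weight_sum (R : realType) (K : incidence) (Phi : edge K -> R)
    (p : seq (dart K)) : R :=
  \sum_(e <- edges_of p) Phi e.

Definition bounds_triangle (K : incidence) (es : seq (edge K)) : Prop :=
  exists f : face K, perm_eq es [seq side_edge (f, i) | i <- enum 'I_3].

(* c and c' are the two sides along which the triangles c.1 and c'.1 meet; the
   boundary of their union consists of the other four sides. *)
Definition bounds_two_triangles (K : incidence) (es : seq (edge K)) : Prop :=
  exists c c' : tri_corner K,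
    [/\ c.1 != c'.1, side_edge c = side_edge c' &
        perm_eq es
          [:: side_edge (c.1, ordS c.2); side_edge (c.1, ord_pred c.2);
              side_edge (c'.1, ordS c'.2); side_edge (c'.1, ord_pred c'.2)]].

Definition edge_in (K : incidence) (I : {set vert K}) (e : edge K) : bool :=
  (org (e, false) \in I) && (org (e, true) \in I).

Definition edge_off (K : incidence) (I : {set vert K}) (e : edge K) : bool :=
  (org (e, false) \notin I) && (org (e, true) \notin I).

(* The Euler characteristic of the full subcomplex F_I spanned by I. *)
Definition chi_sub (K : incidence) (I : {set vert K}) : int :=
  #|I|%:Z - #|[set e | edge_in I e]%SET|%:Z +
  #|[set f : face K | [forall i, corner_vert (f, i) \in I]]%SET|%:Z.

(* chi(X), computed as that of the finite cell complex dividing X. *)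
Definition chi (K : incidence) : int :=
  #|vert K|%:Z - #|edge K|%:Z + #|face K|%:Z.

Definition opposite_edge (K : incidence) (c : tri_corner K) : edge K :=
  side_edge (c.1, ordS c.2).

(* Lk(I): a corner c stands for the pair formed by the opposite edge and the
   vertex at c, so that a pair is listed once for each triangle it forms. *)
Definition Lk (K : incidence) (I : {set vert K}) : {set tri_corner K} :=
  [set c | (corner_vert c \in I) && edge_off I (opposite_edge c)]%SET.

Definition condition_star (R : realType) (K : incidence)
    (Phi : edge K -> R) : Prop :=
  forall I : {set vert K}, (I != finset.set0) -> (I != [set: vert K]%SET) ->
    2 * pi * #|I|%:R * (chi K)%:~R / #|vert K|%:R >
    - (\sum_(c in Lk I) (pi - Phi (opposite_edge c))) +
    2 * pi * (chi_sub I)%:~R.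

(* Main.v *)
Require Import Defs.
From mathcomp Require Import all_boot all_order all_algebra.
From mathcomp Require Import all_classical all_reals all_analysis.
From mathcomp Require Import zify ring lra.
From Stdlib Require Setoid.

(** Both sides of the inequality are additive over the connected components of
    I, because no triangle and no edge meets two of them ([star_additive]).  So
    let I = C be connected.

    The full subcomplex F_C lacks some triangle, so its triangles can be
    collapsed one after another through free edges, and what remains is a
    connected graph.  Hence chi(F_C) <= 1, and if chi(F_C) = 1 the graph is a
    tree and every closed edge walk in F_C contracts across triangles
    ([collapse], [chi_le1]).  When chi(F_C) <= 0 the inequality is clear, up to
    the nonemptiness of Lk(C) if chi(X) = 0 ([link_nonempty]).

    Let chi(F_C) = 1.  The edges that leave C are permuted cyclically by walking
    around C through the triangles that have vertices both in C and outside.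
    The triangles met on the way that have just one vertex in C contribute the
    edges of Lk(C), which make up a closed walk outside C; pushed across the
    triangles it becomes a closed walk in F_C, so it is null homotopic.  If it
    backtracks at a vertex b, then b has a single neighbour outside C, and adding
    b to C keeps chi = 1 and shortens Lk(C) by two.  If no triangle has just one
    vertex in C, then some vertex b has all its neighbours in C, and adding b to
    C gives chi = 2, which is only possible for the whole surface, a sphere.
    Therefore ([boundary_dichotomy]) either X is a sphere, C misses k + 1
    vertices and Lk(C) has at least 2 k elements, or some C' containing C, again
    with chi = 1 and with a smaller link, is surrounded by a null homotopic edge
    loop p without backtracking, made of distinct elements of Lk(C').

    In the first case chi(X) = 2 and the inequality is a matter of counting.  In
    the second, if it failed, then, all angles pi - Phi(e) being at least pi / 2,
    the loop p would have at most 3 edges if chi(X) > 0 and at most 4 if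
    chi(X) = 0.  Null homotopic loops with one or two edges do not exist.  They
    lift to closed edge paths in the universal cover, where the triangles form a
    simplicial family ([no_null_loop1], [no_null_loop2]); if chi(X) = 0, the
    triangles are simplicial already in X, so that the edges form a simple graph
    ([triangulation_no_loop], [triangulation_simple]).  The hypotheses on
    the weight leave only the loops that bound one triangle or two adjacent
    triangles when chi(X) = 0.  These are impossible: if B is the set of vertices
    of p, then chi(F_(C' + B)) = 1 + chi(F_B) ([chi_union]), and chi(F_B) >= 1
    for the vertices of one triangle or of two adjacent ones
    ([no_triangle_loop], [no_two_triangles_loop]); so this sum is at least 2,
    although it is at most 1 on a proper subset and equal to chi(X) = 0 on the
    whole of V.

    The statement speaks of null homotopy in X, so contractions across triangles
    are turned into homotopies of paths ([walk_equiv_homotopic]).  Connectedness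
    of X gives that of the graph of edges ([cells_combinatorial]). *)

Set Implicit Arguments.
Unset Strict Implicit.
Unset Printing Implicit Defensive.

Import Order.TTheory GRing.Theory Num.Theory.
Import numFieldNormedType.Exports.

Local Open Scope ring_scope.

(** * Flags of a triangulated surface *)

(** A flag (f, i, b) is a side of a triangle together with one of its two
    orientations.  Its dart runs along the side; equivalently the flag marks a
    corner of f and one of the two sides of f at that corner.  The three moves
    [flip], [turn] and [cross] change the end of the side, the side at the corner
    and the triangle along the edge, respectively.  This local description is
    insensitive to the orientability of the surface. *)
Definition flag (K : incidence) : finType := (tri_corner K * bool)%type.

Definition flag_dart (K : incidence) (x : flag K) : dart K :=
  ((side x.1.1 x.1.2).1, (side x.1.1 x.1.2).2 (+) x.2).

Definition flip (K : incidence) (x : flag K) : flag K := (x.1, ~~ x.2).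

Definition turn (K : incidence) (x : flag K) : flag K :=
  (x.1.1, if x.2 then ordS x.1.2 else ord_pred x.1.2, ~~ x.2).

(** The corner of the triangle at the origin of the dart of the flag. *)
Definition flag_corner (K : incidence) (x : flag K) : tri_corner K :=
  (x.1.1, if x.2 then ordS x.1.2 else x.1.2).

(** An edge is glued to exactly two sides of triangles (possibly of the same
    triangle); this is the other one. *)
Definition other_slot (K : incidence) (c : tri_corner K) : tri_corner K :=
  odflt c [pick c' | (side_edge c' == side_edge c) && (c' != c)].

(** The orientation is adjusted so that the dart stays the same. *)
Definition cross (K : incidence) (x : flag K) : flag K :=
  (other_slot x.1,
   x.2 (+) (side x.1.1 x.1.2).2
       (+) (side (other_slot x.1).1 (other_slot x.1).2).2).

Definition vert_adj (K : incidence) : rel (vert K) :=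
  fun v w => [exists d : dart K, (org d == v) && (org (rev_dart d) == w)].

(** The compatibility of sides at corners and the connectedness of the graph are
    not part of [surface_incidence]; for a cell division of a connected space they
    come from the topology. *)
Definition combinatorial_surface (K : incidence) : Prop :=
  [/\ surface_incidence K,
      forall (f : face K) (i : 'I_3),
        org (rev_dart (side f i)) = org (side f (ordS i)) &
      forall v w : vert K,
        connect (@vert_adj K) v w].

Definition dest (K : incidence) (d : dart K) : vert K := org (rev_dart d).

Section Flags.
Variable K : incidence.
Implicit Types (x : flag K) (d : dart K).

Lemma rev_dartK : involutive (@rev_dart K).
Proof. by case=> e b; rewrite /rev_dart /= negbK. Qed.

Lemma rev_dart_neq d : rev_dart d != d.
Proof. by case: d => e []; rewrite /rev_dart xpair_eqE /= andbF. Qed.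

Lemma same_edge d d' : d.1 = d'.1 -> d = d' \/ d = rev_dart d'.
Proof.
case: d d' => e b [e' b'] /= ->; rewrite /rev_dart /=.
by case: b b' => [] []; [left|right|right|left].
Qed.

Lemma dest_rev d : dest (rev_dart d) = org d.
Proof. by rewrite /dest rev_dartK. Qed.

Lemma flipK : involutive (@flip K).
Proof. by case=> c b; rewrite /flip /= negbK. Qed.

Lemma flag_dart_flip x : flag_dart (flip x) = rev_dart (flag_dart x).
Proof. by case: x => c b; rewrite /flag_dart /flip /rev_dart /= addbN. Qed.

Lemma turnK : involutive (@turn K).
Proof. by case=> -[f i] []; rewrite /turn /= ?ordSK ?ord_predK. Qed.

Lemma ordS3 (i : 'I_3) : ordS (ordS (ordS i)) = i.
Proof. by apply/val_inj; case: i => -[|[|[|]]]. Qed.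

Lemma ord_pred3 (i : 'I_3) : ord_pred i = ordS (ordS i).
Proof. by apply/val_inj; case: i => -[|[|[|]]]. Qed.

Lemma ordS_neq (i : 'I_3) : ordS i != i.
Proof. by case: i => -[|[|[|]]]. Qed.

Lemma ordSS_neq (i : 'I_3) : ordS (ordS i) != i.
Proof. by case: i => -[|[|[|]]]. Qed.

(** The six flags of a triangle form a hexagon under [flip] and [turn]. *)
Lemma hexagon x : turn (flip (turn x)) = flip (turn (flip x)).
Proof.
by case: x => -[f i] []; rewrite /turn /flip /= !ord_pred3 ?ordS3.
Qed.

Lemma flag_corner_turn x : flag_corner (turn x) = flag_corner x.
Proof.
by case: x => -[f i] []; rewrite /turn /flag_corner //= ord_pred3 ordS3.
Qed.

Lemma flag_corner_eq x y : flag_corner x = flag_corner y -> y = x \/ y = turn x.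
Proof.
case: x y => -[f i] b [[g j] c]; rewrite /flag_corner /= => -[-> +].
case: b c => -[] /=; rewrite /turn /=.
- by move=> /(congr1 (fun i => ordS (ordS i))); rewrite !ordS3 => ->; left.
- by move=> <-; right.
- by move=> ->; right; rewrite ord_pred3 ordS3.
by move=> ->; left.
Qed.

Hypothesis Ksurf : combinatorial_surface K.

Lemma dest_side (f : face K) (i : 'I_3) : dest (side f i) = org (side f (ordS i)).
Proof. by case: Ksurf => _ + _; apply. Qed.

Lemma org_flag_dart x : org (flag_dart x) = corner_vert (flag_corner x).
Proof.
case: x => -[f i] []; rewrite /flag_dart /flag_corner /corner_vert /=.
  by rewrite addbT -dest_side.
by rewrite addbF; case: (side f i).
Qed.

Lemma org_turn x : org (flag_dart (turn x)) = org (flag_dart x).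
Proof. by rewrite !org_flag_dart flag_corner_turn. Qed.

Lemma other_slotP (c : tri_corner K) :
  side_edge (other_slot c) = side_edge c /\ other_slot c != c.
Proof.
rewrite /other_slot; case: pickP => [c' /andP[/eqP-> ->]//|nc].
case: Ksurf => -[/(_ (side_edge c)) + _ _] _ _.
have -> : [set c0 | side_edge c0 == side_edge c]%SET = [set c]%SET.
  apply/finset.setP => c'; rewrite !inE.
  have := nc c'; case: (eqVneq c' c) => [->|_]; first by rewrite eqxx.
  by rewrite andbT => ->.
by rewrite cards1.
Qed.

Lemma slotP (c c' : tri_corner K) :
  side_edge c' = side_edge c -> c' = c \/ c' = other_slot c.
Proof.
move=> e; have [e1 n1] := other_slotP c.
case: Ksurf => -[/(_ (side_edge c)) /eqP/cards2P[u [v [uv E]]] _ _] _ _.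
have M z : side_edge z = side_edge c -> (z == u) || (z == v).
  by move=> h; have := in_set2 z u v; rewrite -E inE h eqxx.
move: n1; have := M _ e; have := M _ e1; have := M c erefl.
case/orP => /eqP ->; case/orP => /eqP ->; case/orP => /eqP ->;
  rewrite ?eqxx //= => _; by [left|right].
Qed.

Lemma other_slotK : involutive (@other_slot K).
Proof.
move=> c; have [e n] := other_slotP c.
have [e' n'] := other_slotP (other_slot c).
have [//|/eqP] := slotP (etrans e' e).
by rewrite (negPf n').
Qed.

Lemma crossK : involutive (@cross K).
Proof.
by case=> c b; rewrite /cross /= other_slotK -!addbA; congr (_, _);
   case: b (_.2) (_.2) => [] [] [].
Qed.

Lemma cross_neq x : cross x != x.
Proof.
case: x => c b; rewrite /cross /= xpair_eqE negb_and.
by have [_ ->] := other_slotP c.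
Qed.

Lemma flag_dart_cross x : flag_dart (cross x) = flag_dart x.
Proof.
case: x => c b; have [e n] := other_slotP c; rewrite /flag_dart /cross /=.
rewrite [(side _ _).1]e; congr (_, _).
by case: b (_.2) (_.2) => [] [] [].
Qed.

Lemma flag_dart_eq x y : flag_dart x = flag_dart y -> y = x \/ y = cross x.
Proof.
move=> e; have e1 : side_edge y.1 = side_edge x.1 by case: e.
case: (slotP e1) => e2.
  left; move: e2 e; clear; case: x y => c b [c' b'] /= ->.
  by move=> /(congr1 snd) h; congr (_, _); apply/esym/(addbI h).
right; move: e2 (etrans (flag_dart_cross x) e); clear; case: x y => c b [c' b'] /= ->.
by move=> /(congr1 snd) h; congr (_, _); apply/esym/(addbI h).
Qed.

Lemma flag_at (s : tri_corner K) d :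
  side_edge s = d.1 -> exists2 x, x.1 = s & flag_dart x = d.
Proof.
move=> e; exists (s, d.2 (+) (side s.1 s.2).2) => //.
rewrite /flag_dart /= [(side _ _).1]e; case: d {e} => e b; congr (_, _).
by rewrite /= addbC -addbA addbb addbF.
Qed.

Lemma flag_dart_surj d : exists x, flag_dart x = d.
Proof.
case: Ksurf => -[/(_ d.1) /eqP/cards2P[c [c' [_ E]]] _ _] _ _.
have : c \in [set c; c']%SET by rewrite !inE eqxx.
by rewrite -E inE => /eqP/flag_at[x _]; exists x.
Qed.

(** Adjacency in the link of a vertex, which is an equality of unordered pairs, is
    rephrased with the move [turn]; then symmetry needs no separate treatment. *)
Lemma link_adjP d d' :
  reflect (exists2 x, flag_dart x = d & flag_dart (turn x) = d') (link_adj d d').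
Proof.
apply: (iffP existsP) => [[c /eqP E]|[x <- <-]].
  pose x : flag K := (c, false).
  have e1 : flag_dart x = side c.1 c.2 by rewrite /flag_dart /= addbF; case: (side _ _).
  have e2 : flag_dart (turn x) = rev_dart (side c.1 (ord_pred c.2)).
    by rewrite /flag_dart /= addbT; case: (side _ _).
  rewrite -e1 -e2 in E.
  have := set21 d d'; have := set22 d d'; rewrite E !inE.
  have := set21 (flag_dart x) (flag_dart (turn x));
    have := set22 (flag_dart x) (flag_dart (turn x)); rewrite -E !inE.
  move=> h1 h2 h3 h4; case: (eqVneq d (flag_dart x)) => [ed|nd].
    exists x => //; case/orP: h1 => /eqP e //.
    by case/orP: h3 => /eqP -> //; rewrite e ed.
  have ed' : d' = flag_dart x by move: h2; rewrite eq_sym (negPf nd) => /eqP.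
  have et : d = flag_dart (turn x) by move: h4; rewrite (negPf nd) => /eqP.
  by exists (turn x); rewrite ?turnK.
case: x => -[f i] [].
  exists (f, ordS i); rewrite finset.setUC /= ordSK /flag_dart /= addbT addbF.
  by case: (side f i) => ? ?; case: (side f (ordS i)).
exists (f, i); rewrite /flag_dart /= addbT addbF.
by case: (side f i) => ? ?; case: (side f (ord_pred i)).
Qed.

(** The link of a vertex is connected, so a property that passes from one dart to
    the next around the vertex and holds for one dart holds for all.  This is how
    the neighbours of a vertex are determined below. *)
Lemma link_closed (S : pred (dart K)) (d0 d : dart K) :
    (forall x, S (flag_dart x) -> org (flag_dart x) = org d0 -> S (flag_dart (turn x))) ->
  S d0 -> org d = org d0 -> S d.
Proof.
move=> cl S0 e.
have /connectP[p pth ->] : connect (@link_adj K) d0 d.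
  by case: Ksurf => -[_ _ h] _ _; apply: h.
have H q d1 : S d1 -> org d1 = org d0 -> path (@link_adj K) d1 q -> S (last d1 q).
  elim: q d1 => //= d2 q IH d1 S1 e1 /andP[/link_adjP[x xd tx] qth].
  by apply: IH qth; rewrite -tx ?org_turn ?cl ?xd.
exact: H.
Qed.

End Flags.

(** * Contracting edge walks across triangles *)

Fixpoint is_walk (K : incidence) (v : vert K) (p : seq (dart K)) (w : vert K) : bool :=
  if p is d :: p' then (org d == v) && is_walk (dest d) p' w else v == w.

Definition rev_walk (K : incidence) (p : seq (dart K)) : seq (dart K) :=
  rev (map (@rev_dart K) p).

(** Homotopy of edge walks across triangles, as a congruence on arbitrary lists
    of darts.  Intermediate lists need not be walks, which keeps the relation a
    plain congruence for rewriting; [walk_equiv_homotopic] shows that nothing is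
    lost for closed walks. *)
Inductive walk_equiv (K : incidence) : seq (dart K) -> seq (dart K) -> Prop :=
| walk_equiv_refl p : walk_equiv p p
| walk_equiv_sym p q : walk_equiv p q -> walk_equiv q p
| walk_equiv_trans p q r : walk_equiv p q -> walk_equiv q r -> walk_equiv p r
| walk_equiv_cat p p' q q' : walk_equiv p p' -> walk_equiv q q' -> walk_equiv (p ++ q) (p' ++ q')
| walk_equiv_cancel d : walk_equiv [:: d; rev_dart d] [::]
| walk_equiv_face x :
    walk_equiv [:: flag_dart x; flag_dart (turn (flip x)); rev_dart (flag_dart (turn x))] [::].

#[local] Hint Resolve walk_equiv_refl : core.

#[local] Instance walk_equiv_equivalence K : RelationClasses.Equivalence (@walk_equiv K).
Proof.
split; [exact: walk_equiv_refl | exact: walk_equiv_sym | exact: walk_equiv_trans].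
Qed.

#[local] Instance walk_equiv_cat_proper K : Morphisms.Proper (Morphisms.respectful (@walk_equiv K)
  (Morphisms.respectful (@walk_equiv K) (@walk_equiv K))) cat.
Proof. by move=> p p' hp q q' hq; exact: walk_equiv_cat. Qed.

Section EdgeHomotopy.
Variable K : incidence.
Implicit Types (x : flag K) (d : dart K) (p q : seq (dart K)) (v w : vert K).

Lemma is_walk_cat v p w q z : is_walk v p w -> is_walk w q z -> is_walk v (p ++ q) z.
Proof.
elim: p v => [|d p IH] v /=; first by move/eqP->.
by case/andP => -> /IH h /h ->.
Qed.

Lemma rev_walk_cons d p : rev_walk (d :: p) = rev_walk p ++ [:: rev_dart d].
Proof. by rewrite /rev_walk /= rev_cons -cats1. Qed.

Lemma rev_walkK : involutive (@rev_walk K).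
Proof.
move=> p; rewrite /rev_walk map_rev revK -map_comp map_id_in // => d _ /=.
by rewrite rev_dartK.
Qed.

Lemma is_walk_rev v p w : is_walk v p w -> is_walk w (rev_walk p) v.
Proof.
elim: p v => [|d p IH] v /=; first by rewrite eq_sym.
case/andP => /eqP <- /IH h; rewrite rev_walk_cons; apply: is_walk_cat h _.
by rewrite /= dest_rev !eqxx.
Qed.

Lemma walk_equiv_rev p : walk_equiv (p ++ rev_walk p) [::].
Proof.
elim: p => // d p IH; rewrite rev_walk_cons catA -cat1s -(catA [:: d]) IH.
exact: walk_equiv_cancel.
Qed.

Lemma walk_equiv_revl p : walk_equiv (rev_walk p ++ p) [::].
Proof. by rewrite -{2}(rev_walkK p); exact: walk_equiv_rev. Qed.

(** A contractible conjugate of a list is enough to contract the list. *)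
Lemma walk_equiv_conj q p : walk_equiv (q ++ p ++ rev_walk q) [::] -> walk_equiv p [::].
Proof.
move=> h; rewrite -(walk_equiv_revl q) -{2}[q]cat0s -h.
have -> : rev_walk q ++ (q ++ p ++ rev_walk q) ++ q = (rev_walk q ++ q) ++ p ++ (rev_walk q ++ q).
  by rewrite !catA.
by rewrite walk_equiv_revl cats0.
Qed.

Lemma walk_equiv_turn x :
  walk_equiv [:: flag_dart (turn x)] [:: flag_dart x; flag_dart (turn (flip x))].
Proof.
set t := [:: flag_dart (turn x)]; set r := [:: _; _].
have -> : walk_equiv r (r ++ (rev_walk t ++ t)) by rewrite walk_equiv_revl cats0.
have f : walk_equiv (r ++ rev_walk t) [::] by exact: walk_equiv_face.
by rewrite catA f.
Qed.

Definition edge_adj (E : {set edge K}) : rel (vert K) :=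
  fun v w => [exists d : dart K, [&& d.1 \in E, org d == v & dest d == w]].

Definition spans (C : {set vert K}) (E : {set edge K}) : Prop :=
  {in E, forall e, (org (e, false) \in C) && (org (e, true) \in C)}.

Definition edge_connected (C : {set vert K}) (E : {set edge K}) : Prop :=
  {in C &, forall v w, connect (edge_adj E) v w}.

(** The subgraph with edge set E is simply connected within the surface. *)
Definition null_walks (E : {set edge K}) : Prop :=
  forall v p, is_walk v p v -> all (fun d => d.1 \in E) p -> walk_equiv p [::].

Lemma spans_org (C : {set vert K}) (E : {set edge K}) d :
  spans C E -> d.1 \in E -> (org d \in C) && (dest d \in C).
Proof.
by move=> s /s; rewrite /dest /rev_dart; case: d => e [] //=; rewrite andbC.
Qed.

Lemma connect_closed_pred (T : finType) (e : rel T) (S : pred T) (a0 b0 : T) :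
  (forall a b, S a -> e a b -> S b) -> S a0 -> connect e a0 b0 -> S b0.
Proof.
move=> cl + /connectP[p + ->]; elim: p a0 => //= b p IH a Sa /andP[/(cl _ _ Sa)].
exact: IH.
Qed.

(** A spanning tree is grown vertex by vertex.  [tau v] is the walk to v in the
    tree.  Keeping only the relation between tau and the edges of the tree avoids
    speaking of the tree itself: it says that every tree edge closes up a
    contractible loop. *)
Lemma grow_tree (C : {set vert K}) (E : {set edge K}) r k :
    r \in C -> spans C E -> edge_connected C E -> (k < #|C|)%N ->
  exists (S : {set vert K}) (ES : {set edge K}) (tau : vert K -> seq (dart K)),
    [/\ #|S| = k.+1, #|ES| = k, r \in S & S \subset C] /\
    [/\ ES \subset E, spans S ES &
        forall d, d.1 \in ES ->
          walk_equiv (tau (org d) ++ [:: d] ++ rev_walk (tau (dest d))) [::]].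
Proof.
move=> rC sp cn; elim: k => [_|k IH kC].
  exists [set r]%SET, finset.set0, (fun=> [::]); split; split.
  - by rewrite cards1.
  - by rewrite cards0.
  - by rewrite !inE.
  - by rewrite finset.sub1set.
  - by rewrite finset.sub0set.
  - by move=> e; rewrite finset.in_set0.
  - by move=> d; rewrite finset.in_set0.
have [S [ES [tau [[cS cE rS SC] [ESE sS treeE]]]]] := IH (ltnW kC).
have [d [dE oS eS]] : exists d, [/\ d.1 \in E, org d \in S & dest d \notin S].
  apply: contrapT => nex.
  have sub : C \subset S.
    apply/fintype.subsetP => v vC; apply: (@connect_closed_pred _ _ (fun a => a \in S) r v _ rS
      (cn r v rC vC)).
    move=> a b aS /existsP[d /and3P[dE /eqP oa /eqP eb]].
    by apply: contraT => bS; case: nex; exists d; rewrite dE oa eb aS bS.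
  by have := leq_trans kC (subset_leq_card sub); rewrite cS ltnn.
have nES : d.1 \notin ES by apply: contraNN eS => /(spans_org sS)/andP[].
pose tau' v := if v == dest d then tau (org d) ++ [:: d] else tau v.
have tauS v : v \in S -> tau' v = tau v.
  by rewrite /tau'; case: eqP => // -> h; rewrite h in eS.
exists (dest d |: S)%SET, (d.1 |: ES)%SET, tau'; split; split.
- by rewrite cardsU1 eS cS.
- by rewrite cardsU1 nES cE.
- by rewrite !inE rS orbT.
- by rewrite finset.subUset finset.sub1set SC; have /andP[_ ->] := spans_org sp dE.
- by rewrite finset.subUset finset.sub1set ESE dE.
- move=> e; rewrite !inE => /orP[/eqP ->|/sS/andP[-> ->]]; last by rewrite !orbT.
  by move: oS; rewrite /dest /rev_dart; case: (d) => a [] /= -> ; rewrite eqxx !orbT.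
move=> d'; rewrite !inE => /orP[/eqP dd|d'E]; last first.
  by have /andP[h1 h2] := spans_org sS d'E; rewrite !tauS // treeE.
case: (same_edge dd) => ->.
  by rewrite (tauS _ oS) /tau' eqxx catA; exact: walk_equiv_rev.
rewrite dest_rev (tauS _ oS) /tau' -[org (rev_dart d)]/(dest d) eqxx.
rewrite -catA -[[:: d] ++ _]/([:: d; rev_dart d] ++ _) (walk_equiv_cancel d).
exact: walk_equiv_rev.
Qed.

(** A connected graph has at most one vertex more than edges; with equality the
    spanning tree is everything, so a closed walk is a product of the contractible
    loops given by its edges. *)
Lemma tree_bound (C : {set vert K}) (E : {set edge K}) r :
    r \in C -> spans C E -> edge_connected C E ->
  (#|C| <= #|E| + 1)%N /\ (#|C| = (#|E| + 1)%N -> null_walks E).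
Proof.
move=> rC sp cn.
have C0 : (0 < #|C|)%N by rewrite card_gt0; apply/finset.set0Pn; exists r.
have [|S [ES [tau [[cS cE rS SC] [ESE sS treeE]]]]] := @grow_tree C E r #|C|.-1 rC sp cn.
  by rewrite prednK.
have leE : (#|C| <= #|E| + 1)%N.
  by have := subset_leq_card ESE; rewrite cE -(prednK C0) addn1 ltnS.
split=> // eC v p.
have EE : ES = E.
  by apply/eqP; rewrite eqEcard ESE cE; move: eC; rewrite addn1 => ->; rewrite leqnn.
rewrite {}EE in treeE.
have H w : is_walk v p w -> all (fun d => d.1 \in E) p ->
    walk_equiv (tau v ++ p ++ rev_walk (tau w)) [::].
  elim: p v => [|d p IH] v /=; first by move/eqP-> => _; exact: walk_equiv_rev.
  case/andP=> /eqP <- h /andP[dE pE].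
  have := IH _ h pE; have := treeE d dE.
  set a := tau (org d); set b := tau (dest d); set c := p ++ _ => gd cd.
  have -> : walk_equiv (a ++ [:: d] ++ c) ((a ++ [:: d] ++ rev_walk b) ++ (b ++ c)).
    have -> : (a ++ [:: d] ++ rev_walk b) ++ b ++ c = a ++ [:: d] ++ (rev_walk b ++ b) ++ c.
      by rewrite !catA.
    by rewrite walk_equiv_revl.
  by rewrite gd cd.
by move=> h hE; apply: walk_equiv_conj (H v h hE).
Qed.

End EdgeHomotopy.

(** * Collapsing a subcomplex onto a tree *)

Section Collapse.
Variable K : incidence.
Hypothesis Ksurf : combinatorial_surface K.
Implicit Types (x : flag K) (d : dart K) (p q : seq (dart K)) (v w : vert K).

(** Dual connectedness: a property of darts that is stable under turning around
    vertices and under reversal spreads along the edges from vertex to vertex. *)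
Lemma spread_darts (S : pred (dart K)) (d0 d : dart K) :
    (forall x, S (flag_dart x) -> S (flag_dart (turn x))) ->
    (forall d, S d -> S (rev_dart d)) ->
  S d0 -> S d.
Proof.
move=> clt clr S0.
pose P v := [forall d : dart K, (org d == v) ==> S d].
have P0 : P (org d0).
  apply/forallP => d1; apply/implyP => /eqP e.
  by apply: (link_closed Ksurf _ S0 e) => x Sx _; exact: clt.
suff /forallP/(_ d) : P (org d) by rewrite eqxx.
have cn : connect (@vert_adj K)
    (org d0) (org d) by case: Ksurf => _ _; apply.
apply: connect_closed_pred P0 cn => v w /forallP Pv /existsP[d1 /andP[/eqP e1 /eqP e2]].
have S1 : S (rev_dart d1) by apply: clr; have := Pv d1; rewrite e1 eqxx.
apply/forallP => d2; apply/implyP => /eqP e.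
by apply: (link_closed Ksurf _ S1); rewrite ?e ?e2 // => x Sx _; exact: clt.
Qed.

(** A nonempty proper set of triangles has a free edge, since otherwise it would
    be closed under passing to adjacent triangles. *)
Lemma free_slot (A : {set face K}) :
    A != finset.set0 -> A != [set: face K]%SET ->
  exists t : tri_corner K, (t.1 \in A) && ((other_slot t).1 \notin A).
Proof.
move=> /finset.set0Pn[f fA] AT; apply/existsP; apply: contraR AT => /existsPn nex.
have cl (t : tri_corner K) : t.1 \in A -> (other_slot t).1 \in A.
  by move=> tA; have := nex t; rewrite tA /= negbK.
have same x y : flag_dart y = flag_dart x -> x.1.1 \in A -> y.1.1 \in A.
  by move=> /esym/(flag_dart_eq Ksurf)[->|->] //; exact: cl.
pose S d := [exists x : flag K, (flag_dart x == d) && (x.1.1 \in A)].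
have SP x : S (flag_dart x) = (x.1.1 \in A).
  apply/existsP/idP => [[y /andP[/eqP e yA]]|xA]; first by rewrite (same y).
  by exists x; rewrite eqxx.
rewrite -finset.subTset; apply/fintype.subsetP => g _.
rewrite -(SP ((g, ord0), false)).
apply: (@spread_darts S (flag_dart ((f, ord0), false))); last by rewrite SP.
  by move=> x; rewrite !SP.
move=> d; have [x <-] := flag_dart_surj Ksurf d.
by rewrite -flag_dart_flip !SP.
Qed.

Definition sides_in (A : {set face K}) (E : {set edge K}) : Prop :=
  forall t : tri_corner K, t.1 \in A -> side_edge t \in E.

Lemma edge_adj_sym (E : {set edge K}) : symmetric (edge_adj E).
Proof.
suff H v w : edge_adj E v w -> edge_adj E w v by move=> v w; apply/idP/idP; exact: H.
case/existsP => d /and3P[dE o e]; apply/existsP; exists (rev_dart d).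
by rewrite dest_rev dE o -[org _]/(dest d) e.
Qed.

Lemma edge_connect_sym (E : {set edge K}) : connect_sym (edge_adj E).
Proof. apply: sym_connect_sym; exact: edge_adj_sym. Qed.

Lemma walk_connect (E : {set edge K}) v p w :
  is_walk v p w -> all (fun d => d.1 \in E) p -> connect (edge_adj E) v w.
Proof.
elim: p v => [|d p IH] v /=; first by move/eqP-> => _; exact: connect0.
case/andP => /eqP <- h /andP[dE pE].
apply: connect_trans (IH _ h pE); apply: connect1.
by apply/existsP; exists d; rewrite dE !eqxx.
Qed.

Lemma walk_equiv_flatten (r : dart K -> seq (dart K)) p :
  (forall d, walk_equiv (r d) [:: d]) -> walk_equiv (flatten (map r p)) p.
Proof.
move=> h; elim: p => //= d p IH.
by rewrite IH (h d).
Qed.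

Lemma is_walk_flatten (r : dart K -> seq (dart K)) v p w :
  (forall d, is_walk (org d) (r d) (dest d)) -> is_walk v p w ->
  is_walk v (flatten (map r p)) w.
Proof.
move=> h; elim: p v => //= d p IH v /andP[/eqP <- /IH].
exact: is_walk_cat.
Qed.

(** The three darts x, [turn (flip x)] and the reverse of [turn x] run around the
    triangle of x. *)
Lemma org_triangle x :
  [/\ org (flag_dart (turn x)) = org (flag_dart x),
      org (flag_dart (turn (flip x))) = dest (flag_dart x) &
      dest (flag_dart (turn (flip x))) = dest (flag_dart (turn x))].
Proof.
split; first exact: org_turn.
  by rewrite (org_turn Ksurf) flag_dart_flip.
rewrite /dest -!flag_dart_flip -(org_turn Ksurf (flip (turn (flip x)))).
by rewrite -hexagon turnK.
Qed.

(** Induction on the number of triangles.  A triangle with a free edge is removed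
    together with that edge.  This keeps |C| - |E| + |A|, connectedness (the free
    edge is replaced by the two other sides) and the walks up to homotopy across
    the triangle.  At the end only a graph is left. *)
Lemma collapse (C : {set vert K}) (E : {set edge K}) (A : {set face K}) r :
    r \in C -> spans C E -> edge_connected C E -> sides_in A E ->
    A != [set: face K]%SET ->
  (#|C| + #|A| <= #|E| + 1)%N /\ ((#|C| + #|A|)%N = (#|E| + 1)%N -> null_walks E).
Proof.
move=> rC; move: {2}#|A| (leqnn #|A|) => n; elim: n E A => [|n IH] E A.
  rewrite leqn0 cards_eq0 => /eqP -> sp cn _ _.
  by rewrite cards0 addn0; exact: tree_bound rC sp cn.
move=> leA sp cn sA AT.
have [A0|An0] := eqVneq A finset.set0.
  by rewrite A0 cards0 addn0; exact: tree_bound rC sp cn.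
have [t /andP[tA otA]] := free_slot An0 AT.
pose x : flag K := (t, false).
pose e := side_edge t.
have eE : e \in E by exact: sA.
pose E' := (E :\ e)%SET; pose A' := (A :\ t.1)%SET.
have xd : flag_dart x = (e, (side t.1 t.2).2) by rewrite /flag_dart /= addbF.
have slot_ne (s : tri_corner K) : s.1 = t.1 -> s.2 != t.2 -> side_edge s \in E'.
  move=> s1 s2; rewrite !inE sA ?s1 // andbT; apply/eqP => /(slotP Ksurf)[est|est].
    by rewrite est eqxx in s2.
  by rewrite -est s1 tA in otA.
have t1E : (flag_dart (turn x)).1 \in E'.
  apply: (slot_ne (turn x).1) => //=; rewrite ord_pred3; exact: ordSS_neq.
have t2E : (flag_dart (turn (flip x))).1 \in E'.
  apply: (slot_ne (turn (flip x)).1) => //=; exact: ordS_neq.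
have sA' : sides_in A' E'.
  move=> s; rewrite !inE => /andP[st sAA]; rewrite sA // andbT.
  apply/eqP => /(slotP Ksurf)[est|est]; first by rewrite est eqxx in st.
  by rewrite -est sAA in otA.
have sp' : spans C E' by move=> a; rewrite !inE => /andP[_ /sp].
pose q := [:: flag_dart (turn x); rev_dart (flag_dart (turn (flip x)))].
have [oa ob oc] := org_triangle x.
have qw : is_walk (org (flag_dart x)) q (dest (flag_dart x)).
  by rewrite /= dest_rev oa ob -[org (rev_dart _)]/(dest _) oc !eqxx.
have qh : walk_equiv q [:: flag_dart x].
  rewrite /q -cat1s walk_equiv_turn; set a := flag_dart x; set b := flag_dart _.
  have -> : [:: a; b] ++ [:: rev_dart b] = [:: a] ++ [:: b; rev_dart b] by [].
  by rewrite (walk_equiv_cancel b).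
(* Walks are rewritten by replacing the free edge e with the path q. *)
pose rep d := if d.1 == e then (if d == flag_dart x then q else rev_walk q) else [:: d].
have repE d : d.1 \in E -> all (fun d => d.1 \in E') (rep d).
  rewrite /rep; case: eqP => [_ _|/eqP ne dE]; last by rewrite /= !inE ne dE.
  by case: ifP => _; rewrite /= ?t1E ?t2E.
have revx d : d.1 = e -> d != flag_dart x -> d = rev_dart (flag_dart x).
  move=> de /eqP nd; have : d.1 = (flag_dart x).1 by rewrite de xd.
  by case/same_edge.
have repw d : is_walk (org d) (rep d) (dest d).
  rewrite /rep; case: eqP => [de|_]; last by rewrite /= !eqxx.
  case: eqP => [->//|/eqP/(revx _ de) ->]; rewrite dest_rev.
  exact: is_walk_rev.
have reph d : walk_equiv (rep d) [:: d].
  rewrite /rep; case: eqP => [de|_] //.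
  case: eqP => [->//|/eqP/(revx _ de) ->].
  have -> : walk_equiv (rev_walk q) (rev_walk q ++ (q ++ [:: rev_dart (flag_dart x)])).
    have -> : walk_equiv (q ++ [:: rev_dart (flag_dart x)]) [::]; last by rewrite cats0.
    by rewrite qh; exact: walk_equiv_cancel.
  by rewrite catA walk_equiv_revl.
have cn' : edge_connected C E'.
  move=> v w vC wC; apply: connect_sub (cn v w vC wC).
  move=> a b /existsP[d /and3P[dE /eqP <- /eqP <-]].
  exact: walk_connect (repw d) (repE d dE).
have AT' : A' != [set: face K]%SET.
  by apply/eqP => /finset.setP/(_ t.1); rewrite !inE eqxx.
have cA : #|A| = #|A'|.+1 by rewrite (cardsD1 t.1) tA.
have cE : #|E| = #|E'|.+1 by rewrite (cardsD1 e) eE.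
have leA' : (#|A'| <= n)%N by rewrite -ltnS -cA.
have [le1 nw] := IH E' A' leA' sp' cn' sA' AT'.
rewrite cA cE addnS addSn ltnS; split=> // -[/nw {}nw] v p pw pE.
rewrite -(walk_equiv_flatten p reph); apply: (nw v); first exact: is_walk_flatten.
elim: p pE {pw} => //= d p IHp /andP[dE /IHp pE'].
by rewrite all_cat repE.
Qed.

End Collapse.

(** * Euler characteristics of full subcomplexes *)

Definition edges_in (K : incidence) (I : {set vert K}) : {set edge K} :=
  [set e | edge_in I e]%SET.

Definition faces_in (K : incidence) (I : {set vert K}) : {set face K} :=
  [set f : face K | [forall i, corner_vert (f, i) \in I]]%SET.

(** The vertex of the triangle opposite to the side of the flag. *)
Definition third (K : incidence) (x : flag K) : vert K := dest (flag_dart (turn x)).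

Definition full_connected (K : incidence) (I : {set vert K}) : Prop :=
  edge_connected I (edges_in I).

Definition count_corners (K : incidence) (I : {set vert K}) (f : face K) : nat :=
  \sum_(i < 3) (corner_vert (f, i) \in I).

(** These triangles measure the failure of additivity of the Euler
    characteristic; see [chi_union]. *)
Definition straddling (K : incidence) (C B : {set vert K}) : {set face K} :=
  [set f | (count_corners C f == 1%N) && (count_corners B f == 1%N)]%SET.

Section Counting.
Variable K : incidence.
Hypothesis Ksurf : combinatorial_surface K.
Implicit Types (x : flag K) (d : dart K) (C B I : {set vert K}).

Lemma sum3 (F : 'I_3 -> nat) :
  (\sum_(i < 3) F i = F ord0 + F (ordS ord0) + F (ordS (ordS ord0)))%N.
Proof.
rewrite !big_ord_recl big_ord0 addn0 addnA.
by congr (F _ + F _ + F _)%N; apply/val_inj.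
Qed.

Lemma forall3 (P : pred 'I_3) :
  [forall i, P i] = [&& P ord0, P (ordS ord0) & P (ordS (ordS ord0))].
Proof.
apply/forallP/and3P => [h|[h0 h1 h2] i]; first by split.
have : [|| i == ord0, i == ordS ord0 | i == ordS (ordS ord0)] by case: i => -[|[|[|]]].
by case/or3P => /eqP ->.
Qed.

Lemma edge_in_dart I d : edge_in I d.1 = (org d \in I) && (dest d \in I).
Proof. by case: d => e []; rewrite /edge_in /dest /rev_dart //= andbC. Qed.

Lemma spans_full I : spans I (edges_in I).
Proof. by move=> e; rewrite inE. Qed.

Lemma side_edge_in I (t : tri_corner K) :
  edge_in I (side_edge t) =
  (corner_vert t \in I) && (corner_vert (t.1, ordS t.2) \in I).
Proof. by rewrite edge_in_dart dest_side. Qed.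

Lemma sides_full I : sides_in (faces_in I) (edges_in I).
Proof.
case=> f i; rewrite !inE side_edge_in /= => /forallP h.
by rewrite (h i) (h (ordS i)).
Qed.

Lemma faces_in_proper I : I != [set: vert K]%SET -> faces_in I != [set: face K]%SET.
Proof.
apply: contraNN => /eqP E; rewrite -finset.subTset; apply/fintype.subsetP => v _.
have [d <-] : exists d : dart K, org d = v by case: Ksurf => -[_ + _] _ _; apply.
have [x <-] := flag_dart_surj Ksurf d.
rewrite org_flag_dart //; have : x.1.1 \in faces_in I by rewrite E inE.
by rewrite inE => /forallP; exact.
Qed.

Lemma chi_le1 C :
    C != finset.set0 -> C != [set: vert K]%SET -> full_connected C ->
  (chi_sub C <= 1)%R /\ (chi_sub C = 1 -> null_walks (edges_in C)).
Proof.
move=> /finset.set0Pn[r rC] CT cn.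
have [le nw] := collapse Ksurf rC (@spans_full C) cn (@sides_full C) (faces_in_proper CT).
rewrite /chi_sub -/(edges_in C) -/(faces_in C); split; first by lia.
by move=> h; apply: nw; lia.
Qed.

Lemma card_sum (T : finType) (P : pred T) : #|[set y | P y]%SET| = (\sum_y P y)%N.
Proof. by rewrite -sum1dep_card big_mkcond; apply: eq_bigr => y _; case: (P y). Qed.

Lemma sum_slots (P : pred (edge K)) :
  (\sum_(t : tri_corner K) P (side_edge t) = 2 * \sum_e P e)%N.
Proof.
rewrite (partition_big (@side_edge K) predT) //= big_distrr /=.
apply: eq_bigr => e _.
rewrite (eq_bigr (fun=> P e : nat)); last by move=> t /eqP ->.
rewrite sum_nat_const; congr (_ * _)%N.
have h : #|[set t | side_edge t == e]%SET| = 2%N by case: Ksurf => -[h _ _] _ _; exact: h.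
by apply: etrans h; apply: eq_card => t; rewrite !inE.
Qed.

(** The sides of triangles that join C to B are counted in two ways.  By edges,
    there are two for each edge joining C to B; by triangles, there are two for each
    triangle with vertices in both sets and none elsewhere, and one for each
    straddling triangle. *)
Lemma chi_union C B : [disjoint C & B] ->
  2 * chi_sub (C :|: B)%SET =
  2 * chi_sub C + 2 * chi_sub B - #|straddling C B|%:Z.
Proof.
move=> dCB.
have dis v : ~~ ((v \in C) && (v \in B)).
  by apply/negP => /andP[vC vB]; have := disjointFr dCB vC; rewrite vB.
pose cr e := (org (e, false) \in C) && (org (e, true) \in B) ||
             (org (e, false) \in B) && (org (e, true) \in C).
pose mix f := [&& count_corners (C :|: B)%SET f == 3%N, (0 < count_corners C f)%N
  & (0 < count_corners B f)%N].
have cE : #|edges_in (C :|: B)%SET| = (#|edges_in C| + #|edges_in B| + \sum_e cr e)%N.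
  rewrite /edges_in !card_sum -!big_split; apply: eq_bigr => e _.
  rewrite /edge_in /cr !inE; have := dis (org (e, false)); have := dis (org (e, true)).
  by do 4 case: (_ \in _).
have faceE I f : [forall i, corner_vert (f, i) \in I] = (count_corners I f == 3%N).
  by rewrite forall3 /count_corners sum3; do 3 case: (_ \in _).
have cF : #|faces_in (C :|: B)%SET| = (#|faces_in C| + #|faces_in B| + \sum_f mix f)%N.
  rewrite /faces_in !card_sum -!big_split; apply: eq_bigr => f _.
  rewrite !faceE /mix /count_corners !sum3 !inE.
  have := dis (corner_vert (f, ord0)); have := dis (corner_vert (f, ordS ord0)).
  have := dis (corner_vert (f, ordS (ordS ord0))).
  by do 6 case: (_ \in _).
have cT : (2 * \sum_e cr e = 2 * (\sum_f mix f) + #|straddling C B|)%N.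
  have crd d : cr d.1 = (org d \in C) && (dest d \in B) || (org d \in B) && (dest d \in C).
    by case: d => e []; rewrite /cr /dest /rev_dart //= [RHS]orbC andbC; congr (_ || _);
      rewrite andbC.
  rewrite -sum_slots /straddling card_sum big_distrr -big_split /=.
  rewrite -(pair_bigA _ (fun f i => cr (side_edge (f, i)) : nat)) /=.
  apply: eq_bigr => f _; rewrite sum3.
  rewrite /side_edge /= !crd !(dest_side Ksurf) ordS3 /mix /count_corners !sum3 !inE.
  rewrite -![org (side f _)]/(corner_vert (f, _)).
  have := dis (corner_vert (f, ord0)); have := dis (corner_vert (f, ordS ord0)).
  have := dis (corner_vert (f, ordS (ordS ord0))).
  by do 6 case: (_ \in _).
have cV : #|(C :|: B)%SET| = (#|C| + #|B|)%N.
  by rewrite cardsU disjoint_setI0 // cards0 subn0.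
rewrite /chi_sub -!/(edges_in _) -!/(faces_in _) cV cE cF.
by lia.
Qed.

Lemma straddlingP C B f : [disjoint C & B] -> f \in straddling C B ->
  exists x, [/\ x.1.1 = f, org (flag_dart x) \in B, dest (flag_dart x) \notin C,
                dest (flag_dart x) \notin B & third x \in C].
Proof.
move=> dCB; rewrite inE /count_corners !sum3.
have dis v : ~~ ((v \in C) && (v \in B)).
  by apply/negP => /andP[vC vB]; have := disjointFr dCB vC; rewrite vB.
pose V i := corner_vert (f, i).
have xF i : [/\ org (flag_dart ((f, i), false)) = V i, dest (flag_dart ((f, i), false)) = V (ordS i)
               & third ((f, i), false) = V (ordS (ordS i))].
  by rewrite /third /dest -!flag_dart_flip !org_flag_dart // /flag_corner /= ord_pred3; split.
have xT i : [/\ org (flag_dart ((f, i), true)) = V (ordS i), dest (flag_dart ((f, i), true)) = V i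
               & third ((f, i), true) = V (ordS (ordS i))].
  by rewrite /third /dest -!flag_dart_flip !org_flag_dart // /flag_corner /=; split.
rewrite -!/(V _).
have := dis (V ord0); have := dis (V (ordS ord0)); have := dis (V (ordS (ordS ord0))).
have w i (b : bool) : let x := (f, i, b) in
    [/\ org (flag_dart x) \in B, dest (flag_dart x) \notin C,
        dest (flag_dart x) \notin B & third x \in C] ->
    exists x, [/\ x.1.1 = f, org (flag_dart x) \in B, dest (flag_dart x) \notin C,
                dest (flag_dart x) \notin B & third x \in C].
  by move=> x [h1 h2 h3 h4]; exists x.
have [h1 h2 h3] := xF ord0; have [h4 h5 h6] := xF (ordS ord0);
  have [h7 h8 h9] := xF (ordS (ordS ord0)).
have [g1 g2 g3] := xT ord0; have [g4 g5 g6] := xT (ordS ord0);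
  have [g7 g8 g9] := xT (ordS (ordS ord0)).
rewrite !ordS3 in h6 h8 h9 g6 g7 g9.
case c0: (V ord0 \in C); case b0: (V ord0 \in B); case c1: (V (ordS ord0) \in C);
  case b1: (V (ordS ord0) \in B);
case c2: (V (ordS (ordS ord0)) \in C); case b2: (V (ordS (ordS ord0)) \in B) => // _ _ _ _.
- by apply: (w (ordS ord0) false); rewrite h4 h5 h6 c0 b1 c2 b2.
- by apply: (w (ordS ord0) true); rewrite g4 g5 g6 c0 b2 c1 b1.
- by apply: (w (ordS (ordS ord0)) true); rewrite g7 g8 g9 c1 b0 c2 b2.
- by apply: (w ord0 false); rewrite h1 h2 h3 c2 b0 c1 b1.
- by apply: (w (ordS (ordS ord0)) false); rewrite h7 h8 h9 c1 b2 c0 b0.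
by apply: (w ord0 true); rewrite g1 g2 g3 c2 b1 c0 b0.
Qed.

Lemma edges_in_sub C (D : {set vert K}) : C \subset D -> edges_in C \subset edges_in D.
Proof.
move=> /fintype.subsetP s; apply/fintype.subsetP => e; rewrite !inE /edge_in.
by case/andP => /s -> /s ->.
Qed.

Lemma connect_edge_adj_sub (E F : {set edge K}) v w : E \subset F ->
  connect (edge_adj E) v w -> connect (edge_adj F) v w.
Proof.
move=> /fintype.subsetP s; apply: connect_sub => a b /existsP[d /and3P[/s dF oa eb]].
by apply: connect1; apply/existsP; exists d; rewrite dF oa.
Qed.

Lemma full_connected_ext C B :
    full_connected C -> C != finset.set0 ->
    (forall b, b \in B -> exists2 d, org d \in C & dest d = b) ->
  full_connected (C :|: B)%SET.
Proof.
move=> cn /finset.set0Pn[r rC] adj.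
have H v : v \in (C :|: B)%SET -> connect (edge_adj (edges_in (C :|: B)%SET)) r v.
  have s : edges_in C \subset edges_in (C :|: B)%SET.
    by apply: edges_in_sub; exact: finset.subsetUl.
  rewrite finset.in_setU => /orP[vC|vB]; first exact: connect_edge_adj_sub s (cn _ _ rC vC).
  have [d dC dv] := adj v vB.
  apply: connect_trans (connect_edge_adj_sub s (cn _ _ rC dC)) _.
  apply: connect1; apply/existsP; exists d.
  by rewrite inE edge_in_dart dv !inE dC vB orbT !eqxx.
move=> v w vU wU; apply: connect_trans (H w wU).
by rewrite edge_connect_sym; exact: H.
Qed.

End Counting.

(** * The walk around a full subcomplex *)

Section BoundaryWalk.
Variable K : incidence.
Hypothesis Ksurf : combinatorial_surface K.
Variable C : {set vert K}.
Implicit Types (x y z : flag K) (d : dart K) (p q : seq (dart K)) (v w : vert K).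

Definition crossing x : bool := (org (flag_dart x) \notin C) && (dest (flag_dart x) \in C).

(** A triangle with a side that leaves C has exactly one other such side; the
    partner flag enters C along it.  Flags that do not enter C are fixed, so that
    this is an involution on all flags. *)
Definition partner x : flag K :=
  if ~~ crossing x then x
  else if third x \in C then turn x else flip (turn (flip x)).

(** One step of the walk around C: through a triangle to its other side that
    leaves C, then across that side into the next triangle. *)
Definition next_crossing x : flag K := cross (partner x).

Lemma third_turn x : third (turn x) = dest (flag_dart x).
Proof. by rewrite /third turnK. Qed.

(** The flag at the third vertex whose dart has the same destination. *)
Lemma far_flag_ends x :
  [/\ org (flag_dart (flip (turn (flip x)))) = third x,
      dest (flag_dart (flip (turn (flip x)))) = dest (flag_dart x) &
      third (flip (turn (flip x))) = org (flag_dart x)].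
Proof.
have [ha hb hc] := org_triangle Ksurf x.
split.
- by rewrite flag_dart_flip -[org _]/(dest _) hc.
- by rewrite flag_dart_flip dest_rev.
by rewrite /third hexagon flipK flag_dart_flip dest_rev (org_turn Ksurf).
Qed.

Lemma crossing_partner x : crossing (partner x) = crossing x.
Proof.
rewrite {1}/partner; case: ifP => [/negbTE //|/negbFE cx].
have [ha hb hc] := far_flag_ends x.
case: ifP => tx; rewrite cx /crossing ?ha ?hb ?tx; case/andP: cx => o_ d_.
  by rewrite (org_turn Ksurf) o_.
by rewrite d_.
Qed.

Lemma partnerK : involutive partner.
Proof.
move=> x; rewrite {1}/partner crossing_partner.
case: ifP => [|/negbFE cx]; first by rewrite /partner => ->.
have [ha hb hc] := far_flag_ends x; rewrite /partner cx /=.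
case: (boolP (third x \in C)) => tx.
  by rewrite third_turn; case/andP: cx => _ ->; rewrite turnK.
by rewrite hc; case/andP: cx => /negbTE -> _; rewrite !(flipK, turnK).
Qed.

Lemma partner_neq x : crossing x -> partner x != x.
Proof.
move=> cx; rewrite /partner cx /=; case: ifP => _.
  by case: x {cx} => c []; rewrite /turn xpair_eqE andbF.
by case: x {cx} => c []; rewrite /turn /flip xpair_eqE andbF.
Qed.

Lemma next_crossing_inj : injective next_crossing.
Proof. by apply: (can_inj (g := partner \o cross (K := K))) => x;
  rewrite /next_crossing /= (crossK Ksurf) partnerK. Qed.

Lemma crossing_next x : crossing (next_crossing x) = crossing x.
Proof. by rewrite /next_crossing {1}/crossing (flag_dart_cross Ksurf) -/(crossing _)
  crossing_partner. Qed.

Lemma crossing_iter n x : crossing (iter n next_crossing x) = crossing x.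
Proof. by elim: n => //= n IH; rewrite crossing_next. Qed.

(** The walk around C never meets a triangle a second time in the opposite
    direction: next_crossing is a product of two involutions, so if it led from x
    to its partner in n steps, it would lead from [next_crossing x] to the partner
    of that flag in n - 2 steps.  Down to n = 0 or 1 this contradicts the absence
    of fixed points. *)
Lemma partner_not_iter n x : crossing x -> iter n next_crossing x <> partner x.
Proof.
elim: n {-2}n (leqnn n) x => [|n IH] [|[|m]] //= lemn x cx.
- by move=> e; have := partner_neq cx; rewrite -e eqxx.
- by move=> e; have := partner_neq cx; rewrite -e eqxx.
- by move=> e; have := cross_neq Ksurf (partner x); rewrite -/(next_crossing x) e eqxx.
rewrite -!iterS iterSr /= => e.
apply: (IH m _ (next_crossing x)); [by apply: ltnW | by rewrite crossing_next|].
apply: next_crossing_inj; rewrite e {1}/next_crossing partnerK /next_crossing.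
by rewrite (crossK Ksurf).
Qed.

(** What a step of the walk around C contributes outside C: the side opposite to
    C if the triangle has just one vertex in C, and nothing otherwise. *)
Definition link_step x : seq (dart K) :=
  if third x \in C then [::] else [:: flag_dart (turn x)].

Definition link_corner x : tri_corner K := flag_corner (flip x).

Definition boundary_walk x n : seq (dart K) := flatten (map link_step (traject next_crossing x n)).

Definition link_corners x n : seq (tri_corner K) :=
  [seq link_corner y | y <- traject next_crossing x n & third y \notin C].

Lemma opposite_link_corner x : opposite_edge (link_corner x) = (flag_dart (turn x)).1.
Proof.
by case: x => -[f i] []; rewrite /opposite_edge /link_corner /side_edge /= ?ord_pred3.
Qed.

Lemma link_corner_Lk x : crossing x -> third x \notin C -> link_corner x \in Lk C.
Proof.
move=> /andP[ox dx] tx; rewrite inE opposite_link_corner; apply/andP; split.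
  by rewrite -(org_flag_dart Ksurf) flag_dart_flip.
have : (org (flag_dart (turn x)) \notin C) && (dest (flag_dart (turn x)) \notin C).
  by rewrite (org_turn Ksurf) ox.
by rewrite /dest /rev_dart; case: (flag_dart (turn x)) => e [] /=; rewrite /edge_off //= andbC.
Qed.

Lemma edges_boundary_walk x n : edges_of (boundary_walk x n) = map (@opposite_edge K)
  (link_corners x n).
Proof.
rewrite /boundary_walk /link_corners; elim: n x => //= n IH x; rewrite /edges_of map_cat.
rewrite -/(edges_of (flatten _)) IH /link_step; case: (third x \in C) => //=.
by rewrite opposite_link_corner.
Qed.

Lemma is_walk_boundary x n : crossing x ->
  is_walk (org (flag_dart x)) (boundary_walk x n) (org (flag_dart (iter n next_crossing x))).
Proof.
elim: n x => [|n IH] x cx; first by rewrite /= eqxx.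
rewrite iterSr /boundary_walk /=; apply: is_walk_cat (IH _ _); last by rewrite crossing_next.
rewrite /next_crossing (flag_dart_cross Ksurf) /partner cx /link_step /=; case: ifP => tx /=.
  by rewrite (org_turn Ksurf).
by have [-> _ _] := far_flag_ends x; rewrite (org_turn Ksurf) !eqxx.
Qed.

(** What the same step contributes inside C. *)
Definition inner_step x : seq (dart K) :=
  if third x \in C then [:: flag_dart (turn (flip x))] else [::].

(** In both kinds of triangles this is the contraction of the boundary of the
    triangle. *)
Lemma link_step_equiv x : crossing x ->
  walk_equiv (link_step x) ([:: flag_dart x] ++ inner_step x ++ [:: rev_dart (flag_dart (partner
    x))]).
Proof.
move=> cx; rewrite /link_step /inner_step /partner cx /=; case: ifP => tx /=.
  by apply: walk_equiv_sym; exact: walk_equiv_face.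
by rewrite flag_dart_flip rev_dartK; exact: walk_equiv_turn.
Qed.

(** The walk outside C is pushed across the triangles to a walk in C.  The
    connecting edges between consecutive triangles cancel. *)
Lemma boundary_walk_equiv x n : crossing x ->
  exists p, [/\ walk_equiv (boundary_walk x n) ([:: flag_dart x] ++ p ++ [:: rev_dart (flag_dart
    (iter n next_crossing x))]),
    is_walk (dest (flag_dart x)) p (dest (flag_dart (iter n next_crossing x))) &
    all (fun d => d.1 \in edges_in C) p].
Proof.
elim: n x => [|n IH] x cx.
  by exists [::]; split => //=; apply: walk_equiv_sym; exact: walk_equiv_cancel.
have [|p [ph pw pE]] := IH (next_crossing x); first by rewrite crossing_next.
have [ha hb hc] := org_triangle Ksurf x.
exists (inner_step x ++ p); split.
- rewrite iterSr /boundary_walk /= -/(boundary_walk (next_crossing x) n) ph (link_step_equiv cx).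
  set r := rev_dart (flag_dart (iter _ _ _)).
  have e : flag_dart (next_crossing x) = flag_dart (partner x) by rewrite /next_crossing
    (flag_dart_cross Ksurf).
  rewrite e; set s := flag_dart (partner x).
  have -> : ([:: flag_dart x] ++ inner_step x ++ [:: rev_dart s]) ++ [:: s] ++ p ++ [:: r] =
     ([:: flag_dart x] ++ inner_step x) ++ rev_walk [:: s] ++ [:: s] ++ (p ++ [:: r]).
    by rewrite -!catA.
  by rewrite [rev_walk _ ++ _]catA walk_equiv_revl -!catA.
- apply: is_walk_cat _ (_ : is_walk (dest (flag_dart (next_crossing x))) p _);
    last by rewrite iterSr.
  rewrite /next_crossing (flag_dart_cross Ksurf) /partner /inner_step cx /=; case: ifP => tx /=.
    by rewrite hb hc !eqxx.
  by have [_ -> _] := far_flag_ends x; rewrite eqxx.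
rewrite all_cat pE andbT /inner_step; case: ifP => // tx.
rewrite /all andbT inE edge_in_dart hb hc -/(third x) tx andbT.
by case/andP: cx.
Qed.

(** After a full turn the connecting edge is the same at both ends, so the walk
    outside is conjugate to a closed walk in C. *)
Lemma boundary_walk_null x n : null_walks (edges_in C) -> crossing x ->
  iter n next_crossing x = x -> walk_equiv (boundary_walk x n) [::].
Proof.
move=> nw cx e; have [p [ph]] := boundary_walk_equiv n cx; rewrite e in ph *.
move=> pw pE; rewrite ph (nw _ p pw pE); exact: walk_equiv_cancel.
Qed.

Lemma iter_order_next x : iter (order next_crossing x) next_crossing x = x.
Proof. exact: iter_order next_crossing_inj x. Qed.

(** A triangle could be met twice only in opposite directions, which
    [partner_not_iter] excludes. *)
Lemma link_corners_uniq x : crossing x -> uniq (link_corners x (order next_crossing x)).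
Proof.
move=> cx; rewrite map_inj_in_uniq ?filter_uniq ?orbit_uniq // => y z.
rewrite !mem_filter -/(orbit next_crossing x) -!fconnect_orbit => /andP[ty xy] /andP[tz xz].
have yz : fconnect next_crossing y z.
  by apply: connect_trans xz; rewrite fconnect_sym //; exact: next_crossing_inj.
have cy : crossing y by rewrite -(iter_findex xy) crossing_iter.
case/flag_corner_eq => [/(can_inj (@flipK K)) //|e].
case: (partner_not_iter (n := findex next_crossing y z) cy); rewrite (iter_findex yz).
by rewrite /partner cy /= (negbTE ty) -e flipK.
Qed.

Lemma link_corners_Lk x n : crossing x -> {subset link_corners x n <= Lk C}.
Proof.
move=> cx t /mapP[y]; rewrite mem_filter => /andP[ty /trajectP[k _ e]] ->.
by apply: link_corner_Lk => //; rewrite e crossing_iter.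
Qed.

(** If no triangle met in the walk around C has just one vertex in C, then the
    walk stays at a single vertex outside C, and it runs through the whole link of
    this vertex. *)
Lemma hole_darts x : crossing x ->
    (forall n, third (iter n next_crossing x) \in C) ->
  forall d, org d = org (flag_dart x) -> dest d \in C.
Proof.
move=> cx tn d.
pose S d := [exists y, fconnect next_crossing x y && (flag_dart y == d)].
have tC y : fconnect next_crossing x y -> [/\ crossing y, third y \in C & partner y = turn y].
  move=> xy; have cy : crossing y by rewrite -(iter_findex xy) crossing_iter.
  have ty : third y \in C by rewrite -(iter_findex xy).
  by rewrite /partner cy ty.
move=> e; have /existsP[y /andP[/tC[cy _ _] /eqP <-]] : S d; last by case/andP: cy.
apply: (link_closed Ksurf _ _ e); last by apply/existsP; exists x; rewrite connect0 eqxx.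
move=> z /existsP[y /andP[xy /eqP/(flag_dart_eq Ksurf) zy]] _.
have [cy ty by_] := tC y xy; apply/existsP.
case: zy => [->|->].
  exists (next_crossing y); rewrite -by_ (flag_dart_cross Ksurf) eqxx andbT.
  exact: connect_trans xy (fconnect1 _ _).
pose y' := finv next_crossing y.
have xy' : fconnect next_crossing x y' by apply: connect_trans xy (fconnect_finv _ _).
have ey : next_crossing y' = y by rewrite /y' f_finv //; exact: next_crossing_inj.
exists y'; rewrite xy' /=; have [_ _ e'] := tC y' xy'.
by rewrite -ey /next_crossing (crossK Ksurf) e' turnK.
Qed.

(** The dart d is the last contribution to the boundary walk before the flag x;
    hence d ends where the dart of x starts. *)
Definition after_step d x : Prop :=
  exists y k, [/\ crossing y, third y \notin C, d = flag_dart (turn y),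
    x = iter k.+1 next_crossing y &
    forall i, (0 < i <= k)%N -> third (iter i next_crossing y) \in C].

(** If the boundary walk arrives at a vertex along d and leaves it along the
    reverse of d, then the darts into C met in between together with the reverse of
    d close up to the whole link of that vertex. *)
Lemma backtracking_darts d x : after_step d x -> third x \notin C ->
    flag_dart (turn x) = rev_dart d ->
  forall d', org d' = org (flag_dart x) -> d' = rev_dart d \/ dest d' \in C.
Proof.
case=> y [k [cy ty dE xE inC]] tx tE d' od.
pose S d' := (d' == rev_dart d) || [exists i : 'I_k.+1,
  flag_dart (iter i.+1 next_crossing y) == d'].
have SI i : (i < k.+1)%N -> S (flag_dart (iter i.+1 next_crossing y)).
  by move=> lik; apply/orP; right; apply/existsP; exists (Ordinal lik).
suff /orP[/eqP ->|/existsP[i /eqP <-]] : S d'; [by left| |].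
  by right; have := crossing_iter i.+1 y; rewrite cy => /andP[].
have S0 : S (flag_dart x) by rewrite xE; exact: SI.
apply: (link_closed Ksurf _ S0 od) => z Sz _.
have by_ : partner y = flip (turn (flip y)) by rewrite /partner cy (negbTE ty).
have bi i : (0 < i <= k)%N -> partner (iter i next_crossing y) = turn (iter i next_crossing y).
  by move=> /inC h; rewrite /partner crossing_iter cy h.
have eu : flag_dart (flip (turn y)) = rev_dart d by rewrite flag_dart_flip -dE.
have ev : flag_dart (turn x) = flag_dart (flip (turn y)) by rewrite tE eu.
have uv : turn x = cross (flip (turn y)).
  case: (flag_dart_eq Ksurf (esym ev)) => // e.
  case: (partner_not_iter (n := k.+1) cy); rewrite -xE by_ -hexagon -e turnK //.
case/orP: Sz => [/eqP zE|/existsP[i /eqP zE]].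
  have : flag_dart (flip (turn y)) = flag_dart z by rewrite zE.
  case/(flag_dart_eq Ksurf) => ->.
    rewrite hexagon -by_ -(flag_dart_cross Ksurf) -/(next_crossing y).
    exact: (SI 0%N).
  by rewrite -uv turnK.
case/(flag_dart_eq Ksurf): zE => ->.
  case: (ltnP i k) => ik.
    rewrite -bi ?ltnS ?ik // -(flag_dart_cross Ksurf) -/(next_crossing _) -iterS.
    exact: SI.
  have -> : nat_of_ord i = k by apply/eqP; rewrite eqn_leq ik -ltnS ltn_ord.
  by rewrite -xE tE /S eqxx.
rewrite iterS /next_crossing (crossK Ksurf) -/next_crossing; case: i => -[|i] /= lik.
  by rewrite by_ -hexagon turnK eu /S eqxx.
by rewrite -iterS bi // turnK; apply: SI; exact: ltnW.
Qed.

(** The origin of d is outside C, and d is its only dart that does not enter C. *)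
Definition spur d : Prop :=
  [/\ org d \notin C, dest d \notin C,
      forall d', org d' = org d -> d' = d \/ dest d' \in C &
      exists2 d', org d' = org d & dest d' \in C].

(** Without spurs there is no backtracking.  The last dart before x is carried
    along, as triangles that contribute nothing may lie in between. *)
Lemma path_boundary_walk d x n : (forall d, ~ spur d) -> after_step d x ->
  path (fun d d' => d' != rev_dart d) d (boundary_walk x n).
Proof.
move=> ns; elim: n d x => // n IH d x dx.
rewrite /boundary_walk /= -/(boundary_walk (next_crossing x) n) /link_step.
have [y [k [cy ty dE xE inC]]] := dx.
have cx : crossing x by rewrite xE crossing_iter.
case: ifP => tx /=.
  apply: IH; exists y, k.+1; split => //; first by rewrite xE -iterS.
  move=> i /andP[i0 ]; rewrite leq_eqVlt => /orP[/eqP ->|ik]; first by rewrite -xE.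
  by apply: inC; rewrite i0.
apply/andP; split; last first.
  apply: IH; exists x, 0%N; split => //; first by rewrite tx.
  by case.
apply/eqP => e; apply: (ns (rev_dart d)).
have od : org (rev_dart d) = org (flag_dart x) by rewrite -e (org_turn Ksurf).
have [ox dxC] := andP cx.
split; rewrite ?od //.
- by rewrite -e -/(third x) tx.
- by move=> d' h; apply: backtracking_darts dx _ e _ h; rewrite tx.
by exists (flag_dart x).
Qed.

(** The walk is started at a triangle that contributes an edge, so that closing
    it up amounts to one more step. *)
Lemma boundary_walk_nonbacktracking x :
    (forall d, ~ spur d) -> crossing x -> third x \notin C ->
  cycle (fun d d' => d' != rev_dart d) (boundary_walk x (order next_crossing x)).
Proof.
move=> ns cx tx.
have [m em] : exists m, order next_crossing x = m.+1.
  by exists (order next_crossing x).-1; rewrite prednK // order_gt0.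
have ex : iter m next_crossing (next_crossing x) = x by rewrite -iterSr -em iter_order_next.
have bx : link_step x = [:: flag_dart (turn x)] by rewrite /link_step (negbTE tx).
have -> : boundary_walk x (order next_crossing x) = flag_dart (turn x) :: boundary_walk
  (next_crossing x) m.
  by rewrite em /boundary_walk /= bx.
rewrite /=.
have -> : rcons (boundary_walk (next_crossing x) m) (flag_dart (turn x)) = boundary_walk
  (next_crossing x) m.+1.
  by rewrite /boundary_walk trajectSr map_rcons flatten_rcons ex bx cats1.
apply: path_boundary_walk => //; exists x, 0%N; split => //.
by case.
Qed.

End BoundaryWalk.

Lemma walk_cycle (K : incidence) (v : vert K) (p : seq (dart K)) :
  is_walk v p v -> cycle (fun d d' => org (rev_dart d) == org d') p.
Proof.
case: p => // d p /= /andP[/eqP <-].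
have H d0 : is_walk (dest d0) p (org d) ->
    path (fun d d' => org (rev_dart d) == org d') d0 (rcons p d).
  elim: p d0 => [|d1 p IH] d0 /=; first by rewrite andbT.
  by case/andP => /eqP e /IH ->; rewrite e eqxx.
exact: H.
Qed.

(** * Absorbing vertices into a disc *)

(** For a connected proper full subcomplex, chi = 1 is the largest value, and it
    makes the subcomplex simply connected. *)
Definition disc_like (K : incidence) (C : {set vert K}) : Prop :=
  [/\ C != finset.set0, C != [set: vert K]%SET, full_connected C & chi_sub C = 1].

(** The corners cs, which are distinct elements of Lk(C), certify that the sum of
    the angles along p is at most the sum over Lk(C). *)
Definition boundary_loop (K : incidence) (C : {set vert K}) (p : seq (dart K))
    (cs : seq (tri_corner K)) : Prop :=
  [/\ p != [::], exists v, is_walk v p v, cycle (fun d d' => d' != rev_dart d) p &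
      walk_equiv p [::]] /\
  [/\ edges_of p = map (@opposite_edge K) cs, uniq cs & {subset cs <= Lk C}].

Section Absorption.
Variable K : incidence.
Hypothesis Ksurf : combinatorial_surface K.
Implicit Types (x y z : flag K) (d : dart K) (v w b : vert K) (C : {set vert K}).

(** The corner opposite to the side s. *)
Definition apex (s : tri_corner K) : tri_corner K := (s.1, ord_pred s.2).

Lemma apex_inj : injective apex.
Proof.
move=> [f i] [g j] e; have /= -> := congr1 fst e.
by have /(can_inj (@ord_predK _)) /= -> := congr1 snd e.
Qed.

Lemma opposite_apex s : opposite_edge (apex s) = side_edge s.
Proof. by case: s => f i; rewrite /opposite_edge /apex /= ord_predK. Qed.

Lemma apexE x : apex x.1 = flag_corner (flip (turn x)).
Proof. by case: x => -[f i] []; rewrite /apex /flag_corner /flip /turn /= ?ord_pred3. Qed.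

Lemma corner_apex x : corner_vert (apex x.1) = third x.
Proof. by rewrite apexE -(org_flag_dart Ksurf) flag_dart_flip. Qed.

Lemma edge_off_dart C d : edge_off C d.1 = (org d \notin C) && (dest d \notin C).
Proof. by case: d => e []; rewrite /edge_off /dest /rev_dart //= andbC. Qed.

Lemma edge_off_opposite C (t : tri_corner K) : edge_off C (opposite_edge t) =
  (dest (flag_dart (t, false)) \notin C) && (third (t, false) \notin C).
Proof.
case: t => f i; rewrite edge_off_dart /= (dest_side Ksurf).
have e : flag_dart ((f, i), false) = side f i by rewrite /flag_dart /= addbF; case: (side f i).
rewrite e (dest_side Ksurf) /third; congr (_ && (_ \notin C)).
have -> : flag_dart (turn (f, i, false)) = rev_dart (side f (ord_pred i)).
  by rewrite /flag_dart /= addbT; case: (side _ _).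
by rewrite dest_rev ord_pred3.
Qed.

Lemma chi_point b : (forall d, org d = b -> dest d != b) -> chi_sub [set b]%SET = 1.
Proof.
move=> nl.
have E0 : edges_in [set b]%SET = finset.set0.
  apply/finset.setP => e; rewrite !inE (edge_in_dart _ (e, false)) !inE.
  by apply/negP => /andP[/eqP h]; apply/negP; exact: nl.
have F0 : faces_in [set b]%SET = finset.set0.
  apply/finset.setP => f; rewrite [RHS]inE; apply/negP => fb.
  by have := @sides_full _ Ksurf [set b]%SET (f, ord0) fb; rewrite E0 inE.
by rewrite /chi_sub -/(edges_in _) -/(faces_in _) E0 F0 !cards0 cards1.
Qed.

Lemma chi_sub_setT : chi_sub [set: vert K]%SET = chi K.
Proof.
rewrite /chi_sub /chi cardsT; congr (_ - _%:Z + _%:Z).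
  by apply: eq_card => e; rewrite inE /edge_in !inE.
by apply: eq_card => f; rewrite inE; apply/forallP => i; rewrite inE.
Qed.

Lemma crossing_exists C :
  C != finset.set0 -> C != [set: vert K]%SET -> exists x, crossing C x.
Proof.
move=> /finset.set0Pn[r rC] CT.
have [v vC] : exists v, v \notin C.
  apply/existsP; apply: contraR CT => /existsPn h; rewrite -finset.subTset.
  by apply/fintype.subsetP => v _; have := h v; rewrite negbK.
apply/existsP; apply: contraNT vC => /existsPn nex.
have cn : connect (@vert_adj K)
    r v by case: Ksurf => _ _; apply.
apply: (@connect_closed_pred _ _ (fun v => v \in C) r v _ rC cn) => a b aC.
case/existsP => d /andP[/eqP da /eqP db]; apply: contraT => bC.
have [x xd] := flag_dart_surj Ksurf (rev_dart d).
by have := nex x; rewrite /crossing xd db bC dest_rev da aC.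
Qed.

(** A vertex whose neighbours are all in C fills a hole of F_C. *)
Lemma hole_chi C b : full_connected C -> C != finset.set0 -> b \notin C ->
    (forall d, org d = b -> dest d \in C) ->
  chi_sub (C :|: [set b])%SET = chi_sub C + 1 /\ full_connected (C :|: [set b])%SET.
Proof.
move=> cn C0 bC h.
have dj : [disjoint C & [set b]%SET].
  by rewrite disjoint_sym disjoints1.
split; last first.
  apply: full_connected_ext => // v; rewrite inE => /eqP ->.
  have [d od] : exists d : dart K, org d = b by case: Ksurf => -[_ + _] _ _; apply.
  by exists (rev_dart d); rewrite ?dest_rev // -[org _]/(dest d) h.
have c1 : chi_sub [set b]%SET = 1.
  by apply: chi_point => d /h dC; apply: contraNneq bC => <-.
have S0 : straddling C [set b]%SET = finset.set0.
  apply/finset.setP => f; rewrite [RHS]inE; apply/negP => /(straddlingP Ksurf dj)[x [_ ob dC _ _]].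
  by move: dC; rewrite h //; move: ob; rewrite inE => /eqP.
by have := chi_union Ksurf dj; rewrite c1 S0 cards0; lia.
Qed.

(** Both triangles at a spur have their third vertex in C, as otherwise the spur
    would be the whole link of its origin. *)
Lemma spur_third C d x : spur C d -> flag_dart x = d -> third x \in C.
Proof.
case=> dC eC sp [d' od' eC'] xd.
have ot : org (flag_dart (turn x)) = org d by rewrite (org_turn Ksurf) xd.
case: (sp _ ot) => // tx.
have tc : turn x = cross x.
  case: (flag_dart_eq Ksurf (etrans xd (esym tx))) => // e.
  by case: x {xd ot tx} e => c []; rewrite /turn => -[].
have /eqP e : pred1 d d'.
  apply: (link_closed Ksurf _ _ od'); last by rewrite /= eqxx.
  move=> z /eqP zd _; apply/eqP.
  case: (flag_dart_eq Ksurf (etrans xd (esym zd))) => -> //.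
  by rewrite -tc turnK.
by rewrite -e eC' in eC.
Qed.

(** Adding the origin b of a spur to C.  The straddling triangles for C and b
    contain the spur, so there are at most two of them and [chi_union] gives
    chi >= 1.  The two triangles at the spur leave the link of C. *)
Lemma spur_prune C d : disc_like C -> spur C d ->
  let C' := (C :|: [set org d])%SET in
  [/\ disc_like C', #|~: C'|.+1 = #|~: C|%SET, Lk C' \subset Lk C
    & (#|Lk C'| + 2 <= #|Lk C|)%N].
Proof.
move=> [C0 CT cn c1] sp C'; have [dC eC sp' [d' od' eC']] := sp.
set b := org d in sp' od' dC C' *.
have eb : dest d != b.
  apply/eqP => e; case: (sp' (rev_dart d) e) => [/eqP|].
    by rewrite (negbTE (rev_dart_neq _)).
  by rewrite dest_rev -/b (negbTE dC).
have dj : [disjoint C & [set b]%SET].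
  by rewrite disjoint_sym disjoints1.
have C'T : C' != [set: vert K]%SET.
  apply/eqP => /finset.setP/(_ (dest d)).
  by rewrite !inE (negbTE eC) (negbTE eb).
have C'0 : C' != finset.set0.
  by apply/finset.set0Pn; exists b; rewrite !inE eqxx orbT.
have cn' : full_connected C'.
  apply: full_connected_ext => // v; rewrite inE => /eqP ->.
  by exists (rev_dart d'); rewrite ?dest_rev.
have [x xd] := flag_dart_surj Ksurf d.
have cb : chi_sub [set b]%SET = 1.
  apply: chi_point => d1 /sp'[->//|h]; by apply: contraNneq dC => <-.
have lS : (#|straddling C [set b]%SET| <= 2)%N.
  apply: (@leq_trans #|[set x.1.1; (cross x).1.1]%SET|); last by rewrite cards2; case: (_ != _).
  apply: subset_leq_card; apply/fintype.subsetP => f.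
  case/(straddlingP Ksurf dj) => y [<- oy ey _ _].
  have oyb : org (flag_dart y) = b by move: oy; rewrite inE => /eqP.
  case: (sp' _ oyb) => [yd|]; last by rewrite (negbTE ey).
  by case: (flag_dart_eq Ksurf (etrans xd (esym yd))) => ->; rewrite !inE eqxx ?orbT.
have c1' : chi_sub C' = 1.
  have := chi_union Ksurf dj; rewrite -/C' c1 cb.
  have [] := chi_le1 Ksurf C'0 C'T cn'.
  by move=> h _; lia.
have sub : Lk C' \subset Lk C.
  apply/fintype.subsetP => t; rewrite !inE !edge_off_opposite !inE !negb_or.
  case/andP => + /andP[/andP[h1 _] /andP[h2 _]]; rewrite h1 h2 !andbT.
  case/orP => // /eqP tb.
  have o1_ : org (flag_dart (t, false)) = b by rewrite (org_flag_dart Ksurf) -tb; case: (t).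
  case: (sp' _ o1_) => [td|]; last by rewrite (negbTE h1).
  by have := spur_third sp td; rewrite (negbTE h2).
split => //.
  have := cardsC C'; have := cardsC C; have : #|C'| = #|C|.+1.
    by rewrite cardsU disjoint_setI0 // cards0 subn0 cards1 addn1.
  by lia.
pose D := [set apex x.1; apex (cross x).1]%SET.
have D2 : #|D| = 2%N.
  rewrite cards2; case: eqP => // /apex_inj e.
  by have [_] := other_slotP Ksurf x.1; rewrite -[other_slot _]/(cross x).1 -e eqxx.
have DL : D \subset Lk C.
  apply/fintype.subsetP => t.
  have H y : flag_dart y = d -> apex y.1 \in Lk C.
    move=> yd; rewrite inE corner_apex (spur_third sp yd) opposite_apex.
    by rewrite -[side_edge _]/(flag_dart y).1 yd edge_off_dart -/b dC eC.
  by case/finset.set2P => ->; [exact: (H x)|apply: (H (cross x))];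
    rewrite (flag_dart_cross Ksurf).
rewrite -D2 -cardsUI [in X in (_ + X)%N](_ : _ :&: _ = finset.set0)%SET.
  by rewrite cards0 addn0; apply: subset_leq_card; rewrite finset.subUset sub.
apply/finset.setP => t; rewrite [RHS]inE; apply/negP; rewrite inE => /andP[+ tD].
have te : opposite_edge t = d.1.
  have H y : flag_dart y = d -> opposite_edge (apex y.1) = d.1.
    by move=> yd; rewrite opposite_apex -yd.
  by case/finset.set2P: tD => ->; [exact: (H x)|apply: (H (cross x))];
    rewrite (flag_dart_cross Ksurf).
by rewrite inE te edge_off_dart !inE eqxx orbT andbF.
Qed.

(** Spurs are absorbed as long as there are any; each time the complement loses
    one vertex and the link at least two elements.  Then the walk around C is a boundary
    loop, or nothing but one vertex lies outside C. *)
Lemma boundary_dichotomy C : disc_like C ->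
  (chi K = 2 /\ exists k, #|~: C|%SET = k.+1 /\ (2 * k <= #|Lk C|)%N) \/
  exists C' p cs, [/\ disc_like C', Lk C' \subset Lk C & boundary_loop C' p cs].
Proof.
move: {2}#|~: C|%SET (leqnn #|~: C|%SET) => n; elim: n C => [|n IH] C leC gC.
  have [C0 CT _ _] := gC; exfalso; move: leC CT; rewrite leqn0 cards_eq0 => /eqP h.
  by rewrite -[C]finset.setCK h finset.setC0 eqxx.
have [C0 CT cn c1] := gC.
case: (pselect (exists d, spur C d)) => [[d sp]|ns].
  have [gC' cC' sub lL] := spur_prune gC sp.
  case: (IH _ _ gC') => [|[chi2 [k [kC kL]]]|[C' [p [cs [gC'' s' bl]]]]].
  - by rewrite -ltnS cC'.
  - left; split=> //; exists k.+1; rewrite -cC' kC; split => //.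
    by apply: leq_trans lL; rewrite mulnS addnC leq_add2r.
  right; exists C', p, cs; split => //.
  exact: fintype.subset_trans s' sub.
have {}ns d : ~ spur C d by move=> h; apply: ns; exists d.
have [x cx] := crossing_exists C0 CT.
case: (pselect (exists y, crossing C y /\ third y \notin C)) => [[y [cy ty]]|nt].
  right; exists C, (boundary_walk C y (order (next_crossing C) y)), (link_corners C y (order
    (next_crossing C) y)).
  have iy := iter_order_next Ksurf C y.
  have [_ nw] := chi_le1 Ksurf C0 CT cn.
  split => //; split; split.
  - have [m ->] : exists m, order (next_crossing C) y = m.+1.
      by exists (order (next_crossing C) y).-1; rewrite prednK // order_gt0.
    by rewrite /boundary_walk /= /link_step (negbTE ty).
  - by exists (org (flag_dart y)); have := is_walk_boundary Ksurf (order (next_crossing C) y) cy;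
      rewrite iy.
  - exact: boundary_walk_nonbacktracking.
  - by apply: boundary_walk_null => //; exact: nw.
  - exact: edges_boundary_walk.
  - exact: link_corners_uniq.
  exact: link_corners_Lk.
have tn m : third (iter m (next_crossing C) x) \in C.
  by apply: contraT => h; case: nt; exists (iter m (next_crossing C) x); rewrite crossing_iter.
have hd := hole_darts Ksurf cx tn.
have [bC _] := andP cx.
have [chi2 cn'] := hole_chi cn C0 bC hd.
have CU : (C :|: [set org (flag_dart x)])%SET = [set: vert K]%SET.
  apply/eqP/negP => /negP h.
  have C'0 : (C :|: [set org (flag_dart x)])%SET != finset.set0.
    by apply/finset.set0Pn; exists (org (flag_dart x)); rewrite !inE eqxx orbT.
  by have [] := chi_le1 Ksurf C'0 h cn'; rewrite chi2 c1.
left; split; first by rewrite -chi_sub_setT -CU chi2 c1.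
exists 0%N; split => //.
have -> : (~: C)%SET = [set org (flag_dart x)]%SET; last by rewrite cards1.
apply/finset.setP => v; have := finset.in_setT v; rewrite -CU !inE.
by case: eqP => [->|_]; rewrite ?bC // orbF => ->.
Qed.

End Absorption.

(** * Boundary loops in a simple graph *)

Section SimpleLoops.
Variable K : incidence.
Hypothesis Ksurf : combinatorial_surface K.
Implicit Types (x y z : flag K) (d : dart K) (v w b : vert K) (C B : {set vert K}).

Definition loop_verts (p : seq (dart K)) : {set vert K} :=
  [set v in map (@org K) p]%SET.

(** The triangle of an element of Lk(C), seen from its edge outside C. *)
Lemma link_flag C t d : t \in Lk C -> opposite_edge t = d.1 ->
  exists y, [/\ flag_dart y = d, apex y.1 = t & third y \in C].
Proof.
move=> tL e; have [y ys yd] := flag_at e.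
have at_ : apex y.1 = t by rewrite ys /apex /= ordSK; case: (t).
exists y; split => //; rewrite -(corner_apex Ksurf) at_.
by move: tL; rewrite inE => /andP[].
Qed.

Lemma link_ends C t d : t \in Lk C -> opposite_edge t = d.1 ->
  (org d \notin C) && (dest d \notin C).
Proof. by rewrite inE => /andP[_ +] e; rewrite e edge_off_dart. Qed.

Lemma loop_ends p v : is_walk v p v ->
  forall d, d.1 \in edges_of p -> (org d \in loop_verts p) && (dest d \in loop_verts p).
Proof.
move=> pw.
have H d : d \in p -> (org d \in loop_verts p) && (dest d \in loop_verts p).
  move=> dp; rewrite !inE map_f //=.
  have /eqP e := next_cycle (walk_cycle pw) dp.
  by rewrite -[dest d]/(org (rev_dart d)) e map_f // mem_next.
move=> d /mapP[d1 /H dp e].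
case: (same_edge e) => -> //.
by rewrite dest_rev -[org (rev_dart _)]/(dest _) andbC.
Qed.

(** Adding all vertices B of a boundary loop p to C.  A straddling triangle for C
    and B gives an element of Lk(C) that is not used by p, so there is at most one.
    As their number is even by [chi_union], there is none, and
    chi(F_(C + B)) = 1 + chi(F_B).  The left-hand side is at most 1. *)
Lemma chi_loop_verts C p cs : disc_like C -> chi K = 0 -> boundary_loop C p cs ->
  (#|Lk C| <= (size p).+1)%N -> chi_sub (loop_verts p) <= 0.
Proof.
move=> [C0 CT cn c1] chi0 [[p0 [v pw] _ _] [pcs ucs scs]] leL.
set B := loop_verts p.
have ends := loop_ends pw.
have offC d : d.1 \in edges_of p -> (org d \notin C) && (dest d \notin C).
  by rewrite pcs => /mapP[t tc e]; apply: link_ends (scs _ tc) _.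
have orgB b : b \in B -> exists2 d, org d = b & d.1 \in edges_of p.
  by rewrite inE => /mapP[d dp ->]; exists d => //; exact: map_f.
have dj : [disjoint C & B].
  rewrite disjoint_sym disjoint_subset; apply/fintype.subsetP => b /orgB[d <- /offC/andP[+ _]].
  by rewrite inE.
have adj b : b \in B -> exists2 d, org d \in C & dest d = b.
  move=> /orgB[d <-]; rewrite pcs => /mapP[t tc e].
  have [y [yd _ ty]] := link_flag (scs _ tc) (esym e).
  exists (rev_dart (flag_dart (turn y))); first exact: ty.
  by rewrite dest_rev (org_turn Ksurf) yd.
have cnB := full_connected_ext cn C0 adj.
have lT : (#|straddling C B| <= 1)%N.
  (* The elements of the link that are not used by p. *)
  pose L := (Lk C :\: [set t in cs])%SET.
  have cL : (#|L| <= 1)%N.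
    have := cardsID [set t in cs]%SET (Lk C); rewrite -/L.
    have -> : (Lk C :&: [set t in cs])%SET = [set t in cs]%SET.
      by apply/finset.setIidPr/fintype.subsetP => t; rewrite inE => /scs.
    have -> : #|[set t in cs]%SET| = size p.
      rewrite cardsE (card_uniqP ucs) -(size_map (@opposite_edge K)) -pcs.
      by rewrite size_map.
    by lia.
  apply: leq_trans cL; apply: leq_trans (leq_imset_card fst _).
  apply: subset_leq_card; apply/fintype.subsetP => f.
  case/(straddlingP Ksurf dj) => x [xf oB dC dB tC].
  apply/imsetP; exists (apex x.1); last by rewrite -xf.
  have oC : org (flag_dart x) \notin C by rewrite (disjointFl dj oB).
  have te : opposite_edge (apex x.1) = (flag_dart x).1 by rewrite opposite_apex.
  rewrite !inE te edge_off_dart oC dC corner_apex // tC !andbT.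
  apply/negP => tc; have /ends/andP[_] : (flag_dart x).1 \in edges_of p by rewrite pcs -te map_f.
  by rewrite (negbTE dB).
have CB0 : (C :|: B)%SET != finset.set0.
  by case/finset.set0Pn: C0 => r rC; apply/finset.set0Pn; exists r; rewrite inE rC.
have leU : chi_sub (C :|: B)%SET <= 1.
  have [E|h] := eqVneq (C :|: B)%SET [set: vert K]%SET.
    by rewrite E chi_sub_setT chi0.
  by have [] := chi_le1 Ksurf CB0 h cnB.
by have := chi_union Ksurf dj; rewrite c1; lia.
Qed.

Hypothesis no_loop : forall d, dest d != org d.
Hypothesis simple : forall d d', org d = org d' -> dest d = dest d' -> d = d'.

Definition edge_ends (e : edge K) : {set vert K} := [set org (e, false); org (e, true)]%SET.

Lemma edge_ends_dart d : edge_ends d.1 = [set org d; dest d]%SET.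
Proof. by case: d => e []; rewrite /edge_ends /dest /rev_dart //= finset.setUC. Qed.

Lemma edge_ends_inj : injective edge_ends.
Proof.
move=> e e'; rewrite (edge_ends_dart (e, false)) (edge_ends_dart (e', false)) => E.
have := set21 (org (e, false)) (dest (e, false)); rewrite E => /finset.set2P h1.
have := set22 (org (e, false)) (dest (e, false)); rewrite E => /finset.set2P h2.
have n := no_loop (e, false).
suff : (e, false) = (e', false) \/ (e, false) = (e', true) by case=> -[->].
case: h1 h2 => h1 [] h2.
- by rewrite h1 h2 eqxx in n.
- by left; apply: simple.
- by right; apply: simple.
by rewrite h1 h2 eqxx in n.
Qed.

(** In a simple graph the edges in B inject into the pairs of elements of B. *)
Lemma card_edges_in B : (#|edges_in B| <= 'C(#|B|, 2))%N.
Proof.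
rewrite -cards_draws -(card_imset _ edge_ends_inj); apply: subset_leq_card.
apply/fintype.subsetP => _ /imsetP[e eB ->]; rewrite inE.
move: eB; rewrite inE (edge_in_dart _ (e, false)) (edge_ends_dart (e, false)) => /andP[h1 h2].
by rewrite finset.subUset !finset.sub1set h1 h2 cards2;
  have := no_loop (e, false); rewrite eq_sym => ->.
Qed.

Lemma card_edges_in_lt B q q' : q \in B -> q' \in B -> q != q' ->
    (forall d, org d = q -> dest d != q') ->
  (#|edges_in B| < 'C(#|B|, 2))%N.
Proof.
move=> qB q'B qq nd.
rewrite -cards_draws -(card_imset _ edge_ends_inj); apply: proper_card.
apply/properP; split.
  apply/fintype.subsetP => _ /imsetP[e eB ->]; rewrite inE.
  move: eB; rewrite inE (edge_in_dart _ (e, false)) (edge_ends_dart (e, false)) => /andP[h1 h2].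
  by rewrite finset.subUset !finset.sub1set h1 h2 cards2;
  have := no_loop (e, false); rewrite eq_sym => ->.
exists [set q; q']%SET.
  by rewrite inE finset.subUset !finset.sub1set qB q'B cards2 qq.
apply/imsetP => -[e _ E].
have : q \in edge_ends e by rewrite -E set21.
have : q' \in edge_ends e by rewrite -E set22.
have H d : d.1 = e -> org d = q -> q' \in edge_ends e -> False.
  move=> <- od; rewrite edge_ends_dart => /finset.set2P[h|h].
    by rewrite -od h eqxx in qq.
  by have := nd d od; rewrite h eqxx.
by move=> h /finset.set2P[/esym|/esym] /H; apply.
Qed.

Lemma loop_size p v : is_walk v p v -> cycle (fun d d' => d' != rev_dart d) p ->
  p != [::] -> (2 < size p)%N.
Proof.
case: p => [|d [|d' [|d'' p]]] //=.
  by case/andP => /eqP <- /eqP e; have := no_loop d; rewrite e eqxx.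
case/and3P => /eqP <- /eqP e /eqP e' /and3P[nb _ _] _.
case/eqP: nb; apply: simple; first by rewrite e.
by rewrite dest_rev.
Qed.

(** Two sides of a triangle contain all its vertices. *)
Lemma face_in_loop p v (c : tri_corner K) : is_walk v p v ->
    side_edge (c.1, ordS c.2) \in edges_of p ->
    side_edge (c.1, ord_pred c.2) \in edges_of p ->
  c.1 \in faces_in (loop_verts p).
Proof.
case: c => f i pw /= h1 h2.
have /andP[a1 a2] := loop_ends pw h1; have /andP[a3 a4] := loop_ends pw h2.
rewrite inE; apply/forallP => j.
have : [|| j == ordS i, j == ord_pred i | j == i].
  by case: i j {h1 h2 a1 a2 a3 a4} => -[|[|[|]]] // ? [[|[|[|]]] // ?].
case/or3P => /eqP -> //.
by move: a4; rewrite (dest_side Ksurf) ord_predK.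
Qed.

Lemma loop_verts_sub p b : b \in loop_verts p -> exists2 d, d \in p & org d = b.
Proof. by rewrite inE => /mapP[d dp ->]; exists d. Qed.

(** Three vertices, at most three edges and at least one triangle give
    chi(F_B) >= 1. *)
Lemma no_triangle_loop C p cs : disc_like C -> chi K = 0 -> boundary_loop C p cs ->
  (#|Lk C| <= 4)%N -> size p = 3%N -> bounds_triangle (edges_of p) -> False.
Proof.
move=> gC chi0 bl leL sp [f pf].
have le0 : chi_sub (loop_verts p) <= 0 by apply: chi_loop_verts bl _ => //; rewrite sp.
have [[_ [v pw] _ _] _] := bl.
have sideP i : side_edge (f, i) \in edges_of p.
  by rewrite (perm_mem pf); apply: map_f; rewrite mem_enum.
have fB : f \in faces_in (loop_verts p) by apply: (@face_in_loop _ _ (f, ord0)) pw _ _.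
have F1 : (0 < #|faces_in (loop_verts p)|)%N by rewrite card_gt0; apply/finset.set0Pn; exists f.
have B3 : #|loop_verts p| = 3%N.
  rewrite cardsE; move: sp pw; case: (p) => [|d0 [|d1 [|d2 [|]]]] //= _.
  case/and4P => /eqP <- /eqP e1 /eqP e2 /eqP e3.
  have n01 : org d0 != org d1 by rewrite e1 eq_sym.
  have n12 : org d1 != org d2 by rewrite e2 eq_sym.
  have n20 : org d0 != org d2 by rewrite -e3.
  by rewrite (card_uniqP _) //= !inE !negb_or n01 n20 n12.
have E3 := card_edges_in (loop_verts p); rewrite B3 in E3.
move: le0; rewrite /chi_sub -/(edges_in _) -/(faces_in _) B3.
by move: E3 F1; rewrite (_ : 'C(3, 2) = 3%N) //; lia.
Qed.

(** A closed walk of length four without backtracking in a simple graph visits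
    four distinct vertices, and only its previous and next edges meet each of
    them. *)
Lemma four_cycle p : size p = 4%N -> (exists v, is_walk v p v) ->
    cycle (fun d d' => d' != rev_dart d) p ->
  #|loop_verts p| = 4%N /\
  forall q, q \in loop_verts p -> exists da db, forall d,
    d.1 \in edges_of p -> org d = q -> d = da \/ d = db.
Proof.
move=> sp [v pw] nb.
case: p sp pw nb => [|d0 [|d1 [|d2 [|d3 [|]]]]] //= _.
rewrite andbT; case/and5P => /eqP ev /eqP e1 /eqP e2 /eqP e3 /eqP e0.
case/and4P => b01 b12 b23 b30; rewrite -ev in e0.
have n01 : org d0 != org d1 by rewrite e1 eq_sym.
have n12 : org d1 != org d2 by rewrite e2 eq_sym.
have n23 : org d2 != org d3 by rewrite e3 eq_sym.
have n30 : org d3 != org d0 by rewrite -e0 eq_sym.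
have n02 : org d0 != org d2.
  by apply: contraNneq b01 => e; apply/eqP/simple; rewrite ?dest_rev ?e -1?e2 // e1.
have n13 : org d1 != org d3.
  by apply: contraNneq b12 => e; apply/eqP/simple; rewrite ?dest_rev ?e -1?e3 // e2.
have un : uniq [:: org d0; org d1; org d2; org d3].
  by rewrite /= !inE !negb_or n01 n02 n12 n13 n23 eq_sym n30.
split; first by rewrite cardsE (card_uniqP un).
have n10 := n01; have n21 := n12; have n32 := n23; have n03 := n30; have n20 := n02;
  have n31 := n13.
rewrite eq_sym in n10; rewrite eq_sym in n21; rewrite eq_sym in n32.
rewrite eq_sym in n03; rewrite eq_sym in n20; rewrite eq_sym in n31.
have H d q : d.1 \in edges_of [:: d0; d1; d2; d3] -> org d = q ->
  (d = d0 /\ org d0 = q) \/ (d = d1 /\ org d1 = q) \/ (d = d2 /\ org d2 = q) \/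
  (d = d3 /\ org d3 = q) \/ (d = rev_dart d0 /\ org d1 = q) \/
  (d = rev_dart d1 /\ org d2 = q) \/ (d = rev_dart d2 /\ org d3 = q) \/
  (d = rev_dart d3 /\ org d0 = q).
  rewrite !inE => /or4P[]/eqP/same_edge[] -> <-; rewrite ?e1 ?e2 ?e3 -?e0; tauto.
move=> q; rewrite !inE => /or4P[]/eqP ->.
- exists d0, (rev_dart d3) => d dp /(H d _ dp).
  have /eqP := n10; have /eqP := n20; have /eqP := n30; tauto.
- exists d1, (rev_dart d0) => d dp /(H d _ dp).
  have /eqP := n01; have /eqP := n21; have /eqP := n31; tauto.
- exists d2, (rev_dart d1) => d dp /(H d _ dp).
  have /eqP := n02; have /eqP := n12; have /eqP := n32; tauto.
exists d3, (rev_dart d2) => d dp /(H d _ dp).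
have /eqP := n03; have /eqP := n13; have /eqP := n23; tauto.
Qed.

(** Here B has four vertices and F_B at least two triangles, so it is enough that
    F_B misses one of the six possible edges.  Let q be the vertex of the first
    triangle that is not on the diagonal and q' the vertex of the loop that is not
    in this triangle.  The link of q consists of the first triangle and of triangles
    that meet C, because every triangle at q with just one vertex in C has its
    opposite edge on the loop.  Hence q and q' are not adjacent. *)
Lemma no_two_triangles_loop C p cs : disc_like C -> chi K = 0 -> boundary_loop C p cs ->
  (#|Lk C| <= 4)%N -> size p = 4%N -> bounds_two_triangles (edges_of p) -> False.
Proof.
move=> gC chi0 bl leL sp [c [c' [cc _ pe]]].
have le0 : chi_sub (loop_verts p) <= 0.
  by apply: chi_loop_verts bl _ => //; rewrite sp; apply: leq_trans leL _.
have [[_ [v pw] nb _] [pcs ucs scs]] := bl.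
have [B4 two] := four_cycle sp (ex_intro _ v pw) nb.
have mem e : e \in [:: side_edge (c.1, ordS c.2); side_edge (c.1, ord_pred c.2);
    side_edge (c'.1, ordS c'.2); side_edge (c'.1, ord_pred c'.2)] -> e \in edges_of p.
  by rewrite (perm_mem pe).
have m1 := mem (side_edge (c.1, ordS c.2)); rewrite !inE eqxx in m1; have {}m1 := m1 isT.
have m2 := mem (side_edge (c.1, ord_pred c.2)); rewrite !inE eqxx orbT in m2; have {}m2 := m2 isT.
have m3 := mem (side_edge (c'.1, ordS c'.2)); rewrite !inE eqxx !orbT in m3; have {}m3 := m3 isT.
have m4 := mem (side_edge (c'.1, ord_pred c'.2)); rewrite !inE eqxx !orbT in m4;
  have {}m4 := m4 isT.
set B := loop_verts p in le0 B4 two *.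
have F2 : (1 < #|faces_in B|)%N.
  have : [set c.1; c'.1]%SET \subset faces_in B.
    by rewrite finset.subUset !finset.sub1set !(face_in_loop pw).
  by move/subset_leq_card; rewrite cards2 cc.
pose f := c.1; pose q := corner_vert (f, ord_pred c.2).
have fB : f \in faces_in B by exact: face_in_loop pw m1 m2.
have cB i : corner_vert (f, i) \in B by move: fB; rewrite inE => /forallP.
have [q' q'B q'n] : exists2 q', q' \in B & forall i, q' != corner_vert (f, i).
  pose F := [set corner_vert (f, i) | i in 'I_3]%SET.
  have lF : (#|F| < #|B|)%N by rewrite B4 ltnS; apply: leq_trans (leq_imset_card _ _) _;
    rewrite card_ord.
  have [q'] : exists q', q' \in (B :\: F)%SET.
    apply/finset.set0Pn; apply: contraTN lF; rewrite finset.setD_eq0 -leqNgt.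
    exact: subset_leq_card.
  rewrite inE => /andP[nF qB]; exists q' => // i; apply: contraNneq nF => ->.
  exact: imset_f.
have offC d : d.1 \in edges_of p -> (org d \notin C) && (dest d \notin C).
  by rewrite pcs => /mapP[t tc e]; apply: link_ends (scs _ tc) _.
have BC b : b \in B -> b \notin C.
  by case/loop_verts_sub => d dp <-; have /andP[] := offC d (map_f _ dp).
have Lcs t : t \in Lk C -> t \in cs.
  have sz : size cs = 4%N by rewrite -(size_map (@opposite_edge K)) -pcs size_map.
  have cs4 : #|[set t in cs]%SET| = 4%N by rewrite cardsE (card_uniqP ucs).
  move=> tL; have E : [set t in cs]%SET = Lk C.
    apply/eqP; rewrite eqEcard cs4 leL andbT.
    by apply/fintype.subsetP => u; rewrite inE => /scs.
  by move: tL; rewrite -E inE.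
pose x1 : flag K := ((f, ord_pred c.2), false).
pose x2 : flag K := turn x1.
have mx1 : (flag_dart x1).1 \in edges_of p by exact: m2.
have mx2 : (flag_dart x2).1 \in edges_of p.
  have := m1; rewrite /x2 /flag_dart /side_edge /= -/f.
  by rewrite !ord_pred3 ordS3.
have fx1 i : i = x1 \/ i = x2 -> [/\ org (flag_dart i) = q,
  dest (flag_dart i) != q' & third i \in B].
  move=> hi; have fi : i.1.1 = f by case: hi => ->.
  have oi : org (flag_dart i) = q.
    by case: hi => ->; rewrite /x2 ?(org_turn Ksurf) (org_flag_dart Ksurf).
  split => //.
    rewrite -[dest _]/(org (rev_dart _)) -flag_dart_flip eq_sym (org_flag_dart Ksurf).
    by rewrite /flag_corner /= fi.
  by rewrite -(corner_apex Ksurf) /apex fi.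
have step i z : i = x1 \/ i = x2 -> flag_dart i = flag_dart z -> z = i \/ third z \in C.
  move=> hi /(flag_dart_eq Ksurf)[->|->]; first by left.
  right; have [oi _ ti] := fx1 i hi.
  have : (flag_dart i).1 \in edges_of p by case: hi => ->.
  rewrite pcs => /mapP[t tc e].
  have [y [yd _ ty]] := link_flag (scs _ tc) (esym e).
  case: (flag_dart_eq Ksurf (esym yd)) => ey; last by rewrite -ey.
  by move: (BC _ ti); rewrite -ey ty.
have n12 : flag_dart x1 <> flag_dart x2.
  move=> /(step x1 x2 (or_introl erefl))[e|h].
    by have := congr1 snd e.
  by have [_ _ /BC] := fx1 x2 (or_intror erefl); rewrite h.
have dq d : d.1 \in edges_of p -> org d = q -> d = flag_dart x1 \/ d = flag_dart x2.
  have [q1 _ _] := fx1 x1 (or_introl erefl); have [q2 _ _] := fx1 x2 (or_intror erefl).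
  have [da [db H]] := two q (cB _).
  move=> /H h /h hd; have h1 := H _ mx1 q1; have h2 := H _ mx2 q2.
  case: hd => ed; case: h1 => e1; case: h2 => e2;
    first [left; congruence | right; congruence | exfalso; congruence].
have nd d : org d = q -> dest d != q'.
  pose S d := [|| dest d \in C, d == flag_dart x1 | d == flag_dart x2].
  have [q1 d1 _] := fx1 x1 (or_introl erefl); have [q2 d2 _] := fx1 x2 (or_intror erefl).
  move=> od; suff /or3P[h|/eqP -> //|/eqP -> //] : S d.
    by apply: contraNneq (BC _ q'B) => <-.
  apply: (link_closed Ksurf (d0 := flag_dart x1)); last 2 first.
  - by rewrite /S eqxx orbT.
  - by rewrite od q1.
  move=> z Sz oz; rewrite q1 in oz.
  have [tz|tz] := boolP (third z \in C); first by rewrite /S -/(third z) tz.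
  case/or3P: Sz => [h|/eqP e|/eqP e].
  - have cz : crossing C z by rewrite /crossing oz h BC //; exact: cB.
    have /(map_f (@opposite_edge K)) := Lcs _ (link_corner_Lk Ksurf cz tz).
    rewrite -pcs opposite_link_corner => /dq -[|->|->]; first by rewrite (org_turn Ksurf).
      by rewrite /S eqxx orbT.
    by rewrite /S eqxx !orbT.
  - case: (step x1 z (or_introl erefl) (esym e)) => [->|h]; last by rewrite h in tz.
    by rewrite /S eqxx !orbT.
  case: (step x2 z (or_intror erefl) (esym e)) => [->|h]; last by rewrite h in tz.
  by rewrite /S /x2 turnK eqxx !orbT.
have qB : q \in B by exact: cB.
have E5 : (#|edges_in B| < 6)%N.
  have := card_edges_in_lt qB q'B; rewrite B4 (_ : 'C(4, 2) = 6%N) //; apply => //.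
  by rewrite eq_sym q'n.
move: le0 E5 F2; rewrite /chi_sub -/(edges_in _) -/(faces_in _) B4.
by move: #|_| #|_| => m n; clear; lia.
Qed.

End SimpleLoops.

(** * The inequality on a combinatorial surface *)

Section Inequality.
Variables (R : realType) (K : incidence) (Phi : edge K -> R).
Hypothesis Ksurf : combinatorial_surface K.
Hypothesis Phiw : is_weight Phi.
Implicit Types (x y z : flag K) (d : dart K) (v w b : vert K) (C B I : {set vert K}).

Definition link_sum I : R := \sum_(c in Lk I) (pi - Phi (opposite_edge c)).

Definition star_rhs I : R := - link_sum I + 2 * pi * (chi_sub I)%:~R.

Definition star_lhs I : R := 2 * pi * #|I|%:R * (chi K)%:~R / #|vert K|%:R.

Lemma angle_ge e : pi / 2 <= pi - Phi e.
Proof. by have /andP[_ h] := Phiw e; lra. Qed.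

Lemma angle_gt0 e : 0 < pi - Phi e.
Proof. by apply: lt_le_trans (angle_ge e); have := @pi_gt0 R; lra. Qed.

Lemma link_sum_ge I : (pi / 2) *+ #|Lk I| <= link_sum I.
Proof. by rewrite -sumr_const; apply: ler_sum => c _; exact: angle_ge. Qed.

Lemma link_sum_ge0 I : 0 <= link_sum I.
Proof. by apply: sumr_ge0 => c _; exact/ltW/angle_gt0. Qed.

Lemma in_Lk I t : (t \in Lk I) = [&& corner_vert t \in I,
  dest (flag_dart (t, false)) \notin I & third (t, false) \notin I].
Proof. by rewrite inE edge_off_opposite. Qed.

Lemma link_sum_sub I C : Lk C \subset Lk I -> link_sum C <= link_sum I.
Proof.
move=> s; rewrite /link_sum [leRHS](bigID (mem (Lk C))) /=.
rewrite -[leLHS]addr0 lerD //; last by apply: sumr_ge0 => c _; exact/ltW/angle_gt0.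
rewrite [leRHS](eq_bigl (fun c => c \in Lk C)) // => c; rewrite andbC;
  case: (boolP (c \in Lk C)) => //=.
by move/(fintype.subsetP s).
Qed.

Lemma link_sum_loop C p cs : boundary_loop C p cs ->
  pi *+ size p - weight_sum Phi p <= link_sum C.
Proof.
move=> [_ [pcs ucs scs]].
have -> : pi *+ size p - weight_sum Phi p = \sum_(c <- cs) (pi - Phi (opposite_edge c)).
  have -> : size p = size cs by rewrite -(size_map (@opposite_edge K)) -pcs size_map.
  rewrite /weight_sum pcs big_map sumrB; congr (_ - _).
  by rewrite big_const_seq count_predT; elim: (size cs) => //= n <-; rewrite mulrS.
rewrite big_uniq //= /link_sum [leRHS](bigID (mem cs)) /=.
rewrite -[leLHS]addr0 lerD //; last by apply: sumr_ge0 => c _; exact/ltW/angle_gt0.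
rewrite [leLHS](eq_bigl (fun c => (c \in Lk C) && (c \in cs))) // => c.
by rewrite andbC; case: (boolP (c \in cs)) => //= /scs ->.
Qed.

Lemma loop_length C p cs : boundary_loop C p cs -> (size p <= #|Lk C|)%N.
Proof.
move=> [_ [pcs ucs scs]].
have -> : size p = size cs by rewrite -(size_map (@opposite_edge K)) -pcs size_map.
rewrite -(card_uniqP ucs); apply: subset_leq_card; apply/fintype.subsetP.
exact: scs.
Qed.

(** A component C of I and the rest D of I have no edge in common, so no triangle
    straddles them, and the link of I is the disjoint union of the links of C and
    D.  The left-hand side is linear in the number of vertices. *)
Lemma star_additive :
    (forall C, C != finset.set0 -> C != [set: vert K]%SET -> full_connected C ->
      star_rhs C < star_lhs C) ->
  condition_star Phi.
Proof.
move=> H I; rewrite -/(link_sum I) -/(star_rhs I) -/(star_lhs I).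
move: {2}#|I| (leqnn #|I|) => n; elim: n I => [|n IH] I.
  by rewrite leqn0 cards_eq0 => ->.
move=> leI I0 IT.
have /finset.set0Pn[r rI] := I0.
pose C := [set v in I | connect (edge_adj (edges_in I)) r v]%SET.
have rC : r \in C by rewrite inE rI connect0.
have CI : C \subset I by apply/fintype.subsetP => v; rewrite inE => /andP[].
have nadj d : org d \in C -> dest d \in I -> dest d \in C.
  rewrite !inE => /andP[oI rv] dI; rewrite dI /=; apply: connect_trans rv (connect1 _).
  by apply/existsP; exists d; rewrite inE edge_in_dart oI dI !eqxx.
have cn : full_connected C.
  have cr v : v \in C -> connect (edge_adj (edges_in C)) r v.
    rewrite inE => /andP[vI rv].
    suff /andP[] : (v \in C) && connect (edge_adj (edges_in C)) r v by [].
    apply: (@connect_closed_pred _ _ (fun v => (v \in C) && connect (edge_adj (edges_in C)) r v) r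
      v _ _ rv).
      move=> a b /andP[aC ra] /existsP[d /and3P[dE /eqP oa /eqP eb]].
      have bC : b \in C.
        by rewrite -eb nadj // ?oa //; move: dE; rewrite inE edge_in_dart => /andP[].
      rewrite bC; apply: connect_trans ra (connect1 _); apply/existsP; exists d.
      by rewrite inE edge_in_dart oa eb aC bC !eqxx.
    by rewrite rC connect0.
  move=> v w vC wC; apply: connect_trans (cr w wC).
  by rewrite edge_connect_sym; exact: cr.
have C0 : C != finset.set0 by apply/finset.set0Pn; exists r.
have CT : C != [set: vert K]%SET.
  by apply: contraNneq IT => E; rewrite -finset.subTset -E.
pose D := (I :\: C)%SET.
have [D0|D0] := eqVneq D finset.set0.
  have -> : I = C; last exact: H.
  by apply/eqP; rewrite finset.eqEsubset CI -finset.setD_eq0 -/D D0 eqxx.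
have ID : I = (C :|: D)%SET.
  by rewrite /D -{1}(finset.setID I C) (finset.setIidPr CI).
have dj : [disjoint C & D].
  rewrite disjoint_subset; apply/fintype.subsetP => v vC.
  by rewrite !inE; apply/negP => /andP[+ _]; move: vC; rewrite inE => ->.
have DI : D \subset I by exact: finset.subsetDl.
have DT : D != [set: vert K]%SET.
  by apply: contraNneq IT => E; rewrite -finset.subTset -E.
have cI : #|I| = (#|C| + #|D|)%N.
  by rewrite {1}ID cardsU disjoint_setI0 // cards0 subn0.
have leD : (#|D| <= n)%N.
  have : (0 < #|C|)%N by rewrite card_gt0.
  by move: leI cI; move: #|I| #|C| #|D| => a b c; clear; lia.
have nCD d : org d \in D -> dest d \in C -> False.
  move=> oD dC; have /nadj : org (rev_dart d) \in C by [].
  rewrite dest_rev (fintype.subsetP DI _ oD) => /(_ isT) oC.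
  by move: oD; rewrite (disjointFr dj oC).
have chiI : chi_sub I = chi_sub C + chi_sub D.
  have S0 : straddling C D = finset.set0.
    apply/finset.setP => f; rewrite [RHS]inE;
      apply/negP => /(straddlingP Ksurf dj)[x [_ ob _ _ tC]].
    by apply: (nCD (flag_dart (turn x))) => //; rewrite (org_turn Ksurf).
  have := chi_union Ksurf dj; rewrite -ID S0 cards0.
  by move: (chi_sub I) (chi_sub C) (chi_sub D) => a b c; clear; lia.
have LI : link_sum I = link_sum C + link_sum D.
  rewrite /link_sum (bigID (fun c => corner_vert c \in C)) /=; congr (_ + _).
    apply: eq_bigl => t; rewrite !in_Lk.
    have ot : org (flag_dart (t, false)) = corner_vert t by rewrite (org_flag_dart Ksurf);
      case: (t).
    have sub v : v \notin I -> v \notin C by apply: contraNN; exact: fintype.subsetP.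
    apply/idP/idP.
      by case/andP => /andP[_ /andP[/sub h1 /sub h2]] h3; rewrite h1 h2 h3.
    case/andP => tC /andP[h1 h2]; rewrite tC (fintype.subsetP CI _ tC) andbT /=; apply/andP; split.
      by apply: contraNN h1 => h1; apply: nadj => //; rewrite ot.
    apply: contraNN h2 => h2; apply: (nadj (flag_dart (turn (t, false)))) => //.
    by rewrite (org_turn Ksurf) ot.
  apply: eq_bigl => t; rewrite !in_Lk.
  have ot : org (flag_dart (t, false)) = corner_vert t by rewrite (org_flag_dart Ksurf); case: (t).
  have inDE v : (v \in D) = (v \notin C) && (v \in I) by rewrite /D finset.in_setD.
  have sub v : v \notin I -> v \notin D by apply: contraNN; exact: fintype.subsetP.
  apply/idP/idP.
    case/andP => /andP[tI /andP[/sub h1 /sub h2]] h3.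
    by rewrite h1 h2 inDE tI h3.
  case/andP => tD /andP[h1 h2]; have := tD; rewrite inDE => /andP[-> ->].
  rewrite andbT /=; apply/andP; split.
    apply: contraNN h1 => h1; rewrite inDE h1 andbT; apply/negP => h1C.
    by apply: (nCD (flag_dart (t, false))) => //; rewrite ot.
  apply: contraNN h2 => h2; rewrite inDE h2 andbT; apply/negP => h2C.
  by apply: (nCD (flag_dart (turn (t, false)))) => //; rewrite (org_turn Ksurf) ot.
have -> : star_rhs I = star_rhs C + star_rhs D.
  by rewrite /star_rhs LI chiI intrD; ring.
have -> : star_lhs I = star_lhs C + star_lhs D.
  by rewrite /star_lhs cI natrD; ring.
by apply: ltrD; [exact: H|exact: IH].
Qed.

Lemma Lk_lt n I : link_sum I < (pi / 2) *+ n -> (#|Lk I| < n)%N.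
Proof.
move=> h; rewrite ltnNge; apply/negP => le.
have := le_lt_trans (link_sum_ge I) h; apply/negP; rewrite -leNgt.
by rewrite ler_wpMn2l // divr_ge0 // pi_ge0.
Qed.

(** Euler's formula with 3 |F| = 2 |E| gives |E| = 3 |V| - 6, and there is an
    edge. *)
Lemma euler_edges : chi K = 2 -> (2 < #|vert K|)%N.
Proof.
have sl := sum_slots Ksurf predT.
rewrite /= !sum_nat_const !muln1 card_prod card_ord in sl.
move=> h.
have e1 : (0 < #|edge K|)%N.
  have v0 : (0 < #|vert K|)%N.
    rewrite lt0n; apply/eqP => V0; move: sl h; rewrite /chi V0.
    by move: #|_| #|_| => a b; clear; lia.
  have [v _] : exists v : vert K, v \in predT by apply/card_gt0P.
  have [d _] : exists d : dart K, org d = v by case: Ksurf => -[_ + _] _ _; apply.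
  by apply/card_gt0P; exists d.1.
by move: sl h e1; rewrite /chi; move: #|vert K| #|edge K| #|face K| => a b c; clear; lia.
Qed.

(** If chi(F_C) = 1 and the sum over the link is less than 2 pi, the link has at
    most three elements.  A boundary loop then contradicts the hypothesis on short
    loops, and on the sphere at most k = 1 spur was absorbed, so that C misses at
    most two of the at least three vertices. *)
Lemma star_positive : (0 < chi K) ->
    (forall p v, is_walk v p v -> cycle (fun d d' => d' != rev_dart d) p ->
       p != [::] -> walk_equiv p [::] -> (size p <= 3)%N ->
       size p = 3%N /\ weight_sum Phi p < pi) ->
  condition_star Phi.
Proof.
move=> chi0 short; apply: star_additive => C C0 CT cn.
have pi0 := @pi_gt0 R.
have cC : (0 < #|C|)%N by rewrite card_gt0.
have cV : (0 < #|vert K|)%N by apply: leq_trans cC (max_card _).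
have lhs0 : 0 < star_lhs C.
  rewrite /star_lhs; apply: divr_gt0; last by rewrite ltr0n.
  by rewrite !mulr_gt0 // ?ltr0n // ltr0z.
have [le1 _] := chi_le1 Ksurf C0 CT cn.
have [c0|c0] := lerP (chi_sub C) 0.
  apply: le_lt_trans lhs0; rewrite /star_rhs.
  have := link_sum_ge0 C; have : 2 * pi * (chi_sub C)%:~R <= 0 :> R.
    by rewrite mulr_ge0_le0 ?mulr_ge0 ?pi_ge0 ?lerz0.
  lra.
have c1 : chi_sub C = 1 by lia.
rewrite /star_rhs c1 mulr1.
have [ge|lt] := lerP (2 * pi) (link_sum C); first by lra.
have L3 : (#|Lk C| < 4)%N by apply: Lk_lt; rewrite -mulr_natr; lra.
case: (boundary_dichotomy Ksurf (And4 C0 CT cn c1)) => [[chi2 [k [ck kL]]]|[C' [p [cs [gC' sub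
  bl]]]]]; last first.
  have szp := leq_trans (loop_length bl) (subset_leq_card sub).
  have [[p0 [v pw] nb ph] _] := bl.
  have [sp wp] := short p v pw nb p0 ph (leq_trans szp L3).
  have := le_trans (link_sum_loop bl) (link_sum_sub sub).
  by rewrite sp -mulr_natr; lra.
have V3 := euler_edges chi2.
have cCk : (#|C| + k.+1)%N = #|vert K| by rewrite -ck cardsC.
rewrite /star_lhs chi2 -cCk in V3 *.
have V0 : 0 < (#|C| + k.+1)%:R :> R by rewrite ltr0n addnS.
rewrite ltr_pdivlMr //.
have gL := link_sum_ge C.
have [k0|k1] : k = 0%N \/ k = 1%N by move: L3 kL; clear; lia.
  have C2 : (2 <= #|C|)%N by rewrite k0 in V3; move: V3; clear; lia.
  have C2R : 2 <= #|C|%:R :> R by rewrite (ler_nat R 2).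
  rewrite k0 natrD; have := link_sum_ge0 C.
  nra.
have C1R : 1 <= #|C|%:R :> R by rewrite (ler_nat R 1).
have pi1 : pi <= link_sum C.
  apply: le_trans gL; apply: le_trans (_ : (pi / 2) *+ 2 <= _).
    by rewrite -mulr_natr; lra.
  by apply: ler_wpMn2l; [rewrite divr_ge0 // pi_ge0|rewrite k1 in kL].
rewrite k1 natrD.
nra.
Qed.

(** If the link of C is empty, then a vertex with all its neighbours in C can be
    added, which makes chi equal to 1 without creating a link.  The dichotomy
    applied to the larger set leaves only the sphere. *)
Lemma link_nonempty C : C != finset.set0 -> C != [set: vert K]%SET ->
  full_connected C -> chi_sub C = 0 -> chi K = 0 -> (0 < #|Lk C|)%N.
Proof.
move=> C0 CT cn c0 chi0; rewrite lt0n; apply/negP; rewrite cards_eq0 => /eqP L0.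
have [x cx] := crossing_exists Ksurf C0 CT.
have tn n : third (iter n (next_crossing C) x) \in C.
  apply: contraT => tC.
  have cy : crossing C (iter n (next_crossing C) x) by rewrite crossing_iter.
  by have := link_corner_Lk Ksurf cy tC; rewrite L0 inE.
have hd := hole_darts Ksurf cx tn.
have [bC _] := andP cx.
set b := org (flag_dart x) in hd bC.
have [chi1 cn'] := hole_chi Ksurf cn C0 bC hd; rewrite c0 add0r in chi1.
have C'0 : (C :|: [set b])%SET != finset.set0.
  by apply/finset.set0Pn; exists b; rewrite !inE eqxx orbT.
have [E|C'T] := eqVneq (C :|: [set b])%SET [set: vert K]%SET.
  by move: chi1; rewrite E chi_sub_setT chi0.
have L'0 : Lk (C :|: [set b])%SET = finset.set0.
  apply/finset.setP => t; rewrite [RHS]inE; apply/negP; rewrite in_Lk !inE !negb_or.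
  case/andP => tb /andP[/andP[h1 _] /andP[h2 _]].
  case/orP: tb => [tC|/eqP tb].
    by have : t \in Lk C; [rewrite in_Lk tC h1 h2|rewrite L0 inE].
  move: h1; rewrite hd // (org_flag_dart Ksurf) -tb; by case: (t).
case: (boundary_dichotomy Ksurf (And4 C'0 C'T cn' chi1)) => [[]|[C' [p [cs [_ sub bl]]]]].
  by rewrite chi0.
have := leq_trans (loop_length bl) (subset_leq_card sub); rewrite L'0 cards0 leqn0.
by rewrite size_eq0; case: bl => -[/negbTE -> _ _ _] _.
Qed.

(** The left-hand side vanishes, so it must be shown that the sum over the link
    exceeds 2 pi if chi(F_C) = 1.  Otherwise the link has at most four elements, and
    the boundary loop has three or four edges of total weight at least pi or 2 pi,
    respectively. *)
Lemma star_zero : chi K = 0 ->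
    (forall d, dest d != org d) ->
    (forall d d' : dart K, org d = org d' -> dest d = dest d' -> d = d') ->
    (forall p v, size p = 3%N -> is_walk v p v ->
       cycle (fun d d' => d' != rev_dart d) p -> walk_equiv p [::] ->
       pi <= weight_sum Phi p -> bounds_triangle (edges_of p)) ->
    (forall p v, size p = 4%N -> is_walk v p v ->
       cycle (fun d d' => d' != rev_dart d) p -> walk_equiv p [::] ->
       2 * pi <= weight_sum Phi p -> bounds_two_triangles (edges_of p)) ->
  condition_star Phi.
Proof.
move=> chi0 nl simple tri3 tri4; apply: star_additive => C C0 CT cn.
have pi0 := @pi_gt0 R.
have -> : star_lhs C = 0 by rewrite /star_lhs chi0 mulr0 mul0r.
have [le1 _] := chi_le1 Ksurf C0 CT cn.
have ls0 := link_sum_ge0 C.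
have [c1|ne1] := eqVneq (chi_sub C) 1; last first.
  have [c0|ne0] := eqVneq (chi_sub C) 0.
    have L1 := link_nonempty C0 CT cn c0 chi0.
    rewrite /star_rhs c0 mulr0 addr0 oppr_lt0.
    apply: lt_le_trans (link_sum_ge C); rewrite pmulrn_lgt0 //.
    by rewrite divr_gt0.
  have cm : (chi_sub C)%:~R <= -1 :> R.
    by rewrite (ler_int R _ (-1)); move: le1 ne1 ne0; move: (chi_sub C) => a; clear; lia.
  by rewrite /star_rhs; nra.
rewrite /star_rhs c1 mulr1; suff : 2 * pi < link_sum C by lra.
rewrite ltNge; apply/negP => le2.
case: (boundary_dichotomy Ksurf (And4 C0 CT cn c1)) => [[]|[C' [p [cs [gC' sub bl]]]]].
  by rewrite chi0.
have le2' := le_trans (link_sum_sub sub) le2.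
have L4 : (#|Lk C'| < 5)%N by apply: Lk_lt; rewrite -mulr_natr; lra.
have p4 := leq_trans (loop_length bl) (L4 : (_ <= 4)%N).
have lw := le_trans (link_sum_loop bl) le2'.
have [[p0 [v pw] nb ph] _] := bl.
have p3 := loop_size nl simple pw nb p0.
have [sp|sp] : size p = 3%N \/ size p = 4%N by move: p3 p4; clear; lia.
  apply: (no_triangle_loop Ksurf nl simple gC' chi0 bl L4 sp).
  by apply: (tri3 p v) => //; move: lw; rewrite sp -mulr_natr; lra.
apply: (no_two_triangles_loop Ksurf nl simple gC' chi0 bl L4 sp).
by apply: (tri4 p v) => //; move: lw; rewrite sp -mulr_natr; lra.
Qed.

End Inequality.

(** * Homotopy of paths *)

Local Open Scope classical_set_scope.
Local Open Scope ring_scope.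

Section Paths.
Variable R : realType.

Section RealFunctions.
Variable Z : topologicalType.
Implicit Types f g : Z -> R.

Lemma contD f g : continuous f -> continuous g -> continuous (fun z => f z + g z).
Proof. by move=> cf cg z; apply: cvgD; [exact: cf|exact: cg]. Qed.

Lemma contB f g : continuous f -> continuous g -> continuous (fun z => f z - g z).
Proof. by move=> cf cg z; apply: cvgB; [exact: cf|exact: cg]. Qed.

Lemma contM f g : continuous f -> continuous g -> continuous (fun z => f z * g z).
Proof. by move=> cf cg z; apply: cvgM; [exact: cf|exact: cg]. Qed.

Lemma cont_max f g : continuous f -> continuous g -> continuous (fun z => Num.max (f z) (g z)).
Proof. by move=> cf cg z; apply: continuous_max; [exact: cf|exact: cg]. Qed.

Lemma cont_min f g : continuous f -> continuous g -> continuous (fun z => Num.min (f z) (g z)).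
Proof. by move=> cf cg z; apply: continuous_min; [exact: cf|exact: cg]. Qed.

Lemma cont_cst (T : topologicalType) (a : T) : continuous (fun _ : Z => a).
Proof. by move=> z; exact: cvg_cst. Qed.

Lemma cont_pair (T U : topologicalType) (f : Z -> T) (g : Z -> U) :
  continuous f -> continuous g -> continuous (fun z => (f z, g z)).
Proof. by move=> cf cg z; apply: cvg_pair; [exact: cf|exact: cg]. Qed.

Lemma cont_comp (T U : topologicalType) (f : Z -> T) (g : T -> U) :
  continuous f -> continuous g -> continuous (fun z => g (f z)).
Proof. by move=> cf cg z; apply: continuous_comp; [exact: cf|exact: cg]. Qed.

Lemma cont_fst (T U : topologicalType) (f : Z -> T * U) :
  continuous f -> continuous (fun z => (f z).1).
Proof. by move=> cf; apply: cont_comp cf _ => z; exact: cvg_fst. Qed.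

Lemma cont_snd (T U : topologicalType) (f : Z -> T * U) :
  continuous f -> continuous (fun z => (f z).2).
Proof. by move=> cf; apply: cont_comp cf _ => z; exact: cvg_snd. Qed.

Lemma cont_id : continuous (fun z : Z => z).
Proof. by move=> z; exact: cvg_id. Qed.

(** Maps that are continuous on a subset become continuous everywhere after
    composition with a retraction onto it.  All paths, homotopies and lifts below
    are made total in this way, so that no subspace topologies are needed. *)
Lemma within_comp (T U : topologicalType) (A : set T) (f : T -> U) (g : Z -> T) :
  {within A, continuous f} -> continuous g -> (forall z, A (g z)) ->
  continuous (fun z => f (g z)).
Proof.
move=> /subspace_continuousP cf cg Ag z.
apply: cvg_comp (cf _ (Ag z)) => B; rewrite nbhs_simpl /within /= => hB.
have := cg z _ hB; rewrite !nbhs_simpl /=; apply: filterS => y /=; apply.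
exact: Ag.
Qed.

Lemma paste (X : topologicalType) (f g : Z -> X) (u : Z -> R) :
  continuous f -> continuous g -> continuous u ->
  (forall z, u z = 0 -> f z = g z) ->
  continuous (fun z => if u z <= 0 then f z else g z).
Proof.
move=> cf cg cu fg; pose h z := if u z <= 0 then f z else g z.
rewrite -[X in continuous X]/h.
have cA : closed [set z | u z <= 0].
  by move/continuous_closedP : cu => /(_ _ (@closed_le R 0)).
have cB : closed [set z | 0 <= u z].
  by move/continuous_closedP : cu => /(_ _ (@closed_ge R 0)).
have AB : [set z | u z <= 0] `|` [set z | 0 <= u z] = setT.
  by rewrite -subTset => z _ /=; case: (lerP (u z) 0) => [|/ltW]; [left|right].
apply/continuous_subspace_setT; rewrite -AB.
apply: withinU_continuous => //.
  apply: (subspace_eq_continuous (f := f)); last exact: continuous_subspaceT.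
  by move=> z; rewrite inE /= => uz; rewrite /from_subspace /h uz.
apply: (subspace_eq_continuous (f := g)); last exact: continuous_subspaceT.
move=> z; rewrite inE /= => u0; rewrite /from_subspace /h; case: ifP => // u1.
by rewrite fg //; apply/eqP; rewrite eq_le u1.
Qed.

End RealFunctions.

Definition clamp (x : R) : R := Num.max 0 (Num.min x 1).

Lemma clamp01 x : clamp x \in `[0, 1].
Proof. by rewrite in_itv /= /clamp le_max lexx ge_max ler01 ge_min lexx orbT. Qed.

Lemma clamp_id x : x \in `[0, 1] -> clamp x = x.
Proof.
by rewrite in_itv /= => /andP[x0 x1]; rewrite /clamp (min_idPl _) // (max_idPr _).
Qed.

Lemma clamp0 : clamp 0 = 0.
Proof. by apply: clamp_id; rewrite in_itv /= lexx ler01. Qed.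

Lemma clamp1 : clamp 1 = 1.
Proof. by apply: clamp_id; rewrite in_itv /= lexx ler01. Qed.

Lemma clamp_clamp x : clamp (clamp x) = clamp x.
Proof. exact/clamp_id/clamp01. Qed.

Lemma cont_clamp (Z : topologicalType) (f : Z -> R) :
  continuous f -> continuous (fun z => clamp (f z)).
Proof.
move=> cf; rewrite /clamp; apply: cont_max; first exact: cont_cst.
apply: cont_min => //; exact: cont_cst.
Qed.

Lemma half_at0 : (2 * 0 - 1 <= 0 :> R) = true.
Proof. by lra. Qed.

Lemma half_at1 : (2 * 1 - 1 <= 0 :> R) = false.
Proof. by lra. Qed.

Lemma double_at1 : 2 * 1 - 1 = 1 :> R.
Proof. by lra. Qed.

Section Homotopy.
Variable X : topologicalType.
Implicit Types c : R -> X.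

(** Homotopy relative to the end points.  Only the restrictions of c and c' to
    [0, 1] matter; prescribing H on full lines makes the gluing of homotopies
    immediate. *)
Definition homotopic c c' : Prop :=
  exists H : R * R -> X,
    [/\ continuous H, forall s, H (s, 0) = c (clamp s), forall s, H (s, 1) = c' (clamp s),
        forall t, H (0, t) = c 0 & forall t, H (1, t) = c 1].

Lemma homotopicI c c' (H : R * R -> X) : continuous H ->
    (forall s, s \in `[0, 1] -> H (s, 0) = c s) ->
    (forall s, s \in `[0, 1] -> H (s, 1) = c' s) ->
    (forall t, t \in `[0, 1] -> H (0, t) = c 0) ->
    (forall t, t \in `[0, 1] -> H (1, t) = c 1) ->
  homotopic c c'.
Proof.
move=> cH h0 h1 g0 g1; exists (fun z => H (clamp z.1, clamp z.2)); split.
- apply: cont_comp cH; apply: cont_pair; apply: cont_clamp => z; [exact: cvg_fst|exact: cvg_snd].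
- by move=> s /=; rewrite clamp0 h0 ?clamp01.
- by move=> s /=; rewrite clamp1 h1 ?clamp01.
- by move=> s /=; rewrite clamp0 g0 ?clamp01.
by move=> s /=; rewrite clamp1 g1 ?clamp01.
Qed.

Lemma homotopic_ext c c' c1 c1' :
  {in `[0, 1], c =1 c1} -> {in `[0, 1], c' =1 c1'} -> homotopic c c' -> homotopic c1 c1'.
Proof.
move=> e e' [H [cH h0 h1 g0 g1]]; exists H; split => //.
- by move=> s; rewrite h0 e ?clamp01.
- by move=> s; rewrite h1 e' ?clamp01.
- by move=> t; rewrite g0 -{1}clamp0 -[in RHS]clamp0 e ?clamp01.
by move=> t; rewrite g1 -{1}clamp1 -[in RHS]clamp1 e ?clamp01.
Qed.

Lemma homotopic_ends c c' : homotopic c c' -> c 0 = c' 0 /\ c 1 = c' 1.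
Proof.
by move=> [H [cH h0 h1 g0 g1]]; rewrite -(g0 1) -(g1 1) !h1 clamp0 clamp1.
Qed.

(** Straight-line homotopies in the source of F.  Reparametrizations, units,
    associativity, and contractions of edges and of triangles are all instances. *)
Lemma homotopic_line (F : R * R -> X) (a b : R -> R * R) :
  continuous F -> continuous a -> continuous b -> a 0 = b 0 -> a 1 = b 1 ->
  homotopic (fun s => F (a s)) (fun s => F (b s)).
Proof.
move=> cF ca cb e0 e1.
have c1 : continuous (fun z : R * R => z.1) by move=> z; exact: cvg_fst.
have c2 : continuous (fun z : R * R => z.2) by move=> z; exact: cvg_snd.
have c3 : continuous (fun z : R * R => 1 - z.2) by apply: contB => //; exact: cont_cst.
have ca1 : continuous (fun z : R * R => (a z.1).1) by apply: cont_fst; exact: cont_comp c1 ca.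
have ca2 : continuous (fun z : R * R => (a z.1).2) by apply: cont_snd; exact: cont_comp c1 ca.
have cb1 : continuous (fun z : R * R => (b z.1).1) by apply: cont_fst; exact: cont_comp c1 cb.
have cb2 : continuous (fun z : R * R => (b z.1).2) by apply: cont_snd; exact: cont_comp c1 cb.
apply: (@homotopicI _ _ (fun z => F ((1 - z.2) * (a z.1).1 + z.2 * (b z.1).1,
   (1 - z.2) * (a z.1).2 + z.2 * (b z.1).2))).
- by apply: cont_comp cF; apply: cont_pair; apply: contD; apply: contM.
- by move=> s _ /=; rewrite subr0 !mul1r !mul0r !addr0 -surjective_pairing.
- by move=> s _ /=; rewrite subrr !mul1r !mul0r !add0r -surjective_pairing.
- by move=> t _ /=; rewrite -e0 -!mulrDl subrK !mul1r -surjective_pairing.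
by move=> t _ /=; rewrite -e1 -!mulrDl subrK !mul1r -surjective_pairing.
Qed.

Lemma homotopic_reparam (F : R -> X) (a b : R -> R) :
  continuous F -> continuous a -> continuous b -> a 0 = b 0 -> a 1 = b 1 ->
  homotopic (fun s => F (a s)) (fun s => F (b s)).
Proof.
move=> cF ca cb e0 e1.
apply: (@homotopic_line (fun z => F z.1) (fun s => (a s, 0)) (fun s => (b s, 0))).
- by apply: cont_comp cF => z; exact: cvg_fst.
- by apply: cont_pair => //; exact: cont_cst.
- by apply: cont_pair => //; exact: cont_cst.
- by rewrite e0.
by rewrite e1.
Qed.

Lemma homotopic_refl c : continuous c -> homotopic c c.
Proof.
by move=> cc; apply: (@homotopic_reparam c id id) => // x; exact: cvg_id.
Qed.

Lemma homotopic_sym c c' : homotopic c c' -> homotopic c' c.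
Proof.
move=> h; have [e0 e1] := homotopic_ends h.
have [H [cH h0 h1 g0 g1]] := h.
exists (fun z => H (z.1, 1 - z.2)); split.
- apply: cont_comp cH; apply: cont_pair; first by move=> z; exact: cvg_fst.
  by apply: contB; [exact: cont_cst|move=> z; exact: cvg_snd].
- by move=> s /=; rewrite subr0.
- by move=> s /=; rewrite subrr.
- by move=> s /=; rewrite g0.
by move=> s /=; rewrite g1.
Qed.

Lemma homotopic_trans c1 c2 c3 : homotopic c1 c2 -> homotopic c2 c3 -> homotopic c1 c3.
Proof.
move=> h12 h23; have [e0 e1] := homotopic_ends h12.
have [H [cH h0 h1 g0 g1]] := h12; have [G [cG h0' h1' g0' g1']] := h23.
have c1' : continuous (fun z : R * R => z.1) by move=> z; exact: cvg_fst.
have c2' : continuous (fun z : R * R => 2 * z.2).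
  by apply: contM; [exact: cont_cst|move=> z; exact: cvg_snd].
have c3' : continuous (fun z : R * R => 2 * z.2 - 1) by apply: contB => //; exact: cont_cst.
apply: (@homotopicI _ _ (fun z => if 2 * z.2 - 1 <= 0 then H (z.1, 2 * z.2) else G (z.1,
  2 * z.2 - 1))).
- apply: paste => //.
  + by apply: cont_comp cH; exact: cont_pair.
  + by apply: cont_comp cG; exact: cont_pair.
  by move=> z e; rewrite e h0' (_ : 2 * z.2 = 1) ?h1 //; lra.
- by move=> s s01 /=; rewrite half_at0 mulr0 h0 clamp_id.
- by move=> s s01 /=; rewrite half_at1 double_at1 h1' clamp_id.
- by move=> t _ /=; case: ifP; rewrite ?g0 ?g0' ?e0.
by move=> t _ /=; case: ifP; rewrite ?g1 ?g1' ?e1.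
Qed.

Definition path_cat c c' : R -> X :=
  fun s => if 2 * s - 1 <= 0 then c (2 * s) else c' (2 * s - 1).

Lemma path_cat_cont c c' : continuous c -> continuous c' -> c 1 = c' 0 ->
  continuous (path_cat c c').
Proof.
move=> cc cc' e.
have c2 : continuous (fun s : R => 2 * s) by apply: contM; [exact: cont_cst|exact: cont_id].
have c3 : continuous (fun s : R => 2 * s - 1) by apply: contB => //; exact: cont_cst.
apply: paste => //.
- exact: cont_comp c2 cc.
- exact: cont_comp c3 cc'.
by move=> z h; rewrite h (_ : 2 * z = 1) //; lra.
Qed.

Lemma path_cat0 c c' : path_cat c c' 0 = c 0.
Proof. by rewrite /path_cat half_at0 mulr0. Qed.

Lemma path_cat1 c c' : path_cat c c' 1 = c' 1.
Proof. by rewrite /path_cat half_at1 double_at1. Qed.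

Lemma homotopic_cat c1 c1' c2 c2' : c1 1 = c2 0 ->
  homotopic c1 c1' -> homotopic c2 c2' -> homotopic (path_cat c1 c2) (path_cat c1' c2').
Proof.
move=> e [H [cH h0 h1 g0 g1]] [G [cG h0' h1' g0' g1']].
have cs2 : continuous (fun z : R * R => z.2) by move=> z; exact: cvg_snd.
have c2_ : continuous (fun z : R * R => 2 * z.1).
  by apply: contM; [exact: cont_cst|move=> z; exact: cvg_fst].
have c3_ : continuous (fun z : R * R => 2 * z.1 - 1) by apply: contB => //; exact: cont_cst.
apply: (@homotopicI _ _ (fun z => if 2 * z.1 - 1 <= 0 then H (2 * z.1, z.2) else G (2 * z.1 - 1,
  z.2))).
- apply: paste => //.
  + by apply: cont_comp cH; exact: cont_pair.
  + by apply: cont_comp cG; exact: cont_pair.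
  by move=> z h; rewrite h g0' (_ : 2 * z.1 = 1) ?g1 //; lra.
- move=> s; rewrite in_itv /= /path_cat => /andP[s0 s1]; case: ifP => hs.
    rewrite h0 clamp_id // in_itv /=; apply/andP; split; lra.
  rewrite h0' clamp_id // in_itv /=; apply/andP; split; lra.
- move=> s; rewrite in_itv /= /path_cat => /andP[s0 s1]; case: ifP => hs.
    rewrite h1 clamp_id // in_itv /=; apply/andP; split; lra.
  rewrite h1' clamp_id // in_itv /=; apply/andP; split; lra.
- by move=> t _ /=; rewrite path_cat0 half_at0 mulr0 g0.
by move=> t _ /=; rewrite path_cat1 half_at1 double_at1 g1'.
Qed.

Lemma homotopic_catA c1 c2 c3 :
  continuous c1 -> continuous c2 -> continuous c3 -> c1 1 = c2 0 -> c2 1 = c3 0 ->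
  homotopic (path_cat (path_cat c1 c2) c3) (path_cat c1 (path_cat c2 c3)).
Proof.
move=> k1 k2 k3 e12 e23.
pose F := path_cat c1 (path_cat c2 c3).
have cF : continuous F by apply: path_cat_cont => //; [exact: path_cat_cont|rewrite path_cat0].
(* phi carries the quarters [0, 1/4], [1/4, 1/2] and the half [1/2, 1] to the
   intervals on which c1, c2 and c3 run in the other bracketing. *)
pose phi (s : R) := if 4 * s - 1 <= 0 then 2 * s else
  if 2 * s - 1 <= 0 then s + 1 / 4 else s / 2 + 1 / 2.
have cphi : continuous phi.
  have cM (a : R) : continuous (fun s : R => a * s) by apply: contM;
    [exact: cont_cst|exact: cont_id].
  apply: paste => //.
  + apply: paste => //.
    * by apply: contD; [exact: cont_id|exact: cont_cst].
    * by apply: contD; [apply: contM; [exact: cont_id|exact: cont_cst]|exact: cont_cst].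
    * by apply: contB; [exact: cM|exact: cont_cst].
    by move=> z h; lra.
  + by apply: contB; [exact: cM|exact: cont_cst].
  by move=> z h; rewrite ifT; lra.
have h : homotopic (fun s => F (phi s)) (fun s => F s).
  apply: homotopic_reparam => //; [exact: cont_id| |].
    by rewrite /phi ifT ?mulr0 //; lra.
  by rewrite /phi !ifF; lra.
apply: homotopic_ext h => // s; rewrite in_itv /= => /andP[s0 s1].
rewrite /F /phi /path_cat.
case: (lerP (4 * s - 1) 0) => h1.
  have -> : (2 * s - 1 <= 0) = true by lra.
  have -> : (2 * (2 * s) - 1 <= 0) = true by lra.
  by [].
case: (lerP (2 * s - 1) 0) => h2.
  have -> : (2 * (s + 1 / 4) - 1 <= 0) = false by lra.
  have -> : (2 * (2 * s) - 1 <= 0) = false by lra.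
  have -> : (2 * (2 * (s + 1 / 4) - 1) - 1 <= 0) = true by lra.
  by congr c2; lra.
have -> : (2 * (s / 2 + 1 / 2) - 1 <= 0) = false by lra.
have -> : (2 * (2 * (s / 2 + 1 / 2) - 1) - 1 <= 0) = false by lra.
by congr c3; lra.
Qed.

End Homotopy.
End Paths.

(** * Edge walks as paths *)

Section WalkTopology.
Variables (R : realType) (X : topologicalType) (T : cell_division R X).
Implicit Types (d : dart T) (p q : seq (dart T)) (v w z : vert T) (x : flag T).

Definition dart_path d (s : R) : X := emap (c := T) d.1 (clamp (if d.2 then 1 - s else s)).

Lemma dart_path_rev d s : dart_path (rev_dart d) s = dart_path d (1 - s).
Proof. by case: d => e []; rewrite /dart_path /= ?subKr. Qed.

Lemma cont_1m : continuous (fun s : R => 1 - s).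
Proof. by apply: contB; [exact: cont_cst|exact: cont_id]. Qed.

Lemma edge_path_cont (e : edge T) : continuous (fun s => emap (c := T) e (clamp s)).
Proof.
apply: (@within_comp R R X `[0, 1] (emap (c := T) e)); first exact: emap_continuous.
  by apply: cont_clamp; exact: cont_id.
by move=> s; exact: clamp01.
Qed.

Lemma dart_path_cont d : continuous (dart_path d).
Proof.
rewrite /dart_path; case: d => e [] /=; last exact: edge_path_cont.
by apply: cont_comp (@edge_path_cont e); exact: cont_1m.
Qed.

Lemma dart_path0 d : dart_path d 0 = vmap (c := T) (org d).
Proof.
have [h0 h1] := emap_org (c := T) d.1.
by case: d h0 h1 => e [] /= h0 h1; rewrite /dart_path /= ?subr0 ?clamp0 ?clamp1.
Qed.

Lemma dart_path1 d : dart_path d 1 = vmap (c := T) (dest d).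
Proof. by rewrite -[1]subr0 -dart_path_rev dart_path0. Qed.

Lemma dart_pathE d s : s \in `[0, 1] -> dart_path d s = dart_map d s.
Proof.
move=> s01; rewrite /dart_path /dart_map clamp_id //; case: ifP => // _.
by move: s01; rewrite !in_itv /= => /andP[a b]; apply/andP; split; lra.
Qed.

Fixpoint walk_path v p : R -> X :=
  if p is d :: p' then path_cat (dart_path d) (walk_path (dest d) p') else fun=> vmap (c := T) v.

Lemma walk_path0 v p w : is_walk v p w -> walk_path v p 0 = vmap (c := T) v.
Proof. by case: p => //= d p /andP[/eqP <- _]; rewrite path_cat0 dart_path0. Qed.

Lemma walk_path1 v p w : is_walk v p w -> walk_path v p 1 = vmap (c := T) w.
Proof.
elim: p v => [|d p IH] v /=; first by move/eqP->.
by case/andP => _ /IH; rewrite path_cat1.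
Qed.

Lemma walk_path_cont v p w : is_walk v p w -> continuous (walk_path v p).
Proof.
elim: p v => [|d p IH] v /=; first by move=> _; exact: cont_cst.
case/andP => _ h; apply: path_cat_cont; [exact: dart_path_cont|exact: IH h|].
by rewrite dart_path1 (walk_path0 h).
Qed.

Lemma path_cat_comp (Y : topologicalType) (F : Y -> X) (a b : R -> Y) s :
  F (path_cat a b s) = path_cat (fun s => F (a s)) (fun s => F (b s)) s.
Proof. by rewrite /path_cat; case: ifP. Qed.

Lemma path_cat_ext (Y : topologicalType) (a b a' b' : R -> Y) :
  {in `[0, 1], a =1 a'} -> {in `[0, 1], b =1 b'} -> {in `[0, 1], path_cat a b =1 path_cat a' b'}.
Proof.
move=> ha hb s; rewrite in_itv /= => /andP[s0 s1]; rewrite /path_cat; case: ifP => h.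
  by apply: ha; rewrite in_itv /=; apply/andP; split; lra.
by apply: hb; rewrite in_itv /=; apply/andP; split; lra.
Qed.

Lemma homotopic_cst_cat (c : R -> X) : continuous c ->
  homotopic c (path_cat (fun=> c 0) c).
Proof.
move=> cc.
pose phi : R -> R := path_cat (fun=> 0 : R) (fun s : R => s).
have cphi : continuous phi by apply: path_cat_cont => //; [exact: cont_cst|exact: cont_id].
have h : homotopic (fun s => c s) (fun s => c (phi s)).
  by apply: homotopic_reparam => //; [exact: cont_id|rewrite /phi path_cat0|rewrite /phi path_cat1].
by apply: homotopic_ext h => // s _; rewrite /phi path_cat_comp.
Qed.

Lemma homotopic_cat_cst (c : R -> X) : continuous c ->
  homotopic c (path_cat c (fun=> c 1)).
Proof.
move=> cc.
pose phi : R -> R := path_cat (fun s : R => s) (fun=> 1 : R).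
have cphi : continuous phi by apply: path_cat_cont => //; [exact: cont_id|exact: cont_cst].
have h : homotopic (fun s => c s) (fun s => c (phi s)).
  by apply: homotopic_reparam => //; [exact: cont_id|rewrite /phi path_cat0|rewrite /phi path_cat1].
by apply: homotopic_ext h => // s _; rewrite /phi path_cat_comp.
Qed.

Lemma walk_path_cat v p w q z : is_walk v p w -> is_walk w q z ->
  homotopic (walk_path v (p ++ q)) (path_cat (walk_path v p) (walk_path w q)).
Proof.
move=> + qw; elim: p v => [|d p IH] v /=.
  move=> /eqP ->; rewrite -(walk_path0 qw); apply: homotopic_cst_cat; exact: walk_path_cont qw.
case/andP => _ pw.
apply: homotopic_trans (_ : homotopic _ (path_cat (dart_path d) (path_cat (walk_path (dest d) p)
  (walk_path w q)))) _.
  apply: homotopic_cat (IH _ pw); last by apply: homotopic_refl; exact: dart_path_cont.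
  by rewrite dart_path1 (walk_path0 (is_walk_cat pw qw)).
apply: homotopic_sym; apply: homotopic_catA.
- exact: dart_path_cont.
- exact: walk_path_cont pw.
- exact: walk_path_cont qw.
- by rewrite dart_path1 (walk_path0 pw).
by rewrite (walk_path1 pw) (walk_path0 qw).
Qed.

Definition walk_homotopic v w p q : Prop :=
  [/\ is_walk v p w, is_walk v q w & homotopic (walk_path v p) (walk_path v q)].

Lemma walk_homotopic_refl v w p : is_walk v p w -> walk_homotopic v w p p.
Proof. by move=> pw; split => //; apply: homotopic_refl; exact: walk_path_cont pw. Qed.

Lemma walk_homotopic_sym v w p q : walk_homotopic v w p q -> walk_homotopic v w q p.
Proof. by case=> pw qw h; split => //; exact: homotopic_sym. Qed.

Lemma walk_homotopic_trans v w p q r : walk_homotopic v w p q -> walk_homotopic v w q r ->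
  walk_homotopic v w p r.
Proof. by case=> pw _ h [_ rw h']; split => //; exact: homotopic_trans h h'. Qed.

Lemma walk_homotopic_cat v w z p p' q q' : walk_homotopic v w p p' -> walk_homotopic w z q q' ->
  walk_homotopic v z (p ++ q) (p' ++ q').
Proof.
case=> pw pw' hp [qw qw' hq]; split; [exact: is_walk_cat pw qw|exact: is_walk_cat pw' qw'|].
apply: homotopic_trans (walk_path_cat pw qw) _.
apply: homotopic_trans (homotopic_sym (walk_path_cat pw' qw')).
by apply: homotopic_cat => //; rewrite (walk_path1 pw) (walk_path0 qw).
Qed.

(** Both darts run in the parameter interval of the same edge. *)
Lemma walk_homotopic_cancel d : walk_homotopic (org d) (org d) [:: d; rev_dart d] [::].
Proof.
split; rewrite /= ?dest_rev ?eqxx //.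
pose a (s : R) : R := if d.2 then 1 - s else s.
have ca : continuous a.
  by rewrite /a; case: (d.2); [exact: cont_1m|exact: cont_id].
pose phi : R -> R := path_cat a (path_cat (fun s => a (1 - s)) (fun=> a 0)).
have cphi : continuous phi.
  apply: path_cat_cont => //; last by rewrite path_cat0 subr0.
  by apply: path_cat_cont; [exact: cont_comp cont_1m ca|exact: cont_cst|rewrite subrr].
have h : homotopic (fun s => emap (c := T) d.1 (clamp (phi s)))
    (fun s => emap (c := T) d.1 (clamp (a 0))).
  apply: (homotopic_reparam (F := fun s => emap (c := T) d.1 (clamp s)) (b := fun=> a 0)) => //.
  - exact: edge_path_cont.
  - exact: cont_cst.
  - by rewrite /phi path_cat0.
  by rewrite /phi !path_cat1.
apply: homotopic_ext h => s _; last exact: dart_path0.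
rewrite /phi /= /path_cat; case: ifP => // _; case: ifP => _; first by rewrite dart_path_rev.
by exact: dart_path0.
Qed.

(** The corner of the standard simplex at the origin of the flag. *)
Definition flag_from x : R * R := corner R (flag_corner x).2.

Definition flag_segment x (s : R) : R * R :=
  ((1 - s) * (flag_from x).1 + s * (flag_from (flip x)).1,
   (1 - s) * (flag_from x).2 + s * (flag_from (flip x)).2).

Lemma flag_segment_cont x : continuous (flag_segment x).
Proof.
by apply: cont_pair; apply: contD; apply: contM;
   first [exact: cont_1m | exact: cont_cst | exact: cont_id].
Qed.

Lemma flag_segment0 x : flag_segment x 0 = flag_from x.
Proof. by rewrite /flag_segment subr0 !mul1r !mul0r !addr0 -surjective_pairing. Qed.

Lemma flag_segment1 x : flag_segment x 1 = flag_from (flip x).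
Proof. by rewrite /flag_segment subrr !mul1r !mul0r !add0r -surjective_pairing. Qed.

Lemma flag_segment_flip x s : flag_segment (flip x) s = flag_segment x (1 - s).
Proof. by rewrite /flag_segment flipK subKr; congr (_, _); rewrite addrC. Qed.

Lemma flag_segment_side (f : face T) i s : flag_segment ((f, i), false) s = side_point i s.
Proof. by []. Qed.

Lemma fmap_segment x s : s \in `[0, 1] ->
  Defs.fmap (c := T) x.1.1 (flag_segment x s) = dart_map (flag_dart x) s.
Proof.
move=> s01; case: x => -[f i] b.
have H (t : R) : t \in `[0, 1] ->
    Defs.fmap (c := T) f (flag_segment ((f, i), false) t) = dart_map (flag_dart ((f, i), false)) t.
  by move=> t01; rewrite flag_segment_side fmap_side // /dart_map /flag_dart /= addbF.
case: b => //=; last exact: H.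
have s01' : 1 - s \in `[0, 1].
  by move: s01; rewrite !in_itv /= => /andP[a b]; apply/andP; split; lra.
rewrite -[s in LHS](subKr 1) -[((f, i), true)]/(flip ((f, i), false)) flag_segment_flip subKr.
by rewrite H // /dart_map /flag_dart /= addbF addbT; case: (side f i).2 => //=; rewrite subKr.
Qed.

Definition simplex_retract (u : R * R) : R * R :=
  (clamp u.1, Num.min (clamp u.2) (1 - clamp u.1)).

Lemma simplex_retract_in u : simplex (simplex_retract u).
Proof.
rewrite /simplex_retract /simplex /=; have := clamp01 u.1; have := clamp01 u.2.
rewrite !in_itv /= => /andP[a b] /andP[c d]; split => //.
  by rewrite le_min a /=; lra.
by rewrite -lerBrDl ge_min lexx orbT.
Qed.

Lemma simplex_retract_id u : simplex u -> simplex_retract u = u.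
Proof.
case: u => a b [/= a0 b0 ab]; rewrite /simplex_retract /= !clamp_id ?(min_idPl _) //; first by lra.
- by rewrite in_itv /=; apply/andP; split; lra.
by rewrite in_itv /=; apply/andP; split; lra.
Qed.

Lemma simplex_retract_cont : continuous simplex_retract.
Proof.
have c1 : continuous (fun u : R * R => clamp u.1) by apply: cont_clamp => z; exact: cvg_fst.
apply: cont_pair => //; apply: cont_min; first by apply: cont_clamp => z; exact: cvg_snd.
by apply: contB => //; exact: cont_cst.
Qed.

Lemma face_retract_cont (f : face T) : continuous (fun u =>
  Defs.fmap (c := T) f (simplex_retract u)).
Proof.
apply: (@within_comp (R * R)%type (R * R)%type X (@simplex R) (Defs.fmap (c := T) f)).
- exact: fmap_continuous.
- exact: simplex_retract_cont.
exact: simplex_retract_in.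
Qed.

Lemma corner_simplex (i : 'I_3) : simplex (corner R i).
Proof. by case: i => -[|[|[|]]] //= lt; rewrite /simplex /corner /= ?mulr0n ?mulr1n; split=> /=;
  lra. Qed.

Lemma simplex_convex (P Q : R * R) s : simplex P -> simplex Q -> s \in `[0, 1] ->
  simplex ((1 - s) * P.1 + s * Q.1, (1 - s) * P.2 + s * Q.2).
Proof.
case: P => a1 a2 [/= a10 a20 a12]; case: Q => b1 b2 [/= b10 b20 b12].
rewrite in_itv /= => /andP[s0 s1]; have t0 : 0 <= 1 - s by lra.
have h1 := ler_wpM2l t0 a12; have h2 := ler_wpM2l s0 b12.
split => /=; [by rewrite addr_ge0 ?mulr_ge0..|].
rewrite addrACA -!mulrDr; apply: le_trans (lerD h1 h2) _; lra.
Qed.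

Lemma flag_segment_simplex x s : s \in `[0, 1] -> simplex (flag_segment x s).
Proof. by apply: simplex_convex; exact: corner_simplex. Qed.

Lemma dart_path_segment x s : s \in `[0, 1] -> dart_path (flag_dart x) s =
  Defs.fmap (c := T) x.1.1 (simplex_retract (flag_segment x s)).
Proof. by move=> s01; rewrite dart_pathE // simplex_retract_id ?fmap_segment //;
  exact: flag_segment_simplex. Qed.

Hypothesis Ksurf : combinatorial_surface T.

(** The boundary of a triangle is a closed path in the standard simplex. *)
Lemma walk_homotopic_face x : walk_homotopic (org (flag_dart x)) (org (flag_dart x))
  [:: flag_dart x; flag_dart (turn (flip x)); rev_dart (flag_dart (turn x))] [::].
Proof.
have [oa ob oc] := org_triangle Ksurf x.
split; first by rewrite /= !eqxx ob dest_rev -[org (rev_dart _)]/(dest _) oc oa !eqxx.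
  by rewrite /= eqxx.
set y := turn (flip x); pose z := flip (turn x).
have zd : rev_dart (flag_dart (turn x)) = flag_dart z by rewrite /z flag_dart_flip.
have xy : flag_from (flip x) = flag_from y by rewrite /flag_from /y flag_corner_turn.
have yz : flag_from (flip y) = flag_from z.
  by rewrite /flag_from /y /z -hexagon flag_corner_turn.
have zx : flag_from (flip z) = flag_from x by rewrite /flag_from /z flipK flag_corner_turn.
pose phi : R -> R * R := path_cat (flag_segment x) (path_cat (flag_segment y) (path_cat
  (flag_segment z) (fun=> flag_segment x 0))).
have cphi : continuous phi.
  apply: path_cat_cont; [exact: flag_segment_cont| |by rewrite path_cat0 flag_segment1
    flag_segment0].
  apply: path_cat_cont; [exact: flag_segment_cont| |by rewrite path_cat0 flag_segment1
    flag_segment0].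
  by apply: path_cat_cont; [exact: flag_segment_cont|exact: cont_cst|rewrite flag_segment1
    flag_segment0].
pose F u := Defs.fmap (c := T) x.1.1 (simplex_retract u).
have h : homotopic (fun s => F (phi s)) (fun s => F (flag_segment x 0)).
  apply: (homotopic_line (b := fun=> flag_segment x 0)) => //.
  - exact: face_retract_cont.
  - exact: cont_cst.
  - by rewrite /phi path_cat0.
  by rewrite /phi !path_cat1.
have Fx0 : F (flag_segment x 0) = vmap (c := T) (org (flag_dart x)).
  by rewrite /F -dart_path_segment ?dart_path0 // in_itv /= lexx ler01.
rewrite zd; apply: homotopic_ext h => s s01; last by rewrite /= Fx0.
rewrite /phi (path_cat_comp F) /=; apply: path_cat_ext s01; first by move=> t t01;
  rewrite dart_path_segment.
move=> t t01; rewrite (path_cat_comp F); apply: path_cat_ext t01; first by move=> {}t t01;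
  rewrite dart_path_segment.
move=> {}t t01; rewrite (path_cat_comp F); apply: path_cat_ext t01; first by move=> {}t t01;
  rewrite dart_path_segment.
by move=> {}t _; rewrite Fx0 -zd dest_rev oa.
Qed.

Lemma walk_homotopic_rev v p w : is_walk v p w -> walk_homotopic v v (p ++ rev_walk p) [::].
Proof.
elim: p v => [|d p IH] v /=; first by move=> _; apply: walk_homotopic_refl; rewrite /= eqxx.
case/andP => /eqP <- pw.
have -> : d :: p ++ rev_walk (d :: p) = [:: d] ++ (p ++ rev_walk p) ++ [:: rev_dart d].
  by rewrite rev_walk_cons -!catA.
have hd : is_walk (org d) [:: d] (dest d) by rewrite /= !eqxx.
have hr : is_walk (dest d) [:: rev_dart d] (org d) by rewrite /= dest_rev !eqxx.
apply: walk_homotopic_trans (walk_homotopic_cancel d).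
apply: walk_homotopic_cat (walk_homotopic_refl hd) _; rewrite -[[:: rev_dart d]]cat0s.
exact: walk_homotopic_cat (IH _ pw) (walk_homotopic_refl hr).
Qed.

Lemma walk_homotopic_revl v p w : is_walk v p w -> walk_homotopic w w (rev_walk p ++ p) [::].
Proof. by move=> pw; rewrite -{2}(rev_walkK p); apply: walk_homotopic_rev (is_walk_rev pw). Qed.

Lemma walk_homotopic_insert v w z p q r : is_walk v p w -> walk_homotopic w w r [::] ->
  is_walk w q z ->
  walk_homotopic v z (p ++ r ++ q) (p ++ q).
Proof.
move=> pw hr qw; apply: walk_homotopic_cat (walk_homotopic_refl pw) _.
by rewrite -[q in X in walk_homotopic _ _ _ X]cat0s;
  apply: walk_homotopic_cat hr (walk_homotopic_refl qw).
Qed.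

Section Based.
Variables (r : vert T) (tether : vert T -> seq (dart T)).
Hypothesis tetherP : forall v, is_walk r (tether v) v.

(** [walk_equiv] passes through lists that are not walks.  Joining both ends of
    every dart to a base point r by the walks [tether] turns every list into a
    closed walk at r, and the generators of [walk_equiv] into homotopies. *)
Definition based p : seq (dart T) :=
  flatten [seq tether (org d) ++ [:: d] ++ rev_walk (tether (dest d)) | d <- p].

Lemma based_is_walk p : is_walk r (based p) r.
Proof.
elim: p => [|d p IH] /=; first exact: eqxx.
apply: is_walk_cat IH; apply: is_walk_cat (tetherP (org d)) _ => /=.
by rewrite eqxx /=; exact: is_walk_rev.
Qed.

Lemma based_cat p q : based (p ++ q) = based p ++ based q.
Proof. by rewrite /based map_cat flatten_cat. Qed.

(** On an actual walk the tethers in between cancel. *)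
Lemma walk_homotopic_based v p w : is_walk v p w ->
  walk_homotopic r r (based p) (tether v ++ p ++ rev_walk (tether w)).
Proof.
elim: p v => [|d p IH] v /=.
  by move/eqP->; apply: walk_homotopic_sym; exact: walk_homotopic_rev (tetherP w).
case/andP => /eqP <- pw.
have hd : is_walk (org d) [:: d] (dest d) by rewrite /= !eqxx.
have k1 := tetherP (org d); have k2 := tetherP (dest d); have k3 := is_walk_rev (tetherP w).
have h1 : is_walk r (tether (org d) ++ [:: d] ++ rev_walk (tether (dest d))) r.
  apply: is_walk_cat k1 _; apply: is_walk_cat hd _; exact: is_walk_rev.
apply: walk_homotopic_trans (walk_homotopic_cat (walk_homotopic_refl h1) (IH _ pw)) _.
have -> : (tether (org d) ++ [:: d] ++ rev_walk (tether (dest d))) ++ tether (dest d) ++ p ++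
  rev_walk (tether w)
   = (tether (org d) ++ [:: d]) ++ (rev_walk (tether (dest d)) ++ tether (dest d)) ++ (p ++
     rev_walk (tether w)).
  by rewrite -!catA.
have -> : tether (org d) ++ d :: p ++ rev_walk (tether w) = (tether (org d) ++ [:: d]) ++ (p ++
  rev_walk (tether w)).
  by rewrite -catA.
apply: walk_homotopic_insert (walk_homotopic_revl k2) _;
  [exact: is_walk_cat k1 hd|exact: is_walk_cat pw k3].
Qed.

Lemma based_null v p : walk_homotopic v v p [::] -> walk_homotopic r r (based p) [::].
Proof.
move=> h; have [pw _ _] := h; apply: walk_homotopic_trans (walk_homotopic_based pw) _.
apply: walk_homotopic_trans (walk_homotopic_rev (tetherP v)).
by apply: walk_homotopic_cat (walk_homotopic_refl (tetherP v)) _;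
  rewrite -[rev_walk _ in X in walk_homotopic _ _ _ X]cat0s;
   apply: walk_homotopic_cat h (walk_homotopic_refl (is_walk_rev (tetherP v))).
Qed.

Lemma walk_equiv_based p q : walk_equiv p q -> walk_homotopic r r (based p) (based q).
Proof.
elim => [{}p|{}p {}q _|{}p {}q s _ h _ h'|{}p p' {}q q' _ h _ h'|d|x].
- exact: walk_homotopic_refl (based_is_walk p).
- exact: walk_homotopic_sym.
- exact: walk_homotopic_trans h h'.
- by rewrite !based_cat; exact: walk_homotopic_cat h h'.
- exact: based_null (walk_homotopic_cancel d).
exact: based_null (walk_homotopic_face x).
Qed.

Lemma walk_equiv_based_null v p : is_walk v p v -> walk_equiv p [::] -> walk_homotopic v v p [::].
Proof.
move=> pw h; have kv := tetherP v; have rk := is_walk_rev kv.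
have h1 : walk_homotopic r r (tether v ++ p ++ rev_walk (tether v)) [::].
  by apply: walk_homotopic_trans (walk_equiv_based h); apply: walk_homotopic_sym;
    exact: walk_homotopic_based.
have h2 : walk_homotopic v v (rev_walk (tether v) ++ (tether v ++ p ++ rev_walk (tether v)) ++
  tether v) [::].
  apply: walk_homotopic_trans (walk_homotopic_revl kv).
  exact: walk_homotopic_insert rk h1 kv.
apply: walk_homotopic_trans h2; apply: walk_homotopic_sym.
have -> : rev_walk (tether v) ++ (tether v ++ p ++ rev_walk (tether v)) ++ tether v =
    (rev_walk (tether v) ++ tether v) ++ p ++ (rev_walk (tether v) ++ tether v) by rewrite -!catA.
have := walk_homotopic_cat (walk_homotopic_revl kv) (walk_homotopic_cat (walk_homotopic_refl pw)
  (walk_homotopic_revl kv)).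
by rewrite cats0.
Qed.

End Based.

Lemma walk_equiv_homotopic v p : is_walk v p v -> walk_equiv p [::] -> walk_homotopic v v p [::].
Proof.
have tether_exists w : exists q, is_walk v q w.
  have : connect (@vert_adj T) v w.
    by case: Ksurf => _ _; apply.
  case/connectP => s + ->; elim: s v => [|a s IH] u /=; first by exists [::]; rewrite /= eqxx.
  case/andP => /existsP[d /andP[/eqP <- /eqP <-]] /IH[q qw].
  by exists (d :: q); rewrite /= eqxx.
have [tether tetherP] := choice tether_exists.
exact: (walk_equiv_based_null (tether := tether)).
Qed.

End WalkTopology.

(** * Edge loops and cells of a connected surface *)

Section NullLoop.
Variables (R : realType) (X : topologicalType) (T : cell_division R X).
Implicit Types (d : dart T) (p q : seq (dart T)) (v w z : vert T) (x : flag T).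

(** [walk] with continuous pieces also outside their unit intervals. *)
Fixpoint clamped_walk d p (s : R) : X :=
  if p is d' :: p' then if s - 1 <= 0 then dart_path d s else clamped_walk d' p' (s - 1)
  else dart_path d s.

Lemma clamped_walk0 d p : clamped_walk d p 0 = vmap (c := T) (org d).
Proof. by case: p => [|d' p] /=; rewrite ?ifT ?dart_path0 //; lra. Qed.

Lemma clamped_walk_cont d p w : is_walk (dest d) p w -> continuous (clamped_walk d p).
Proof.
elim: p d => [|d' p IH] d /=; first by move=> _; exact: dart_path_cont.
case/andP => /eqP e pw.
have cm : continuous (fun s : R => s - 1) by apply: contB; [exact: cont_id|exact: cont_cst].
apply: paste => //.
- exact: dart_path_cont.
- exact: cont_comp cm (IH _ pw).
by move=> s h; rewrite h (_ : s = 1) ?dart_path1 ?clamped_walk0 ?e //; lra.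
Qed.

Lemma clamped_walkE d p s : 0 <= s <= (size p).+1%:R -> clamped_walk d p s = walk d p s.
Proof.
elim: p d s => [|d' p IH] d s /= /andP[s0 s1].
  by rewrite dart_pathE // in_itv /= s0.
rewrite subr_le0; case: ifP => h; first by rewrite dart_pathE // in_itv /= s0.
apply: IH; rewrite -natr1 in s1; move/negbT: h; rewrite -ltNge => h.
by apply/andP; split; lra.
Qed.

(** Running through n edges in equal times is a piecewise linear change of
    parameter of the nested concatenation. *)
Lemma homotopic_clamped_walk d p w : is_walk (dest d) p w ->
  homotopic (fun s => clamped_walk d p (s * (size p).+1%:R)) (walk_path (org d) (d :: p)).
Proof.
elim: p d => [|d' p IH] d.
  move=> _; apply: homotopic_ext (homotopic_cat_cst (@dart_path_cont _ _ T d)) => s _ /=.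
    by rewrite mulr1.
  by rewrite dart_path1.
move=> pw; have /andP[/eqP e pw'] := pw.
set m := (size p).+1.
have m0 : 0 < m%:R :> R by rewrite ltr0n.
have ctw : continuous (clamped_walk d' p) by exact: clamped_walk_cont pw'.
have ctm : continuous (fun s : R => clamped_walk d' p (s * m%:R)).
  by apply: cont_comp ctw; apply: contM; [exact: cont_id|exact: cont_cst].
have cF : continuous (path_cat (dart_path d) (fun s : R => clamped_walk d' p (s * m%:R))).
  by apply: path_cat_cont => //; [exact: dart_path_cont|rewrite mul0r dart_path1 clamped_walk0 e].
pose n : R := m.+1%:R.
have nE : n = m%:R + 1 by rewrite /n -natr1.
pose phi (s : R) := if s * n - 1 <= 0 then s * n / 2 else 1 / 2 + (s * n - 1) / (2 * m%:R).
have csn : continuous (fun s : R => s * n) by apply: contM; [exact: cont_id|exact: cont_cst].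
have csn1 : continuous (fun s : R => s * n - 1) by apply: contB => //; exact: cont_cst.
have cphi : continuous phi.
  apply: paste => //.
  - by apply: contM => //; exact: cont_cst.
  - by apply: contD; [exact: cont_cst|apply: contM => //; exact: cont_cst].
  by move=> s h; rewrite h mul0r addr0; lra.
have h : homotopic (fun s => path_cat (dart_path d) (fun s : R => clamped_walk d' p (s * m%:R))
  (phi s))
    (fun s => path_cat (dart_path d) (fun s : R => clamped_walk d' p (s * m%:R)) s).
  apply: homotopic_reparam => //; first exact: cont_id.
    by rewrite /phi mul0r sub0r ifT ?mul0r //; lra.
  rewrite /phi mul1r nE addrK ifF; first by field; rewrite gt_eqF.
  by apply/negbTE; rewrite -ltNge.
apply: homotopic_trans (_ : homotopic _ (path_cat (dart_path d) (fun s : R => clamped_walk d' p (s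
  * m%:R)))) _.
  apply: homotopic_ext h => s; rewrite in_itv /= => /andP[s0 s1] //.
  rewrite -/m -/n /path_cat /phi; case: (lerP (s * n - 1) 0) => h.
    rewrite ifT; last by lra.
    by congr dart_path; lra.
  have h2 : 2 * (1 / 2 + (s * n - 1) / (2 * m%:R)) - 1 = (s * n - 1) / m%:R.
    by field; rewrite gt_eqF.
  rewrite h2 ifF; last by apply/negbTE; rewrite -ltNge divr_gt0.
  by rewrite divfK // gt_eqF.
apply: homotopic_cat => /=.
- by rewrite dart_path1 mul0r clamped_walk0 e.
- by apply: homotopic_refl; exact: dart_path_cont.
exact: IH pw'.
Qed.

Hypothesis Ksurf : combinatorial_surface T.

(** The combinatorial data of a boundary loop give the topological notion of a
    null homotopic edge loop. *)
Lemma walk_equiv_null_loop v p : p != [::] -> is_walk v p v ->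
    cycle (fun d d' => d' != rev_dart d) p -> walk_equiv p [::] ->
  null_homotopic_edge_loop p.
Proof.
case: p => // d p _ pw nb ph; have [_ _ h] := walk_equiv_homotopic Ksurf pw ph.
have /andP[/eqP od pw'] := pw.
split => //; first exact: walk_cycle pw.
have h' : homotopic (fun s => clamped_walk d p (s * (size p).+1%:R)) (walk_path v [::]).
  by apply: homotopic_trans h; rewrite -od; exact: homotopic_clamped_walk pw'.
have [H [cH h0 h1 g0 g1]] := h'.
have [_ e1] := homotopic_ends h'.
have E s : s \in `[0, 1] -> clamped_walk d p (s * (size p).+1%:R) = walk d p (s * (size p).+1%:R).
  rewrite in_itv /= => /andP[s0 s1]; apply: clamped_walkE; rewrite mulr_ge0 //=.
  by rewrite -[leRHS]mul1r ler_wpM2r.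
have c0 : walk d p (0 * (size p).+1%:R) = vmap (c := T) v.
  by rewrite -E ?in_itv /= ?lexx ?ler01 // mul0r clamped_walk0 od.
exists H; split.
- exact: continuous_subspaceT.
- by move=> s s01; rewrite h0 clamp_id // E.
- by move=> t _; rewrite g0 /= c0 mul0r clamped_walk0 od.
- by move=> t _; rewrite g1 /= c0 e1.
by move=> s _; rewrite h1 /= c0.
Qed.

End NullLoop.

Section CellStructure.
Variables (R : realType) (X : topologicalType) (T : cell_division R X).
Implicit Types (d : dart T) (v w : vert T) (x : flag T).

Definition cell_index : Type := (vert T + (edge T * R + face T * (R * R)))%type.

Definition cell_map (z : cell_index) : X :=
  match z with
  | inl v => vmap (c := T) v
  | inr (inl es) => emap (c := T) es.1 es.2
  | inr (inr fu) => Defs.fmap (c := T) fu.1 fu.2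
  end.

Lemma cell_inj (z z' : cell_index) : open_cell_points z -> open_cell_points z' ->
  cell_map z = cell_map z' -> z = z'.
Proof.
move=> oz oz' e; have [_ inj _] := @open_cells R X T.
by apply: inj => //; rewrite inE.
Qed.

Lemma cell_surj a : exists2 z : cell_index, open_cell_points z & cell_map z = a.
Proof.
have [_ _ surj] := @open_cells R X T.
by have [z oz <-] := surj a I; exists z.
Qed.

Lemma vmap_inj v w : vmap (c := T) v = vmap (c := T) w -> v = w.
Proof. by move=> e; have [] := @cell_inj (inl v) (inl w) I I e. Qed.

Lemma side_point0 i : side_point i 0 = corner R i.
Proof. by rewrite /side_point subr0 !mul1r !mul0r !addr0 -surjective_pairing. Qed.

Lemma side_point1 i : side_point i 1 = corner R (ordS i).
Proof. by rewrite /side_point subrr !mul1r !mul0r !add0r -surjective_pairing. Qed.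

Lemma fmap_side_path f i s : s \in `[0, 1] ->
  Defs.fmap (c := T) f (side_point i s) = dart_path (side f i) s.
Proof. by move=> s01; rewrite dart_pathE // fmap_side. Qed.

Lemma fmap_corner f i : Defs.fmap (c := T) f (corner R i) = vmap (c := T) (org (side f i)).
Proof. by rewrite -side_point0 fmap_side_path ?dart_path0 // in_itv /= lexx ler01. Qed.

(** The two sides at a corner of a triangle give the same point of X, and the
    vertices are distinct points. *)
Lemma corner_compat (f : face T) i : org (rev_dart (side f i)) = org (side f (ordS i)).
Proof.
apply: vmap_inj; rewrite -fmap_corner -side_point1 fmap_side_path ?dart_path1 //.
by rewrite in_itv /= lexx ler01.
Qed.

Lemma side_point_coord (s : R) :
  [/\ side_point (@Ordinal 3 0 isT) s = (s, 0),
      side_point (@Ordinal 3 1 isT) s = (1 - s, s) &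
      side_point (@Ordinal 3 2 isT) s = (0, 1 - s)].
Proof.
have e0 : ordS (@Ordinal 3 0 isT) = @Ordinal 3 1 isT by apply/val_inj.
have e1 : ordS (@Ordinal 3 1 isT) = @Ordinal 3 2 isT by apply/val_inj.
have e2 : ordS (@Ordinal 3 2 isT) = @Ordinal 3 0 isT by apply/val_inj.
rewrite /side_point e0 e1 e2 /corner /= ?mulr0n ?mulr1n.
by split; congr (_, _); ring.
Qed.

Lemma simplexP (u : R * R) : simplex u ->
  open_simplex u \/ exists i s, s \in `[0, 1] /\ u = side_point i s.
Proof.
case: u => a b [/= a0 b0 ab].
case: (ltrP 0 a) => a1; last first.
  right; exists (@Ordinal 3 2 isT), (1 - b); rewrite in_itv /=; split.
    by apply/andP; split; lra.
  by have [_ _ ->] := side_point_coord (1 - b); congr (_, _); lra.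
case: (ltrP 0 b) => b1; last first.
  right; exists (@Ordinal 3 0 isT), a; rewrite in_itv /=; split.
    by apply/andP; split; lra.
  by have [-> _ _] := side_point_coord a; congr (_, _); lra.
case: (ltrP (a + b) 1) => ab1; first by left.
right; exists (@Ordinal 3 1 isT), b; rewrite in_itv /=; split.
  by apply/andP; split; lra.
by have [_ -> _] := side_point_coord b; congr (_, _); lra.
Qed.

Lemma edge_pointP (e : edge T) s : s \in `[0, 1] ->
  (s \in `]0, 1[) \/ exists2 d, (d.1 = e) & (emap (c := T) e s = vmap (c := T) (org d)).
Proof.
have [h0 h1] := @emap_org R X T e.
rewrite !in_itv /= => /andP[]; rewrite le_eqVlt => /predU1P[<- _|s0].
  by right; exists (e, false).
by rewrite le_eqVlt => /predU1P[->|s1]; [right; exists (e, true)|left; rewrite s0].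
Qed.

Hypotheses (hausX : hausdorff_space X) (connX : connected [set: X]).

Lemma closed_edge (e : edge T) : closed (emap (c := T) e @` `[0, 1]).
Proof.
apply: compact_closed => //; apply: continuous_compact; last exact: segment_compact.
exact: emap_continuous.
Qed.

Lemma closed_face (f : face T) : closed (Defs.fmap (c := T) f @` @simplex R).
Proof.
have -> : Defs.fmap (c := T) f @` @simplex R =
    (fun u => Defs.fmap (c := T) f (simplex_retract u)) @` (`[0, 1] `*` `[0, 1]).
  apply/seteqP; split => x [u su <-].
    exists u; last by rewrite simplex_retract_id.
    case: su => a b ab; split; rewrite /= in_itv /=; apply/andP; split => //.
      by apply: le_trans ab; rewrite lerDl.
    by apply: le_trans ab; rewrite lerDr.
  by exists (simplex_retract u) => //; exact: simplex_retract_in.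
apply: compact_closed => //; apply: continuous_compact.
  by apply: continuous_subspaceT; exact: face_retract_cont.
by apply: compact_setX; exact: segment_compact.
Qed.

(** The closed cells with vertices reachable from v and the other ones form two
    disjoint closed sets that cover X, because each closed cell is the image of a
    compact set and lies in the union of the open cells of one kind. *)
Lemma vertices_connected v w : connect (@vert_adj T) v w.
Proof.
pose S w := connect (@vert_adj T) v w.
have Sd d : S (dest d) = S (org d).
  have H d' : S (org d') -> S (dest d').
    move=> h; apply: connect_trans h (connect1 _).
    by apply/existsP; exists d'; rewrite !eqxx.
  by apply/idP/idP; [move/(H (rev_dart d)); rewrite dest_rev|exact: H].
pose inS (z : cell_index) : bool := match z with
  | inl w => S w
  | inr (inl es) => S (org (es.1, false))
  | inr (inr fu) => S (org (side fu.1 ord0)) end.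
have Sf f i : S (org (side f i)) = S (org (side f ord0)).
  have H j : S (org (side f (ordS j))) = S (org (side f j)).
    by rewrite -corner_compat -[org (rev_dart _)]/(dest _) Sd.
  have : [|| i == ord0, i == ordS ord0 | i == ordS (ordS ord0)] by case: i => -[|[|[|]]].
  by case/or3P => /eqP ->; rewrite ?H.
have Se d : S (org (d.1, false)) = S (org d).
  by case: d => e [] //=; rewrite -(Sd (e, true)).
have edgeS (e : edge T) s : s \in `[0, 1] -> exists z, [/\ open_cell_points z,
    cell_map z = emap (c := T) e s & inS z = S (org (e, false))].
  case/(@edge_pointP e) => [s01|[d de ->]]; first by exists (inr (inl (e, s))).
  by exists (inl (org d)); split => //=; rewrite -Se de.
have faceS (f : face T) u : simplex u -> exists z, [/\ open_cell_points z,
    cell_map z = Defs.fmap (c := T) f u & inS z = S (org (side f ord0))].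
  case/simplexP => [ou|[i [s [s01 ->]]]]; first by exists (inr (inr (f, u))).
  have s01' : (if (side f i).2 then 1 - s else s) \in `[0, 1].
    case: ifP => // _; move: s01; rewrite !in_itv /= => /andP[a b].
    by apply/andP; split; lra.
  have [z [oz zm zS]] := edgeS (side f i).1 _ s01'.
  by exists z; split => //; [rewrite zm fmap_side|rewrite zS Se Sf].
pose P b := [set x | exists z, [/\ open_cell_points z, cell_map z = x & inS z = b]].
have clP b : closed (P b).
  pose U := (\bigcup_(w in [set w : vert T | S w = b]) [set vmap (c := T) w]) `|`
    (\bigcup_(e in [set e : edge T | S (org (e, false)) = b]) (emap (c := T) e @` `[0, 1])) `|`
    (\bigcup_(f in [set f : face T | S (org (side f ord0)) = b])
      (Defs.fmap (c := T) f @` @simplex R)).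
  have -> : P b = U.
    apply/seteqP; split => x.
      case=> -[w'|[[e s]|[f u]]] /= [oz <- zb].
      - by left; left; exists w'.
      - left; right; exists e => //; exists s => //=; move: oz; rewrite /= !in_itv /=.
        by case/andP => /ltW -> /ltW ->.
      by right; exists f => //; exists u => //; case: oz => /ltW a /ltW b0 /ltW c.
    case=> [[[w' wb ->]|[e eb [s s01 <-]]]|[f fb [u su <-]]].
    - by exists (inl w').
    - by have [z [oz zm zS]] := edgeS e s s01; exists z; rewrite zS.
    by have [z [oz zm zS]] := faceS f u su; exists z; rewrite zS.
  apply: closedU; first apply: closedU.
  - apply: closed_bigcup; [exact: finite_finset|]; move=> w' _; apply: compact_closed => //;
      exact: compact_set1.
  - by apply: closed_bigcup; [exact: finite_finset|]; move=> e _; exact: closed_edge.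
  by apply: closed_bigcup; [exact: finite_finset|]; move=> f _; exact: closed_face.
(* P true and P false are complementary because open cells are disjoint. *)
have PC : P true = ~` P false.
  apply/seteqP; split => x.
    case=> z [oz zx zS] [z' [oz' zx' zS']].
    by move: zS'; rewrite -(cell_inj oz oz') ?zS // zx zx'.
  move=> nP; have [z oz zx] := cell_surj x; exists z; split => //.
  by apply/negbNE/negP => /negbTE h; apply: nP; exists z.
have PT : P true = setT.
  apply: connX; first by exists (vmap (c := T) v), (inl v); split => //=; exact: connect0.
    by exists (P true); rewrite ?setTI // PC; exact: closed_openC.
  by exists (P true); rewrite ?setTI.
have [z [oz zw zS]] : P true (vmap (c := T) w) by rewrite PT.
by move: zS; rewrite (cell_inj (z' := inl w) oz I zw).
Qed.

Lemma cells_combinatorial : combinatorial_surface T.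
Proof. by split; [exact: cells_surface|exact: corner_compat|exact: vertices_connected]. Qed.

End CellStructure.

(** * Lifting to a covering space *)

Section Covering.
Variables (R : realType) (Y X : topologicalType) (p : Y -> X).

Definition unique_path_lifting : Prop := forall g1 g2 : R -> Y,
  continuous g1 -> continuous g2 -> (forall s, p (g1 s) = p (g2 s)) ->
  forall s0, g1 s0 = g2 s0 -> forall s, g1 s = g2 s.

Hypothesis covp : covering_map p.

Lemma sheet_inj (S : set Y) (U : set X) : homeo_on S U p ->
  forall a b, S a -> S b -> p a = p b -> a = b.
Proof.
move=> [g [_ [pg _]]] a b Sa Sb e.
by rewrite -(pg a) ?inE // -(pg b) ?inE // e.
Qed.

(** The set where two lifts agree is open and closed: near a given parameter the
    lifts stay in fixed sheets, which are equal or disjoint. *)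
Lemma lift_unique : unique_path_lifting.
Proof.
move=> g1 g2 c1 c2 e s0 es0 s.
have [_ _ ev] := covp.
pose B := [set s | g1 s = g2 s].
have sheetE t : exists (S1 S2 : set Y), [/\ open S1, open S2, S1 (g1 t), S2 (g2 t) &
    forall t', S1 (g1 t') -> S2 (g2 t') -> g1 t = g2 t <-> g1 t' = g2 t'].
  have [U [I [S [oU Ut pU tr hS]]]] := ev (p (g1 t)).
  have [i _ Si] : (\bigcup_i S i) (g1 t) by rewrite -pU.
  have [j _ Sj] : (\bigcup_i S i) (g2 t) by rewrite -pU /= -e.
  exists (S i), (S j); split; [by case: (hS i)|by case: (hS j)|by []|by []|].
  move=> t' S1 S2; split => [et|et].
    have ij : i = j by apply: (tr i j Logic.I Logic.I); exists (g1 t); split => //; rewrite et.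
    by apply: (sheet_inj (proj2 (hS i))) => //; rewrite ij.
  have ij : i = j by apply: (tr i j Logic.I Logic.I); exists (g1 t'); split => //; rewrite et.
  by apply: (sheet_inj (proj2 (hS i))) => //; rewrite ij.
have near_ t : \forall t' \near t, (g1 t = g2 t) <-> (g1 t' = g2 t').
  have [S1 [S2 [op1 op2 h1 h2 h]]] := sheetE t.
  have n1 : \forall t' \near t, S1 (g1 t') by apply: c1; exact: open_nbhs_nbhs.
  have n2 : \forall t' \near t, S2 (g2 t') by apply: c2; exact: open_nbhs_nbhs.
  by near=> t'; apply: h; near: t'.
have oB : open B.
  rewrite openE => t Bt; rewrite /interior; have := near_ t.
  by apply: filterS => t' /= [h _]; exact: h.
have cB : closed B.
  rewrite -openC openE => t Bt; rewrite /interior; have := near_ t.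
  by apply: filterS => t' /= [_ h] /h.
have : B = setT.
  have cR : connected [set: R] by apply/connected_intervalP => ? ? _ _ ? _.
  apply: cR; first by exists s0.
    by exists B; rewrite ?setTI.
  by exists B; rewrite ?setTI.
by move/seteqP => [_ h]; exact: (h s I).
Unshelve. all: by end_near. Qed.

Definition clamp_to (a b x : R) : R := Num.max a (Num.min b x).

Lemma clamp_to_in a b x : a <= b -> a <= clamp_to a b x <= b.
Proof. by move=> ab; rewrite /clamp_to le_max lexx ge_max ab ge_min lexx. Qed.

Lemma clamp_to_id a b x : a <= x <= b -> clamp_to a b x = x.
Proof. by case/andP => ax xb; rewrite /clamp_to (min_idPr xb) (max_idPr ax). Qed.

Lemma cont_clamp_to (Z : topologicalType) (a b : R) (f : Z -> R) : continuous f ->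
  continuous (fun z => clamp_to a b (f z)).
Proof.
by move=> cf; apply: cont_max; [exact: cont_cst|apply: cont_min => //; exact: cont_cst].
Qed.

Definition box (a b c d : R) : set (R * R) :=
  [set z | (a <= z.1 <= b) && (c <= z.2 <= d)].

(** H lifts over the box through every point above it.  Prescribing an arbitrary
    point q of the box makes the property inherited by smaller boxes and stable
    under gluing. *)
Definition liftable (H : R * R -> X) (a b c d : R) : Prop :=
  forall q y, box a b c d q -> p y = H q ->
  exists g : R * R -> Y, [/\ continuous g, forall z, box a b c d z -> p (g z) = H z & g q = y].

Lemma liftable_sub H a b c d a' b' c' d' :
  a <= a' -> b' <= b -> c <= c' -> d' <= d -> liftable H a b c d -> liftable H a' b' c' d'.
Proof.
move=> aa bb cc dd L q y.
have sub z : box a' b' c' d' z -> box a b c d z.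
  case/andP => /andP[h1 h2] /andP[h3 h4]; apply/andP; split; apply/andP; split.
  - exact: le_trans aa h1.
  - exact: le_trans h2 bb.
  - exact: le_trans cc h3.
  exact: le_trans h4 dd.
move=> /sub bq /(L q y bq)[g [cg gl gq]]; exists g; split => // z /sub; exact: gl.
Qed.

(** Lifts over two boxes with a common side agree on that side as soon as they
    agree at one of its points. *)
Lemma liftable_glue H a m b c d : continuous H -> a <= m -> m <= b -> c <= d ->
  liftable H a m c d -> liftable H m b c d -> liftable H a b c d.
Proof.
move=> cH am mb cd L1 L2 q y bq py.
have line z : z.1 = m -> c <= z.2 <= d -> box a m c d z /\ box m b c d z.
  by move=> e h; rewrite /box /= e am mb lexx h.
have glue (g1 g2 : R * R -> Y) : continuous g1 -> continuous g2 ->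
    (forall z, box a m c d z -> p (g1 z) = H z) ->
    (forall z, box m b c d z -> p (g2 z) = H z) -> g1 (m, c) = g2 (m, c) ->
    exists g, [/\ continuous g, forall z, box a b c d z -> p (g z) = H z,
       forall z, box a m c d z -> g z = g1 z & forall z, box m b c d z -> g z = g2 z].
  move=> c1 c2 h1 h2 e.
  pose k (z : R * R) := (z.1, clamp_to c d z.2).
  have ck : continuous k.
    by apply: cont_pair; [move=> z; exact: cvg_fst|apply: cont_clamp_to => z; exact: cvg_snd].
  have kid z : c <= z.2 <= d -> k z = z.
    by move=> h; rewrite /k clamp_to_id // -surjective_pairing.
  have agree s : g1 (m, clamp_to c d s) = g2 (m, clamp_to c d s).
    have cms : continuous (fun s : R => (m, clamp_to c d s)).
      by apply: cont_pair; [exact: cont_cst|apply: cont_clamp_to; exact: cont_id].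
    apply: (@lift_unique (fun s => g1 (m, clamp_to c d s)) (fun s => g2 (m,
      clamp_to c d s)) _ _ _ c).
    - exact: cont_comp cms c1.
    - exact: cont_comp cms c2.
    - move=> t; have [b1 b2] := line (m, clamp_to c d t) erefl (clamp_to_in t cd).
      by rewrite h1 // h2.
    by rewrite clamp_to_id // lexx.
  exists (fun z => if z.1 - m <= 0 then g1 (k z) else g2 (k z)); split.
  - apply: paste; [exact: cont_comp ck c1|exact: cont_comp ck c2| |].
      by apply: contB; [move=> z; exact: cvg_fst|exact: cont_cst].
    by move=> z /eqP; rewrite subr_eq0 /k => /eqP ->.
  - move=> z /andP[/andP[z1 z2] z3]; rewrite kid // subr_le0; case: ifP => h.
      by apply: h1; rewrite /box /= z1 h z3.
    by apply: h2; rewrite /box /= z2 z3 !andbT; move/negbT: h; rewrite -ltNge => /ltW.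
  - by move=> z /andP[/andP[_ z2] z3]; rewrite kid // subr_le0 z2.
  move=> z /andP[/andP[z1 z2] z3]; rewrite kid // subr_le0; case: ifP => // h.
  have zm : z.1 = m by apply/eqP; rewrite eq_le h z1.
  by have := agree z.2; rewrite -zm clamp_to_id // -surjective_pairing.
have [b1 b2] := line (m, c) erefl (introT andP (conj (lexx c) cd)).
have [qm|qm] := lerP q.1 m.
  have bq1 : box a m c d q by case/andP: bq => /andP[h1 h2] h3; rewrite /box /= h1 qm h3.
  have [g1 [c1 h1 e1]] := L1 q y bq1 py.
  have [g2 [c2 h2 e2]] := L2 (m, c) (g1 (m, c)) b2 (h1 _ b1).
  have [g [cg gl g1E _]] := glue g1 g2 c1 c2 h1 h2 (esym e2).
  by exists g; split => //; rewrite g1E.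
have bq2 : box m b c d q by case/andP: bq => /andP[h1 h2] h3; rewrite /box /= h2 h3 ltW.
have [g2 [c2 h2 e2]] := L2 q y bq2 py.
have [g1 [c1 h1 e1]] := L1 (m, c) (g2 (m, c)) b1 (h2 _ b2).
have [g [cg gl _ g2E]] := glue g1 g2 c1 c2 h1 h2 e1.
by exists g; split => //; rewrite g2E.
Qed.

Lemma liftable_swap H a b c d : liftable H a b c d ->
  liftable (fun z => H (z.2, z.1)) c d a b.
Proof.
move=> L q y; rewrite /box /= andbC => bq py.
have [g [cg gl gq]] := L (q.2, q.1) y bq py.
exists (fun z => g (z.2, z.1)); split => //.
  by apply: cont_comp cg; apply: cont_pair => z; [exact: cvg_snd|exact: cvg_fst].
by move=> z; rewrite /= andbC => bz; rewrite gl.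
Qed.

Lemma liftable_glue_y H a b c m d : continuous H -> a <= b -> c <= m -> m <= d ->
  liftable H a b c m -> liftable H a b m d -> liftable H a b c d.
Proof.
move=> cH ab cm md /liftable_swap L1 /liftable_swap L2.
have cH' : continuous (fun z : R * R => H (z.2, z.1)).
  by apply: cont_comp cH; apply: cont_pair => z; [exact: cvg_snd|exact: cvg_fst].
have /liftable_swap := liftable_glue cH' cm md ab L1 L2.
rewrite /liftable => L q y bq py.
have [g [cg gl gq]] := L q y bq (etrans py (congr1 H (surjective_pairing q))).
by exists g; split => // z /gl ->; rewrite /= -surjective_pairing.
Qed.

(** A small box is mapped into an evenly covered set. *)
Lemma liftable_local H (z0 : R * R) : continuous H ->
  exists2 e, 0 < e & liftable H (z0.1 - e) (z0.1 + e) (z0.2 - e) (z0.2 + e).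
Proof.
move=> cH; have [_ _ ev] := covp.
have [U [I [S [oU Ut pU tr hS]]]] := ev (H z0).
have /nbhs_ballP[e /= e0 be] : nbhs z0 (H @^-1` U) by apply: cH; exact: open_nbhs_nbhs.
exists (e / 2); first by rewrite divr_gt0.
move=> q y bq py.
set a := z0.1 - e / 2; set b := z0.1 + e / 2; set c := z0.2 - e / 2; set d := z0.2 + e / 2.
have ab : a <= b by rewrite /a /b; lra.
have cd : c <= d by rewrite /c /d; lra.
have inU z : box a b c d z -> U (H z).
  move=> /andP[/andP[h1 h2] /andP[h3 h4]]; apply: be; split.
    by rewrite /ball /= ltr_norml; apply/andP; move: h1 h2; rewrite /a /b; split; lra.
  by rewrite /ball /= ltr_norml; apply/andP; move: h3 h4; rewrite /c /d; split; lra.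
have [i _ Si] : (\bigcup_i S i) y by rewrite -pU /= py; exact: inU.
have [oS [s [[cp cs sp ss] [ps sp']]]] := hS i.
pose k (z : R * R) := (clamp_to a b z.1, clamp_to c d z.2).
have ck : continuous k.
  apply: cont_pair; first by apply: cont_clamp_to => z; exact: cvg_fst.
  by apply: cont_clamp_to => z; exact: cvg_snd.
have kb z : box a b c d (k z) by rewrite /box /k /= !clamp_to_in.
have kid z : box a b c d z -> k z = z.
  by case/andP => h1 h2; rewrite /k !clamp_to_id // -surjective_pairing.
exists (fun z => s (H (k z))); split.
- apply: (@within_comp (R * R)%type X Y U s (fun z => H (k z))) => //.
    exact: cont_comp ck cH.
  by move=> z; apply: inU.
- by move=> z bz; rewrite kid // sp' // inE; exact: inU.
by rewrite kid // -py ps // inE.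
Qed.

(** A property of intervals that is additive and holds for small intervals
    around each point holds for [0, 1].  The supremum of the t for which it holds
    on [0, t] is 1. *)
Lemma interval_induction (P : R -> R -> Prop) :
    (forall a m b, a <= m -> m <= b -> P a m -> P m b -> P a b) ->
    (forall x, exists2 e, 0 < e &
       forall a b, x - e <= a -> a <= x -> x <= b -> b <= x + e -> P a b) ->
  P 0 1.
Proof.
move=> glue loc.
pose E := [set t : R | 0 <= t <= 1 /\ P 0 t].
have E0 : E 0.
  split; first by rewrite lexx ler01.
  by have [e e0 h] := loc 0; apply: h; lra.
have ubE : has_ubound E by exists 1 => t [/andP[]].
have supE : has_sup E by split => //; exists 0.
have s0 : 0 <= sup E by apply: ub_le_sup.
have s1 : sup E <= 1 by apply: ge_sup; [exists 0|move=> t [/andP[]]].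
have [e e0 h] := loc (sup E).
have [t [/andP[t0 t1] Pt] ts] := sup_adherent e0 supE.
have tle : t <= sup E by apply: ub_le_sup => //; split => //; rewrite t0.
pose b := Num.min (sup E + e) 1.
have sb : sup E <= b by rewrite /b le_min s1 andbT lerDl ltW.
have be : b <= sup E + e by rewrite /b ge_min lexx.
have b1 : b <= 1 by rewrite /b ge_min lexx orbT.
have Pb : P 0 b.
  apply: (glue 0 t b) => //; first exact: le_trans tle sb.
  by apply: h => //; exact: ltW.
have bs : b <= sup E by apply: ub_le_sup => //; split => //; rewrite b1 (le_trans s0).
suff <- : b = 1 by [].
move: bs; rewrite /b; case: (lerP (sup E + e) 1) => // h2; lra.
Qed.

(** [interval_induction] in the second variable lifts H over a thin strip, and
    then in the first variable over the square. *)
Lemma liftable_square H : continuous H -> liftable H 0 1 0 1.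
Proof.
move=> cH; apply: (@interval_induction (fun a b => liftable H a b 0 1)).
  by move=> a m b am mb; apply: liftable_glue.
move=> x.
have [e e0 L] : exists2 e, 0 < e & liftable H (x - e) (x + e) 0 1.
  apply: (@interval_induction (fun c d => exists2 e, 0 < e & liftable H (x - e) (x + e) c d)).
    move=> c m d cm md [e1 e10 L1] [e2 e20 L2].
    exists (Num.min e1 e2); first by rewrite lt_min e10.
    have m1 : Num.min e1 e2 <= e1 by rewrite ge_min lexx.
    have m2 : Num.min e1 e2 <= e2 by rewrite ge_min lexx orbT.
    have m0 : 0 < Num.min e1 e2 by rewrite lt_min e10.
    apply: (liftable_glue_y cH _ cm md); first by lra.
      by apply: liftable_sub L1 => //; lra.
    by apply: liftable_sub L2 => //; lra.
  move=> y; have [e e0 L] := liftable_local (x, y) cH.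
  exists e => // c d h1 h2 h3 h4; exists e => //.
  by apply: liftable_sub L.
exists e => // a b h1 h2 h3 h4.
by apply: liftable_sub L.
Qed.

End Covering.

(** * Simplicial families of triangles *)

Section Simplicial.
Variables (R : realType) (X : topologicalType) (T : cell_division R X).
Hypothesis Ksurf : combinatorial_surface T.
Implicit Types (d : dart T) (v w : vert T) (x : flag T).

Notation fl := (@flag_from R X T).

Lemma corner_inj : injective (@corner R).
Proof.
move=> i j; rewrite /corner => -[].
by case: i j => -[|[|[|]]] // ? [[|[|[|]]] // ?] /=; rewrite ?mulr0n ?mulr1n => e1 e2;
   try (exfalso; lra); apply/val_inj.
Qed.

Lemma flag_from_simplex x : simplex (fl x).
Proof. exact: corner_simplex. Qed.

Lemma flag_from_neq x : fl x <> fl (flip x).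
Proof.
move=> /corner_inj; case: x => -[f i] [] /=; rewrite /flag_corner /=.
  by move/eqP; rewrite (negbTE (ordS_neq _)).
by move/esym/eqP; rewrite (negbTE (ordS_neq _)).
Qed.

Lemma fmap_flag_from x : Defs.fmap (c := T) x.1.1 (fl x) = vmap (c := T) (org (flag_dart x)).
Proof. by rewrite (org_flag_dart Ksurf) /flag_from fmap_corner; case: x => -[f i] b. Qed.

Lemma side_simplex i (u : R * R) : simplex_side i u -> simplex u.
Proof.
case=> s s01 <-; rewrite -/(flag_segment ((_, i), false) s).
exact: simplex_convex (corner_simplex _ _) (corner_simplex _ _) s01.
Qed.

Lemma corner_in_side (i j : 'I_3) : simplex_side i (corner R j) -> j = i \/ j = ordS i.
Proof.
case=> s _; have [h0 h1 h2] := side_point_coord s.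
case: i j => -[|[|[|]]] // pi [[|[|[|]]] // pj];
  rewrite ?(bool_irrelevance pi isT); try (by left; apply/val_inj); try (by right; apply/val_inj).
- by rewrite h0 /corner /= ?mulr0n ?mulr1n => -[] e1 e2; clear h0 h1 h2; exfalso; lra.
- by rewrite h1 /corner /= ?mulr0n ?mulr1n => -[] e1 e2; clear h0 h1 h2; exfalso; lra.
by rewrite h2 /corner /= ?mulr0n ?mulr1n => -[] e1 e2; clear h0 h1 h2; exfalso; lra.
Qed.

(** A side contains no corners but its two ends. *)
Lemma side_of_flag i x : simplex_side i (fl x) -> simplex_side i (fl (flip x)) -> x.1.2 = i.
Proof.
move=> /corner_in_side h1 /corner_in_side h2; move: h1 h2.
have n1 := ordS_neq i; have n2 := ordSS_neq i.
case: x => -[f j] [] /=; rewrite /flag_corner /=.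
  move=> h1 [//|ji]; rewrite ji in h1; case: h1 => /eqP; first by rewrite (negbTE n2).
  by rewrite (negbTE (ordS_neq _)).
move=> [//|ji] h1; rewrite ji in h1; case: h1 => /eqP; first by rewrite (negbTE n2).
by rewrite (negbTE (ordS_neq _)).
Qed.

Lemma flag_corners_inj x y : flag_corner x = flag_corner y ->
  flag_corner (flip x) = flag_corner (flip y) -> x = y.
Proof.
case: x y => -[f i] b [[g j] c]; rewrite /flag_corner /= => e1 e2.
have fg : f = g by have := congr1 fst e1.
have := congr1 snd e1; have := congr1 snd e2; rewrite fg /=.
case: b c {e1 e2} => -[] /= k2 k1.
- by rewrite k2.
- by have := ordSS_neq i; rewrite k1 -k2 eqxx.
- by have := ordSS_neq i; rewrite k2 -k1 eqxx.
by rewrite k1.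
Qed.

Lemma edge_point_open (e e' : edge T) (s t : R) : s \in `]0, 1[ -> t \in `[0, 1] ->
  emap (c := T) e s = emap (c := T) e' t -> e = e' /\ s = t.
Proof.
move=> s01 t01 E; case: (@edge_pointP R X T e' t t01) => [t01'|[d _ dt]].
  by have [] := @cell_inj R X T (inr (inl (e, s))) (inr (inl (e', t))) s01 t01' E.
by have := @cell_inj R X T (inr (inl (e, s))) (inl (org d)) s01 Logic.I (etrans E dt).
Qed.

Lemma face_point_open (f f' : face T) (u u' : R * R) : open_simplex u -> simplex u' ->
  Defs.fmap (c := T) f u = Defs.fmap (c := T) f' u' -> f = f' /\ u = u'.
Proof.
move=> ou su' E; case: (simplexP su') => [ou'|[i [s [s01 es]]]].
  by have [] := @cell_inj R X T (inr (inr (f, u))) (inr (inr (f', u'))) ou ou' E.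
exfalso; move: E; rewrite es fmap_side //; set t := (if _ then _ else _) => E.
have t01 : t \in `[0, 1].
  rewrite /t; case: ifP => // _; move: s01; rewrite !in_itv /= => /andP[a b].
  by apply/andP; split; lra.
case: (@edge_pointP R X T (side f' i).1 t t01) => [t01'|[d _ dt]].
  have := @cell_inj R X T (inr (inr (f, u))) (inr (inl ((side f' i).1, t))) ou t01' E.
  by [].
by have := @cell_inj R X T (inr (inr (f, u))) (inl (org d)) ou Logic.I (etrans E dt).
Qed.

Lemma flag_segment_half x : flag_segment x (1 / 2) = side_point x.1.2 (1 / 2).
Proof.
have e : 1 - 1 / 2 = 1 / 2 :> R by lra.
case: x => -[f i] [] //=; rewrite -[((f, i), true)]/(flip ((f, i), false)) flag_segment_flip e.
by [].
Qed.

Section Lifts.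
Variables (Y : topologicalType) (p : Y -> X).
Hypothesis upl : @unique_path_lifting R Y X p.

(** A singular triangle in Y above the triangle f.  With p the identity this
    covers the triangles of X itself. *)
Definition lift_of (f : face T) (a : R * R -> Y) : Prop :=
  {within @simplex R, continuous a} /\
  forall u, simplex u -> p (a u) = Defs.fmap (c := T) f u.

Lemma lift_retract_cont f a : lift_of f a -> continuous (fun u => a (simplex_retract u)).
Proof.
move=> [ca _]; apply: (@within_comp (R * R)%type (R * R)%type Y (@simplex R) a) => //.
  exact: simplex_retract_cont.
exact: simplex_retract_in.
Qed.

(** Unique path lifting along two paths in the simplex with the same image in
    X. *)
Lemma lifts_agree f1 f2 a1 a2 (l1 l2 : R -> R * R) s0 :
    lift_of f1 a1 -> lift_of f2 a2 -> continuous l1 -> continuous l2 ->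
    (forall s, s \in `[0, 1] -> simplex (l1 s)) ->
    (forall s, s \in `[0, 1] -> simplex (l2 s)) ->
    (forall s, s \in `[0, 1] ->
       Defs.fmap (c := T) f1 (l1 s) = Defs.fmap (c := T) f2 (l2 s)) ->
    s0 \in `[0, 1] -> a1 (l1 s0) = a2 (l2 s0) ->
  forall s, s \in `[0, 1] -> a1 (l1 s) = a2 (l2 s).
Proof.
move=> h1 h2 c1 c2 s1 s2 e s001 e0 s s01.
have cc : continuous (fun s : R => clamp s) by apply: cont_clamp; exact: cont_id.
pose g1 s := a1 (simplex_retract (l1 (clamp s))); pose g2 s := a2 (simplex_retract (l2 (clamp s))).
have k1 : continuous g1.
  by apply: cont_comp (lift_retract_cont h1); exact: cont_comp cc c1.
have k2 : continuous g2.
  by apply: cont_comp (lift_retract_cont h2); exact: cont_comp cc c2.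
have E t : p (g1 t) = p (g2 t).
  have t01 := clamp01 t; rewrite /g1 /g2.
  rewrite (simplex_retract_id (s1 _ t01)) (simplex_retract_id (s2 _ t01)).
  have [_ q1] := h1; have [_ q2] := h2.
  by rewrite (q1 _ (s1 _ t01)) (q2 _ (s2 _ t01)) e.
have G t : t \in `[0, 1] -> g1 t = a1 (l1 t) /\ g2 t = a2 (l2 t).
  by move=> t01; rewrite /g1 /g2 clamp_id // (simplex_retract_id (s1 _ t01)) (simplex_retract_id
    (s2 _ t01)).
have [G1 G2] := G _ s01; have [G3 G4] := G _ s001.
by rewrite -G1 -G2; apply: (upl k1 k2 E (s0 := s0)); rewrite G3 G4.
Qed.

(** Two triangles of a simplicial family with two common vertices share the edge
    between them.  If their images coincide, they lift the same triangle, agree at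
    its centre and hence at the corners.  If they meet in a side, this is the edge
    in question for both, and midpoints of the sides correspond.  If the two edges
    had opposite orientations, then unique path lifting from the midpoint would
    identify their end points. *)
Lemma simplicial_edge (F : set (R * R -> Y)) a1 a2 x1 x2 :
    simplicial F -> F a1 -> F a2 -> lift_of x1.1.1 a1 -> lift_of x2.1.1 a2 ->
    a1 (fl x1) = a2 (fl x2) -> a1 (fl (flip x1)) = a2 (fl (flip x2)) ->
  flag_dart x1 = flag_dart x2.
Proof.
move=> [inj meet] F1 F2 l1 l2 e0 e1.
have inj1 := inj _ F1; have inj2 := inj _ F2.
have i1 u u' : simplex u -> simplex u' -> a1 u = a1 u' -> u = u'.
  by move=> su su'; apply: inj1; rewrite inE.
have i2 u u' : simplex u -> simplex u' -> a2 u = a2 u' -> u = u'.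
  by move=> su su'; apply: inj2; rewrite inE.
have ne : a1 (fl x1) <> a1 (fl (flip x1)).
  by move/(i1 _ _ (flag_from_simplex _) (flag_from_simplex _)); exact: flag_from_neq.
have im1 x : (a1 @` @simplex R) (a1 (fl x)) by exists (fl x) => //; exact: flag_from_simplex.
have im2 x : (a2 @` @simplex R) (a2 (fl x)) by exists (fl x) => //; exact: flag_from_simplex.
have M0 : ((a1 @` @simplex R) `&` (a2 @` @simplex R)) (a1 (fl x1)).
  by split; [exact: im1|rewrite e0; exact: im2].
have M1 : ((a1 @` @simplex R) `&` (a2 @` @simplex R)) (a1 (fl (flip x1))).
  by split; [exact: im1|rewrite e1; exact: im2].
case: (meet a1 a2 F1 F2) => /=.
- (* An inner point, to recognize the triangle and its parametrization. *)
  move=> E; pose m : R * R := (1 / 3, 1 / 3).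
  have om : open_simplex m by rewrite /open_simplex /=; split; lra.
  have sm : simplex m by case: om => a b c; split; apply: ltW.
  have [u su au] : (a1 @` @simplex R) (a2 m) by rewrite E; exists m.
  have [ff um] : x2.1.1 = x1.1.1 /\ m = u.
    by apply: face_point_open => //; rewrite -(proj2 l2) // -au (proj2 l1).
  rewrite -um in au.
  have cor k : a1 (corner R k) = a2 (corner R k).
    pose l (s : R) := ((1 - s) * m.1 + s * (corner R k).1, (1 - s) * m.2 + s * (corner R k).2).
    have cl : continuous l.
      by apply: cont_pair; apply: contD; apply: contM;
        first [exact: cont_1m | exact: cont_cst | exact: cont_id].
    have sl s : s \in `[0, 1] -> simplex (l s).
      by apply: simplex_convex => //; exact: corner_simplex.
    have l1_ : l 1 = corner R k.
      by rewrite /l subrr !mul0r !mul1r !add0r -surjective_pairing.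
    rewrite -l1_; apply: (lifts_agree (s0 := 0) l1 l2 cl cl sl sl).
    + by move=> s _; rewrite ff.
    + by rewrite in_itv /= lexx ler01.
    + by rewrite /l subr0 !mul0r !mul1r !addr0.
    by rewrite in_itv /= lexx ler01.
  congr flag_dart; apply: flag_corners_inj.
    have : fl x1 = fl x2.
      by apply: i1; rewrite ?e0 ?cor //; exact: flag_from_simplex.
    move/corner_inj => h; rewrite (surjective_pairing (flag_corner x1)) h.
    by rewrite /flag_corner /= ff.
  have : fl (flip x1) = fl (flip x2).
    by apply: i1; rewrite ?e1 ?cor //; exact: flag_from_simplex.
  move/corner_inj => h; rewrite (surjective_pairing (flag_corner (flip x1))) h.
  by rewrite /flag_corner /= ff.
- by move=> E; rewrite E in M0.
- case=> i [j [E _]]; rewrite E in M0 M1.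
  by case: ne; rewrite M0 M1.
case=> i [j [E1 E2]].
have onside1 x : ((a1 @` @simplex R) `&` (a2 @` @simplex R)) (a1 (fl x)) -> simplex_side i (fl x).
  rewrite E1 => -[u su au]; suff <- : u = fl x by [].
  by apply: i1 => //; [exact: side_simplex su|exact: flag_from_simplex].
have onside2 x : ((a1 @` @simplex R) `&` (a2 @` @simplex R)) (a2 (fl x)) -> simplex_side j (fl x).
  rewrite E2 => -[u su au]; suff <- : u = fl x by [].
  by apply: i2 => //; [exact: side_simplex su|exact: flag_from_simplex].
have x1i : x1.1.2 = i by apply: side_of_flag; apply: onside1.
have x2j : x2.1.2 = j by apply: side_of_flag; apply: onside2; rewrite -?e0 -?e1.
have h01 : (1 / 2 : R) \in `[0, 1] by rewrite in_itv /=; apply/andP; split; lra.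
have h01' : (1 / 2 : R) \in `]0, 1[ by rewrite in_itv /=; apply/andP; split; lra.
have [u [t t01 ut] au] : (a2 @` @simplex_side R j) (a1 (side_point i (1 / 2))).
  by rewrite -E2 E1; exists (side_point i (1 / 2)) => //; exists (1 / 2).
have hh (b : bool) : (if b then 1 - 1 / 2 else 1 / 2) = 1 / 2 :> R by case: b; lra.
have [ee th] : (side x1.1.1 i).1 = (side x2.1.1 j).1 /\ t = 1 / 2.
  have := congr1 p au; rewrite -ut.
  rewrite (proj2 l2); last by rewrite ut; apply: side_simplex; exists t; [exact: t01|exact: ut].
  rewrite (proj2 l1); last by apply: side_simplex; exists (1 / 2).
  rewrite !fmap_side // hh => /esym; set t' := (if _ then _ else _) => E.
  have t01' : t' \in `[0, 1].
    rewrite /t'; case: ifP => // _; move: (t01); rewrite /= !in_itv /= => /andP[a b].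
    by apply/andP; split; lra.
  have [-> th'] := edge_point_open h01' t01' E; split => //.
  by move: th'; rewrite /t'; case: ifP => _; lra.
have ed : (flag_dart x1).1 = (flag_dart x2).1 by rewrite /flag_dart /= x1i x2j.
have [//|er] : flag_dart x1 = flag_dart x2 \/ flag_dart x1 = flag_dart (flip x2).
  by rewrite flag_dart_flip; exact: same_edge.
exfalso; apply: ne; rewrite e1 -(flag_segment0 x1).
have -> : fl (flip x2) = flag_segment (flip x2) 0 by rewrite flag_segment0.
apply: (lifts_agree (s0 := 1 / 2) l1 l2 (@flag_segment_cont _ _ _ x1) (@flag_segment_cont _ _ _
  (flip x2))) => //.
- by move=> s; exact: flag_segment_simplex.
- by move=> s; exact: flag_segment_simplex.
- by move=> s s01; rewrite fmap_segment // -[x2.1.1]/((flip x2).1.1) fmap_segment // er.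
- by rewrite !flag_segment_half x1i /= x2j -au -ut th.
by rewrite in_itv /= lexx ler01.
Qed.

End Lifts.
End Simplicial.

(** * Edge loops in triangulations *)

Section Triangulation.
Variables (R : realType) (X : topologicalType) (T : cell_division R X).
Hypothesis Ksurf : combinatorial_surface T.
Hypothesis triT : is_triangulation T.
Implicit Types (d : dart T) (x : flag T).

Notation fl := (@flag_from R X T).

Lemma triangulation_no_loop d : dest d != org d.
Proof.
apply/eqP => e; have [x xd] := flag_dart_surj Ksurf d.
have [inj _] := triT.
apply: (@flag_from_neq R X T x); apply: (inj (Defs.fmap (c := T) x.1.1)).
- by exists x.1.1.
- by rewrite inE; exact: flag_from_simplex.
- by rewrite inE; exact: flag_from_simplex.
have -> : x.1.1 = (flip x).1.1 by [].
rewrite (fmap_flag_from Ksurf (flip x)) -[(flip x).1.1]/(x.1.1) (fmap_flag_from Ksurf).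
by rewrite flag_dart_flip xd -[org (rev_dart d)]/(dest d) e.
Qed.

Lemma triangulation_simple d d' : org d = org d' -> dest d = dest d' -> d = d'.
Proof.
move=> eo ee; have [x xd] := flag_dart_surj Ksurf d; have [x' xd'] := flag_dart_surj Ksurf d'.
have lift f : lift_of id f (Defs.fmap (c := T) f) by split => //; exact: fmap_continuous.
have upl : @unique_path_lifting R X X id by move=> g1 g2 _ _ e s0 _ s; exact: e.
rewrite -xd -xd'; apply: (simplicial_edge upl triT (a1 := Defs.fmap (c := T) x.1.1)
  (a2 := Defs.fmap (c := T) x'.1.1)); [| |exact: lift|exact: lift| |].
- by exists x.1.1.
- by exists x'.1.1.
- by rewrite !(fmap_flag_from Ksurf) xd xd' eo.
rewrite -[x.1.1]/((flip x).1.1) -[x'.1.1]/((flip x').1.1) !(fmap_flag_from Ksurf).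
by rewrite !flag_dart_flip xd xd' -[org _]/(dest d) ee.
Qed.

End Triangulation.

Section GeneralizedTriangulation.
Variables (R : realType) (X Y : topologicalType) (T : cell_division R X) (p : Y -> X).
Hypothesis Ksurf : combinatorial_surface T.
Hypothesis covp : covering_map p.
Hypothesis simp : simplicial (lifted_triangles p T).
Implicit Types (d : dart T) (x : flag T).

Notation fl := (@flag_from R X T).

Lemma lifts_eq (g1 g2 : R -> Y) (s0 s : R) : continuous g1 -> continuous g2 ->
  (forall t, p (g1 t) = p (g2 t)) -> g1 s0 = g2 s0 -> g1 s = g2 s.
Proof. by move=> c1 c2 e e0; exact: (lift_unique covp c1 c2 e e0). Qed.

Lemma simplex_box (u : R * R) : simplex u -> box 0 1 0 1 u.
Proof.
case=> a b ab; apply/andP; split; apply/andP; split => //.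
  by apply: le_trans ab; rewrite lerDl.
by apply: le_trans ab; rewrite lerDr.
Qed.

(** The triangle is extended to the square by the retraction and lifted there. *)
Lemma lift_triangle x y0 : p y0 = vmap (c := T) (org (flag_dart x)) ->
  exists a, [/\ lifted_triangles p T a, lift_of p x.1.1 a & a (fl x) = y0].
Proof.
move=> py.
have L := liftable_square covp (@face_retract_cont R X T x.1.1).
have sx := flag_from_simplex x.
have [a [ca la ax]] := L (fl x) y0 (simplex_box sx)
  (etrans py (esym (etrans (congr1 _ (simplex_retract_id sx)) (fmap_flag_from Ksurf x)))).
have cS : {within @simplex R, continuous a} by exact: continuous_subspaceT.
have lS u : simplex u -> p (a u) = Defs.fmap (c := T) x.1.1 u.
  by move=> su; rewrite la ?simplex_retract_id //; exact: simplex_box.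
by exists a; split => //; split => //; exists x.1.1.
Qed.

(** A lift of a dart is a side of a lift of each adjacent triangle. *)
Lemma lift_dart x (g : R -> Y) : continuous g ->
    (forall s, p (g s) = dart_map (flag_dart x) (clamp s)) ->
  exists a, [/\ lifted_triangles p T a, lift_of p x.1.1 a, a (fl x) = g 0 &
                a (fl (flip x)) = g 1].
Proof.
move=> cg pg.
have s01 (b : bool) : (b%:R : R) \in `[0, 1] by rewrite in_itv /= ler0n lern1 leq_b1.
have pg0 : p (g 0) = vmap (c := T) (org (flag_dart x)).
  by rewrite pg clamp0 -dart_pathE ?dart_path0 //; exact: (s01 false).
have [a [Fa la ax]] := lift_triangle pg0.
exists a; split => //.
have cs : continuous (fun s => a (simplex_retract (flag_segment x (clamp s)))).
  apply: cont_comp (lift_retract_cont la).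
  by apply: cont_comp (@flag_segment_cont R X T x); apply: cont_clamp; exact: cont_id.
have E s : a (simplex_retract (flag_segment x (clamp s))) = g s.
  apply: (lifts_eq (g1 := fun s => a (simplex_retract (flag_segment x (clamp s)))) (s0
    := 0) _ cs cg).
    move=> t; have t01 := clamp01 t; have st := flag_segment_simplex x t01.
    by rewrite pg (simplex_retract_id st); have [_ ->] := la; rewrite ?fmap_segment.
  by rewrite clamp0 flag_segment0 simplex_retract_id //; exact: flag_from_simplex.
by rewrite -E clamp1 flag_segment1 simplex_retract_id //; exact: flag_from_simplex.
Qed.

(** A null homotopy is lifted over the square.  On three sides of the square it
    is constant, so there the lift is constant too, and the remaining side is a
    closed lift of c. *)
Lemma null_lift (c : R -> X) : null_homotopic c ->
  exists g : R -> Y, [/\ continuous g, forall s, p (g s) = c (clamp s) & g 0 = g 1].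
Proof.
move=> [H [cH h0 g0 g1 h1]].
pose K z := H (clamp z.1, clamp z.2).
have cK : continuous K.
  apply: (@within_comp (R * R)%type (R * R)%type X (`[0, 1] `*` `[0, 1]) H
     (fun z => (clamp z.1, clamp z.2))) => //.
    by apply: cont_pair; apply: cont_clamp => z; [exact: cvg_fst|exact: cvg_snd].
  by move=> z; split; exact: clamp01.
have [_ surj _] := covp.
have [y0 _ py0] := surj (c 0) Logic.I.
have b01 : (0 : R) \in `[0, 1] by rewrite in_itv /= lexx ler01.
have b11 : (1 : R) \in `[0, 1] by rewrite in_itv /= lexx ler01.
have K0 s : K (s, 0) = c (clamp s) by rewrite /K /= clamp0 h0 ?clamp01.
have K1 s : K (s, 1) = c 0 by rewrite /K /= clamp1 h1 ?clamp01.
have L0 t : K (0, t) = c 0 by rewrite /K /= clamp0 g0 ?clamp01.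
have L1 t : K (1, t) = c 0 by rewrite /K /= clamp1 g1 ?clamp01.
have bx0 : box 0 1 0 1 ((0, 0) : R * R) by rewrite /box /= lexx ler01.
have [G [cG lG G0]] := liftable_square covp cK bx0 (etrans py0 (esym (L0 0))).
have inb (a b : R) : box 0 1 0 1 (clamp a, clamp b).
  by rewrite /box /=; move: (clamp01 a) (clamp01 b); rewrite !in_itv /= => -> ->.
have cc : continuous (fun s : R => clamp s) by apply: cont_clamp; exact: cont_id.
have cy0 : continuous (fun _ : R => y0) by exact: cont_cst.
have E0 t : p (G (0, clamp t)) = p y0.
  by have := lG _ (inb 0 t); rewrite clamp0 => ->; rewrite L0.
have E1 t : p (G (clamp t, 1)) = p y0.
  by have := lG _ (inb t 1); rewrite clamp1 => ->; rewrite K1.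
have E2 t : p (G (1, clamp t)) = p y0.
  by have := lG _ (inb 1 t); rewrite clamp1 => ->; rewrite L1.
have E3 t : p (G (clamp t, 0)) = c (clamp t).
  by have := lG _ (inb t 0); rewrite clamp0 => ->; rewrite K0 clamp_clamp.
have side0 t : G (0, clamp t) = y0.
  apply: (lifts_eq (g1 := fun t => G (0, clamp t)) (s0 := 0) _ _ cy0).
  - by apply: cont_comp cG; apply: cont_pair => //; exact: cont_cst.
  - exact: E0.
  by rewrite clamp0.
have side1 t : G (clamp t, 1) = y0.
  apply: (lifts_eq (g1 := fun t => G (clamp t, 1)) (s0 := 0) _ _ cy0).
  - by apply: cont_comp cG; apply: cont_pair => //; exact: cont_cst.
  - exact: E1.
  by rewrite clamp0; have := side0 1; rewrite clamp1.
have side2 t : G (1, clamp t) = y0.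
  apply: (lifts_eq (g1 := fun t => G (1, clamp t)) (s0 := 1) _ _ cy0).
  - by apply: cont_comp cG; apply: cont_pair => //; exact: cont_cst.
  - exact: E2.
  by rewrite clamp1; have := side1 1; rewrite clamp1.
exists (fun s => G (clamp s, 0)); split.
- by apply: cont_comp cG; apply: cont_pair => //; exact: cont_cst.
- exact: E3.
by rewrite clamp0 clamp1 G0; have := side2 0; rewrite clamp0.
Qed.

(** It would lift to a closed side of an embedded triangle. *)
Lemma no_null_loop1 d : ~ null_homotopic_edge_loop [:: d].
Proof.
move=> [_ _ nl]; have [x xd] := flag_dart_surj Ksurf d.
have [g [cg pg g01]] := null_lift nl.
have pgx s : p (g s) = dart_map (flag_dart x) (clamp s) by rewrite pg /= mulr1 xd.
have [a [Fa la a0 a1]] := lift_dart cg pgx.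
have [inj _] := simp.
apply: (@flag_from_neq R X T x); apply: (inj a Fa).
- by rewrite inE; exact: flag_from_simplex.
- by rewrite inE; exact: flag_from_simplex.
by rewrite a0 a1.
Qed.

(** It would lift to two edges with the same end points.  By [simplicial_edge]
    these coincide, so the loop backtracks. *)
Lemma no_null_loop2 d d' : ~ null_homotopic_edge_loop [:: d; d'].
Proof.
move=> [/= /and3P[/eqP ch _ _] /and3P[nb _ _] nl].
have [x xd] := flag_dart_surj Ksurf d; have [x' xd'] := flag_dart_surj Ksurf d'.
have [g [cg pg g01]] := null_lift nl.
have cc : continuous (fun s : R => clamp s) by apply: cont_clamp; exact: cont_id.
have b01 : (0 : R) \in `[0, 1] by rewrite in_itv /= lexx ler01.
have b11 : (1 : R) \in `[0, 1] by rewrite in_itv /= lexx ler01.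
pose g1 s := g (clamp s / 2); pose g2 s := g (clamp s / 2 + 1 / 2).
have ch2 : continuous (fun s : R => clamp s / 2) by apply: contM => //; exact: cont_cst.
have c1 : continuous g1 by apply: cont_comp ch2 cg.
have c2 : continuous g2.
  by apply: cont_comp cg; apply: contD => //; exact: cont_cst.
have pg1 s : p (g1 s) = dart_map (flag_dart x) (clamp s).
  have := clamp01 s; rewrite in_itv /= => /andP[s0 s1].
  rewrite /g1 pg /= clamp_id; last by rewrite in_itv /=; apply/andP; split; lra.
  by rewrite divfK // s1 xd.
have pg2 s : p (g2 s) = dart_map (flag_dart x') (clamp s).
  have := clamp01 s; rewrite in_itv /= => /andP[s0 s1].
  rewrite /g2 pg /= clamp_id; last by rewrite in_itv /=; apply/andP; split; lra.
  have -> : (clamp s / 2 + 1 / 2) * 2%:R = clamp s + 1 by field.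
  rewrite addrK; case: ifP => h; last by rewrite xd'.
  have -> : clamp s = 0 by lra.
  by rewrite add0r -!dart_pathE // dart_path0 dart_path1 xd' -ch.
have [a1 [F1 l1 a10 a11]] := lift_dart c1 pg1.
have [a2 [F2 l2 a20 a21]] := lift_dart c2 pg2.
have e0 : g1 0 = g2 1.
  rewrite /g1 /g2 clamp0 clamp1 mul0r (_ : 1 / 2 + 1 / 2 = 1) //; lra.
have e1 : g1 1 = g2 0 by rewrite /g1 /g2 clamp0 clamp1 mul0r add0r.
have := simplicial_edge (lift_unique covp) simp F1 F2 l1 (x2 := flip x') l2.
rewrite flipK a10 a11 a20 a21 => /(_ e0 e1).
rewrite flag_dart_flip xd xd' => dd.
by move: nb; rewrite dd rev_dartK eqxx.
Qed.

End GeneralizedTriangulation.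

Theorem proposition1p3 (R : realType) (X : topologicalType)
    (surfX : closed_surface R X) (connX : connected [set: X]) :
  (forall (T : cell_division R X) (Phi : edge T -> R),
     (0 < chi T)%R ->
     is_generalized_triangulation T ->
     is_weight Phi ->
     ~ (exists p : seq (dart T),
          [/\ size p = 3%N, null_homotopic_edge_loop p &
              pi <= weight_sum Phi p]) ->
     condition_star Phi) /\
  (forall (T : cell_division R X) (Phi : edge T -> R),
     chi T = 0 ->
     is_triangulation T ->
     is_weight Phi ->
     (forall p : seq (dart T),
        size p = 3%N -> null_homotopic_edge_loop p ->
        pi <= weight_sum Phi p ->
        bounds_triangle (edges_of p)) ->
     (forall p : seq (dart T),
        size p = 4%N -> null_homotopic_edge_loop p ->
        2 * pi <= weight_sum Phi p ->
        bounds_two_triangles (edges_of p)) ->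
     condition_star Phi).
Proof.
have [hausX _ _] := surfX.
split => T Phi chiT triT wPhi.
  move=> no3; have Ksurf := cells_combinatorial T hausX connX.
  have [Y [p [[covp _] simp]]] := triT.
  apply: (star_positive Ksurf wPhi chiT) => q v qw nb q0 qh sz.
  have nl := walk_equiv_null_loop Ksurf q0 qw nb qh.
  have s3 : size q = 3%N.
    case: q q0 nl sz {qw nb qh} => [|d [|d' [|d'' [|]]]] //= _ nl _.
      by have := no_null_loop1 Ksurf covp simp nl.
    by have := no_null_loop2 Ksurf covp simp nl.
  split => //; rewrite ltNge; apply/negP => h; apply: no3.
  by exists q.
move=> tri3 tri4; have Ksurf := cells_combinatorial T hausX connX.
apply: (star_zero Ksurf wPhi chiT (triangulation_no_loop Ksurf triT)
   (triangulation_simple Ksurf triT)) => q v sz qw nb qh.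
  by apply: tri3 => //; apply: (walk_equiv_null_loop Ksurf _ qw nb qh); case: q sz {qw nb qh}.
by apply: tri4 => //; apply: (walk_equiv_null_loop Ksurf _ qw nb qh); case: q sz {qw nb qh}.
Qed.
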